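(* Let $\mathfrak b\in\{-1,0,1\}$ and $s<-2$. Consider the Cauchy problem for the Kawahara equation $$\partial_tu-\partial_x^5u+\mathfrak b\,\partial_x^3u+\partial_x(u^2)=0,\qquad u(0,x)=u_0(x),\qquad x\in\mathbb{R}.$$ The flow map of this Cauchy problem is discontinuous everywhere in $H^s(\mathbb{R})$. More precisely, norm inflation with general initial data occurs: for every $\phi\in H^s(\mathbb{R})$ and every $\varepsilon>0$ there exist a solution $u_\varepsilon$ to the Kawahara equation with initial data $u_\varepsilon(0)\in\mathcal{S}(\mathbb{R})$ and a time $t_\varepsilon\in(0,\varepsilon)$ such that $$\|u_\varepsilon(0)-\phi\|_{H^s}<\varepsilon,\qquad \|u_\varepsilon(t_\varepsilon)\|_{H^s}>\varepsilon^{-1}.$$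
   Context: $\mathcal{S}(\mathbb{R})$ is the Schwartz space and $\|f\|_{H^s}:=\|(1+|\cdot|^2)^{s/2}\widehat f\|_{L^2}$. A solution on $[0,T]$ with initial data $u_0$ is a function $u\in C([0,T];L^2(\mathbb{R}))$ satisfying, in the sense of tempered distributions, for $t\in[0,T]$, $$u(t)=e^{t(\partial_x^5-\mathfrak b\partial_x^3)}u_0-\int_0^te^{(t-t')(\partial_x^5-\mathfrak b\partial_x^3)}\partial_x(u^2)(t')\,dt';$$ the solution $u_\varepsilon$ is defined on some $[0,T]$ with $T\ge t_\varepsilon$. The everywhere discontinuity of the flow map (initial data $\mapsto$ solution, with the $H^s$ topology on data and the $C([0,T];H^s)$ topology on solutions) is understood as the norm inflation property stated in the claim. *)

(* Defs.v *)
From HB Require Import structures.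
From mathcomp Require Import all_boot all_order all_algebra.
From mathcomp Require Import complex.
From mathcomp Require Import all_classical all_reals all_analysis.

Set Implicit Arguments.
Unset Strict Implicit.
Unset Printing Implicit Defensive.

Import Order.TTheory GRing.Theory Num.Theory.
Import numFieldNormedType.Exports.

Local Open Scope classical_set_scope.
Local Open Scope ring_scope.
Local Open Scope complex_scope.

Section ComplexValued.
Context {R : realType}.
Implicit Types (D : set R) (f g : R -> R[i]).

Definition re_fun f : R -> R := fun x => complex.Re (f x).
Definition im_fun f : R -> R := fun x => complex.Im (f x).

Definition cmeasurable f : Prop :=
  measurable_fun setT (re_fun f) /\ measurable_fun setT (im_fun f).

Definition cintegrable D f : Prop :=
  lebesgue_measure.-integrable D (EFin \o re_fun f) /\
  lebesgue_measure.-integrable D (EFin \o im_fun f).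

Definition cintegral D f : R[i] :=
  Rintegral lebesgue_measure D (re_fun f) +i*
  Rintegral lebesgue_measure D (im_fun f).

Definition cderiven (n : nat) f : R -> R[i] :=
  fun x => derive1n n (re_fun f) x +i* derive1n n (im_fun f) x.

Definition csmooth f : Prop := forall (n : nat) (x : R),
  derivable (derive1n n (re_fun f)) x 1 /\
  derivable (derive1n n (im_fun f)) x 1.

Definition L2norm f : \bar R :=
  Lnorm lebesgue_measure 2%:E (fun x => (Normc.normc (f x))%:E).

Definition inL2 f : Prop := cmeasurable f /\ (L2norm f < +oo)%E.

Definition cis (theta : R) : R[i] := cos theta +i* sin theta.

(* The unitary normalization of the Fourier transform. *)
Definition fourier f : R -> R[i] := fun xi =>
  (Num.sqrt (2 * pi))^-1%:C *
  cintegral setT (fun x => cis (- (x * xi)) * f x).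

Definition ifourier f : R -> R[i] := fun x =>
  (Num.sqrt (2 * pi))^-1%:C *
  cintegral setT (fun xi => cis (x * xi) * f xi).

Definition schwartz f : Prop := csmooth f /\
  forall k n : nat, exists M : R, forall x : R,
    `|x| ^+ k * Normc.normc (cderiven n f x) <= M.

Definition schwartz_seminorm (k n : nat) f : R :=
  sup [set `|x| ^+ k * Normc.normc (cderiven n f x) | x in setT].

End ComplexValued.

Section Distributions.
Context {R : realType}.

(* A distribution is encoded as a functional on all functions, of which only
   the values at Schwartz functions are meaningful: every notion below tests
   it on Schwartz functions only. *)
Definition functional : Type := (R -> R[i]) -> R[i].

Implicit Types (T : functional) (f m : R -> R[i]).

Definition tempered T : Prop :=
  (forall (a : R[i]) f g, schwartz f -> schwartz g ->
     T (fun x => a * f x + g x) = a * T f + T g) /\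
  (exists (N : nat) (C : R), forall f, schwartz f ->
     Normc.normc (T f) <=
       C * \sum_(k < N) \sum_(n < N) schwartz_seminorm k n f).

Definition distr_of f : functional :=
  fun psi => cintegral setT (fun x => f x * psi x).

Definition distr_fourier T : functional := fun psi => T (fourier psi).

Definition distr_ifourier T : functional := fun psi => T (ifourier psi).

Definition distr_mul m T : functional := fun psi => T (fun x => m x * psi x).

Definition distr_deriv T : functional := fun psi => - T (cderiven 1 psi).

Definition represented_by T f : Prop := cmeasurable f /\
  forall psi, schwartz psi ->
    cintegrable setT (fun x => f x * psi x) /\ T psi = distr_of f psi.

(* A function representing the Fourier transform of T is unique almost
   everywhere, so the infimum is the weighted norm of that function; it is +oo
   when the Fourier transform of T is not a function. *)
Definition Hs_norm (s : R) T : \bar R :=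
  ereal_inf [set L2norm (fun xi => ((1 + xi ^+ 2) `^ (s / 2))%:C * g xi)
            | g in [set g | represented_by (distr_fourier T) g]].

Definition inHs (s : R) T : Prop := tempered T /\ (Hs_norm s T < +oo)%E.

End Distributions.

Section Kawahara.
Context {R : realType}.
Implicit Types (b t : R) (u : R -> R -> R[i]).

(* The symbol of d_x^5 - b d_x^3 is
   (i xi)^5 - b (i xi)^3 = i (xi^5 + b xi^3). *)
Definition kawahara_multiplier b t : R -> R[i] :=
  fun xi => cis (t * (xi ^+ 5 + b * xi ^+ 3)).

Definition kawahara_group b t (T : @functional R) : functional :=
  distr_ifourier (distr_mul (kawahara_multiplier b t) (distr_fourier T)).

Definition in_C_L2 (T : R) u : Prop :=
  (forall t, 0 <= t <= T -> inL2 (u t)) /\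
  (forall t0, 0 <= t0 <= T ->
     L2norm (fun x => u t x - u t0 x) @[t --> within `[0, T] (nbhs t0)]
       --> (0 : \bar R)%E).

Definition kawahara_solution b (T : R) (u0 : R -> R[i]) u : Prop :=
  in_C_L2 T u /\
  forall t, 0 <= t <= T -> forall psi, schwartz psi ->
    distr_of (u t) psi =
      kawahara_group b t (distr_of u0) psi -
      cintegral `[0, t] (fun t' =>
        kawahara_group b (t - t')
          (distr_deriv (distr_of (fun x => u t' x ^+ 2))) psi).

End Kawahara.

(* Main.v *)
Require Import Defs.
From HB Require Import structures.
From mathcomp Require Import all_boot all_order all_algebra.
From mathcomp Require Import complex ring lra.
From mathcomp Require Import all_classical all_reals all_analysis.
From mathcomp Require Import measurable_realfun.
Import Order.TTheory GRing.Theory Num.Theory.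
Import numFieldNormedType.Exports.
Local Open Scope classical_set_scope.
Local Open Scope ring_scope.
Local Open Scope complex_scope.
Set Implicit Arguments.
Unset Strict Implicit.
Unset Printing Implicit Defensive.

(** We work on the frequency side.  The data is u0 = F^{-1} v0, where v0 is a Gaussian
    mollification of g1 + A 1_{N <= |xi| <= 2N}; here g1 is bounded with compact support and
    its mollification is close to F phi in the weighted L^2 space, so that u0 is Schwartz, and
    the H^s size of the block is A N^(s + 1/2).  Measured in the weight
    exp(- (2 - t/T) |xi| / N) / (1 + (xi/N)^2), whose exponential rate decreases in time and so
    absorbs the derivative in the Duhamel term, the Picard iteration contracts on [0, T] as soon
    as A T N^2 is small.  With T = 1 / (L N^4) and A = L N^(3/2) the block is small in H^s
    because s < -2, the iteration contracts, and up to time T the phases of the linear flow do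
    not rotate away the high x high -> low interaction: the second Picard iterate at frequencies
    of size 1 is of size A^2 N T = L, up to errors bounded independently of L.  Testing u(T)
    against the Fourier transform of xi exp(- xi^2 / 2) detects this, and by Cauchy-Schwarz the
    H^s norm of u(T) is at least of order L. *)

(** A time of order [N^-4], longer than the period [N^-5] of a single frequency of size [N], is
    affordable because the symbol is odd: for bounded [x] the leading powers cancel in
    [y^5 + (x - y)^5 = 5 x y^4 + ...], so that the phase of the interaction of [y] and [x - y] is of
    size [T N^4 = 1 / L]. Its contribution to the second iterate is [A^2 N T * T N^4 = 1] up to a
    constant, whereas the main term [A^2 N T] is [L]. With these scales the block has norm
    [A N^(s + 1/2) = L N^(s + 2)], which is where the threshold [-2] comes from. The contraction
    uses only that the multiplier has modulus 1; all gains come from the weight. Its exponential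
    rate shrinks by the relative amount 1 during the whole life span, so the norm in which the
    iteration runs never degenerates. The solution is defined as the inverse transform of the fixed
    point, and each passage between the two sides is an instance of Fubini or of the Parseval
    identity, the latter obtained by removing a Gaussian regularization. *)

Notation normc := (@Normc.normc _).

(** * Complex-valued integrals *)

Section ComplexNorm.
Variable R : realType.
Implicit Types z w : R[i].

Lemma normcE z : normc z = Num.sqrt (complex.Re z ^+ 2 + complex.Im z ^+ 2).
Proof. by case: z. Qed.

Lemma normc_ge0 z : 0 <= normc z.
Proof. by rewrite normcE sqrtr_ge0. Qed.

Lemma sqr_normc z : normc z ^+ 2 = complex.Re z ^+ 2 + complex.Im z ^+ 2.
Proof. by rewrite normcE sqr_sqrtr// addr_ge0 ?sqr_ge0. Qed.

Lemma normcD z w : normc (z + w) <= normc z + normc w.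
Proof. exact: le_normcD. Qed.

Lemma normc_opp z : normc (- z) = normc z.
Proof. exact: normcN. Qed.

Lemma normcB z w : normc (z - w) <= normc z + normc w.
Proof. by rewrite -(normc_opp w) normcD. Qed.

Lemma normc_dist z w : normc (z - w) = normc (w - z).
Proof. by rewrite -normc_opp opprB. Qed.

Lemma le_normcB z w : normc z <= normc w + normc (z - w).
Proof. by rewrite -{1}(subrKC w z) normcD. Qed.

Lemma normcM z w : normc (z * w) = normc z * normc w.
Proof. exact: Normc.normcM. Qed.

Lemma normcX z n : normc (z ^+ n) = normc z ^+ n.
Proof.
by elim: n => [|n ih]; rewrite ?expr0 ?Normc.normc1// !exprS normcM ih.
Qed.

Lemma normc_real (x : R) : normc x%:C = `|x|.
Proof. by rewrite normcE/= expr0n/= addr0 sqrtr_sqr. Qed.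

Lemma normc_1B (x : R) : normc (1 - x%:C) = `|1 - x|.
Proof. by rewrite -normc_real rmorphB. Qed.

Lemma normc_Re z : `|complex.Re z| <= normc z.
Proof.
by rewrite normcE -sqrtr_sqr ler_sqrt ?addr_ge0 ?sqr_ge0// lerDl sqr_ge0.
Qed.

Lemma normc_Im z : `|complex.Im z| <= normc z.
Proof.
by rewrite normcE -sqrtr_sqr ler_sqrt ?addr_ge0 ?sqr_ge0// lerDr sqr_ge0.
Qed.

Lemma normc_ReIm z : normc z <= `|complex.Re z| + `|complex.Im z|.
Proof.
rewrite normcE -[leRHS]ger0_norm ?addr_ge0// -sqrtr_sqr ler_sqrt ?sqr_ge0//.
rewrite sqrrD !real_normK ?num_real//.
by rewrite -addrA (addrC (_ *+ 2)) addrA lerDl mulrn_wge0// mulr_ge0.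
Qed.

Lemma ReD z w : complex.Re (z + w) = complex.Re z + complex.Re w.
Proof. by case: z; case: w. Qed.
Lemma ImD z w : complex.Im (z + w) = complex.Im z + complex.Im w.
Proof. by case: z; case: w. Qed.
Lemma ReN z : complex.Re (- z) = - complex.Re z.
Proof. by case: z. Qed.
Lemma ImN z : complex.Im (- z) = - complex.Im z.
Proof. by case: z. Qed.
Lemma ReM z w : complex.Re (z * w) =
  complex.Re z * complex.Re w - complex.Im z * complex.Im w.
Proof. by case: z; case: w. Qed.
Lemma ImM z w : complex.Im (z * w) =
  complex.Re z * complex.Im w + complex.Im z * complex.Re w.
Proof. by case: z; case: w. Qed.

Lemma complexP z w : complex.Re z = complex.Re w ->
  complex.Im z = complex.Im w -> z = w.
Proof. by case: z; case: w => a b c d /= -> ->. Qed.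

Lemma cisD (a b : R) : cis (a + b) = cis a * cis b.
Proof. by apply: complexP; rewrite ?ReM ?ImM /= ?cosD ?sinD// addrC. Qed.

Lemma cis0 : cis (0 : R) = 1.
Proof. by rewrite /cis cos0 sin0. Qed.

Lemma normc_cis (a : R) : normc (cis a) = 1.
Proof. by rewrite normcE /= cos2Dsin2 sqrtr1. Qed.

Lemma normc_cisM (a : R) z : normc (cis a * z) = normc z.
Proof. by rewrite normcM normc_cis mul1r. Qed.

Lemma norm_sin_le (a : R) : `|sin a| <= `|a|.
Proof.
have H (x : R) : 0 <= x -> `|sin x| <= x.
  move=> x0; have [->|xn0] := eqVneq x 0; first by rewrite sin0 normr0.
  have {x0 xn0}x0 : 0 < x by rewrite lt_def xn0.
  have [|c _] := @MVT R sin cos 0 x x0 (fun y _ => is_derive_sin y).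
    by apply: continuous_subspaceT => y; exact: continuous_sin.
  rewrite sin0 !subr0 => ->.
  by rewrite normrM (gtr0_norm x0) ler_piMl ?(ltW x0)// ler_norml cos_geN1 cos_le1.
have [a0|a0] := leP 0 a; first by rewrite (ger0_norm a0) H.
by rewrite -normrN -sinN (ltr0_norm a0) H// oppr_ge0 ltW.
Qed.

(** The chord [2 |sin (a / 2)|] is at most the arc. All errors caused by the phases of the linear
    flow are estimated in this way. *)
Lemma normc_cisB1 (a : R) : normc (cis a - 1) <= `|a|.
Proof.
rewrite normcE /= subr0.
have -> : (cos a - 1) ^+ 2 + sin a ^+ 2 = (2 * sin (a / 2)) ^+ 2.
  have := cos2Dsin2 a; have := cos2Dsin2 (a / 2).
  have -> : cos a = cos (a / 2 + a / 2) by congr cos; lra.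
  rewrite cosD => h1 h2.
  have h : (cos (a / 2) * cos (a / 2) - sin (a / 2) * sin (a / 2)) =
           1 - 2 * sin (a / 2) ^+ 2 by move: h1; set c := cos _; set t := sin _ => h1; lra.
  by rewrite h in h2 *; set t := sin (a / 2) in h2 *; nra.
rewrite sqrtr_sqr normrM (@ger0_norm _ 2)//.
have := norm_sin_le (a / 2); rewrite normrM (@ger0_norm _ 2^-1) ?invr_ge0//.
lra.
Qed.

End ComplexNorm.

Lemma cvg0_le (R : realType) (u v : nat -> R) : (forall n, 0 <= u n <= v n) ->
  v n @[n --> \oo] --> (0 : R) -> u n @[n --> \oo] --> (0 : R).
Proof.
move=> uv v0; apply: (squeeze_cvgr _ (@cvg_cst _ _ _ _ _) v0).
exact: nearW.
Qed.

Section ComplexIntegral.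
Context d (T : measurableType d) (R : realType).
Implicit Types (f g : T -> R[i]) (G : T -> R).

(** [cmeas], [cintg] and [cint] generalize [cmeasurable], [cintegrable] and [cintegral] to an
    arbitrary measure space; for the Lebesgue measure they unfold to those notions with
    [D = setT]. *)
Definition cmeas f : Prop :=
  measurable_fun setT (fun x => complex.Re (f x)) /\
  measurable_fun setT (fun x => complex.Im (f x)).

Lemma cmeas_cst (z : R[i]) : cmeas (fun=> z).
Proof. by split; exact: measurable_cst. Qed.

Lemma cmeasD f g : cmeas f -> cmeas g -> cmeas (fun x => f x + g x).
Proof.
move=> [f1 f2] [g1 g2]; split.
- under eq_fun do rewrite ReD; exact: measurable_funD.
- under eq_fun do rewrite ImD; exact: measurable_funD.
Qed.

Lemma cmeasN f : cmeas f -> cmeas (fun x => - f x).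
Proof.
move=> [f1 f2]; split.
- under eq_fun do rewrite ReN; exact: measurableT_comp.
- under eq_fun do rewrite ImN; exact: measurableT_comp.
Qed.

Lemma cmeasB f g : cmeas f -> cmeas g -> cmeas (fun x => f x - g x).
Proof. by move=> mf mg; apply: cmeasD => //; exact: cmeasN. Qed.

Lemma cmeasM f g : cmeas f -> cmeas g -> cmeas (fun x => f x * g x).
Proof.
move=> [f1 f2] [g1 g2]; split.
- under eq_fun do rewrite ReM.
  by apply: measurable_funB; exact: measurable_funM.
- under eq_fun do rewrite ImM.
  by apply: measurable_funD; exact: measurable_funM.
Qed.

Lemma cmeas_real G : measurable_fun setT G -> cmeas (fun x => (G x)%:C).
Proof. by move=> mG; split => //=; exact: measurable_cst. Qed.

Lemma cmeas_cis G : measurable_fun setT G -> cmeas (fun x => cis (G x)).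
Proof.
move=> mG; split => /=.
- by apply: (measurableT_comp (continuous_measurable_fun (@continuous_cos R))).
- by apply: (measurableT_comp (continuous_measurable_fun (@continuous_sin R))).
Qed.

Lemma measurable_normc f : cmeas f -> measurable_fun setT (fun x => normc (f x)).
Proof.
move=> [f1 f2]; under eq_fun do rewrite normcE.
apply: (@measurableT_comp _ _ _ _ _ _ (@Num.sqrt R)).
  by apply: continuous_measurable_fun; exact: sqrt_continuous.
by apply: measurable_funD; exact: measurable_funX.
Qed.

Variable mu : {measure set T -> \bar R}.

Definition rintg G : Prop := mu.-integrable setT (EFin \o G).

Definition cintg f : Prop := rintg (fun x => complex.Re (f x)) /\
  rintg (fun x => complex.Im (f x)).

Definition cint f : R[i] :=
  (\int[mu]_x complex.Re (f x)) +i* (\int[mu]_x complex.Im (f x)).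

Lemma rintg_meas G : rintg G -> measurable_fun setT G.
Proof. by move=> /integrableP[/measurable_EFinP]. Qed.

Lemma rintg_dom (F G : T -> R) : measurable_fun setT F -> rintg G ->
  (forall x, `|F x| <= G x) -> rintg F.
Proof.
move=> mF iG FG; apply: (le_integrable _ _ _ iG) => //.
- exact/measurable_EFinP.
- by move=> x _ /=; rewrite lee_fin (le_trans (FG x))// ler_norm.
Qed.

Lemma rintgD (F G : T -> R) : rintg F -> rintg G -> rintg (fun x => F x + G x).
Proof.
move=> iF iG; rewrite /rintg.
by rewrite (_ : _ \o _ = (EFin \o F) \+ (EFin \o G))%E//; exact: integrableD.
Qed.

Lemma rintgZ (c : R) G : rintg G -> rintg (fun x => c * G x).
Proof.
move=> iG; rewrite /rintg (_ : _ \o _ = fun x => (c%:E * (EFin \o G) x)%E)//.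
by apply: integrableZl.
Qed.

Lemma rintgN G : rintg G -> rintg (fun x => - G x).
Proof.
by move=> /(rintgZ (-1)); under eq_fun do rewrite mulN1r.
Qed.

Lemma rintgB (F G : T -> R) : rintg F -> rintg G -> rintg (fun x => F x - G x).
Proof. by move=> iF iG; apply: rintgD => //; exact: rintgN. Qed.

Lemma cintg_meas f : cintg f -> cmeas f.
Proof. by move=> [/rintg_meas ? /rintg_meas ?]. Qed.

Lemma cintg_dom f G : cmeas f -> rintg G -> (forall x, normc (f x) <= G x) ->
  cintg f.
Proof.
move=> [f1 f2] iG fG; split; apply: rintg_dom iG _ => // x.
- exact: le_trans (normc_Re _) (fG x).
- exact: le_trans (normc_Im _) (fG x).
Qed.

Lemma cintg_normc f : cintg f -> rintg (fun x => normc (f x)).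
Proof.
move=> cf; have [f1 f2] := cf.
apply: (@rintg_dom _ (fun x => `|complex.Re (f x)| + `|complex.Im (f x)|)).
- by apply: measurable_normc; exact: cintg_meas.
- by apply: rintgD; [exact: (integrable_norm f1)|exact: (integrable_norm f2)].
- by move=> x; rewrite ger0_norm ?normc_ge0// normc_ReIm.
Qed.

Lemma cintg_real G : rintg G -> cintg (fun x => (G x)%:C).
Proof.
move=> iG; apply: (@cintg_dom _ (fun x => `|G x|)).
- by apply: cmeas_real; exact: rintg_meas.
- exact: (integrable_norm iG).
- by move=> x; rewrite normc_real.
Qed.

Lemma cintgD f g : cintg f -> cintg g -> cintg (fun x => f x + g x).
Proof.
move=> [f1 f2] [g1 g2]; split.
- under eq_fun do rewrite ReD; exact: rintgD.
- under eq_fun do rewrite ImD; exact: rintgD.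
Qed.

Lemma cintgM_bnd f g (M : R) : cmeas f -> (forall x, normc (f x) <= M) ->
  cintg g -> cintg (fun x => f x * g x).
Proof.
move=> mf fM ig; apply: (@cintg_dom _ (fun x => M * normc (g x))).
- by apply: cmeasM => //; exact: cintg_meas.
- by apply: rintgZ; exact: cintg_normc.
- by move=> x; rewrite normcM ler_wpM2r ?normc_ge0.
Qed.

Lemma cintgZ f (z : R[i]) : cintg f -> cintg (fun x => z * f x).
Proof. by apply: cintgM_bnd (cmeas_cst z) _ => x; exact: lexx. Qed.

Lemma cintgN f : cintg f -> cintg (fun x => - f x).
Proof. by move=> /(cintgZ (-1)); under eq_fun do rewrite mulN1r. Qed.

Lemma cintgB f g : cintg f -> cintg g -> cintg (fun x => f x - g x).
Proof. by move=> hf hg; apply: cintgD => //; exact: cintgN. Qed.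

Lemma eq_cint f g : (forall x, f x = g x) -> cint f = cint g.
Proof. by move=> /funext ->. Qed.

Lemma cintD f g : cintg f -> cintg g ->
  cint (fun x => f x + g x) = cint f + cint g.
Proof.
move=> [f1 f2] [g1 g2]; apply: complexP; rewrite ?ReD ?ImD /cint /=.
- by rewrite -RintegralD//; apply: eq_Rintegral => x _; rewrite ReD.
- by rewrite -RintegralD//; apply: eq_Rintegral => x _; rewrite ImD.
Qed.

Lemma cintZ f (z : R[i]) : cintg f -> cint (fun x => z * f x) = z * cint f.
Proof.
move=> [f1 f2]; apply: complexP; rewrite ?ReM ?ImM /cint /=.
- rewrite -!RintegralZl// -RintegralB//; first last.
  + exact: (rintgZ _ f2).
  + exact: (rintgZ _ f1).
  by apply: eq_Rintegral => x _; rewrite ReM.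
- rewrite -!RintegralZl// -RintegralD//; first last.
  + exact: (rintgZ _ f1).
  + exact: (rintgZ _ f2).
  by apply: eq_Rintegral => x _; rewrite ImM.
Qed.

Lemma cintZr f (z : R[i]) : cintg f -> cint (fun x => f x * z) = cint f * z.
Proof.
by move=> cf; rewrite mulrC -cintZ//; apply: eq_cint => x; rewrite mulrC.
Qed.

Lemma cintN f : cintg f -> cint (fun x => - f x) = - cint f.
Proof.
by move=> cf; rewrite -mulN1r -cintZ//; apply: eq_cint => x; rewrite mulN1r.
Qed.

Lemma cintB f g : cintg f -> cintg g ->
  cint (fun x => f x - g x) = cint f - cint g.
Proof.
by move=> cf cg; rewrite cintD ?cintN//; exact: cintgN.
Qed.

Lemma cint_real G : rintg G -> cint (fun x => (G x)%:C) = (\int[mu]_x G x)%:C.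
Proof.
move=> iG; rewrite /cint /=; congr (_ +i* _).
by rewrite Rintegral_cst// mul0r.
Qed.

(** Rotate the integral [I] onto the real axis: its product with the conjugate of [I] is [n ^+ 2],
    the real part of an integral whose integrand has norm [n * normc (f x)]. *)
Lemma normc_cint f : cintg f -> normc (cint f) <= \int[mu]_x normc (f x).
Proof.
move=> cf; set I := cint f; set n := normc I.
have [->|n0] := eqVneq n 0; first by apply: Rintegral_ge0 => x _; exact: normc_ge0.
have n_gt0 : 0 < n by rewrite lt_def n0 normc_ge0.
pose cI : R[i] := complex.Re I -i* complex.Im I.
have ncI : normc cI = n by rewrite /cI /n !normcE /= sqrrN.
have ReI : complex.Re (cI * I) = n ^+ 2.
  by rewrite ReM /cI /= sqr_normc mulNr opprK -!expr2.
rewrite -(ler_pM2l n_gt0) -expr2 -ReI -cintZ// /cint /=.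
rewrite -RintegralZl//; last exact: cintg_normc.
apply: le_Rintegral => //.
- by have [] := cintgZ cI cf.
- by apply: rintgZ; exact: cintg_normc.
- move=> x _; apply: le_trans (ler_norm _) _; apply: le_trans (normc_Re _) _.
  by rewrite normcM ncI.
Qed.

Lemma normc_cint_le f G : cmeas f -> rintg G -> (forall x, normc (f x) <= G x) ->
  normc (cint f) <= \int[mu]_x G x.
Proof.
move=> mf iG fG; have cf : cintg f by exact: cintg_dom iG fG.
apply: le_trans (normc_cint cf) _; apply: le_Rintegral => //.
exact: cintg_normc.
Qed.

(** Dominated convergence. Here and below, convergence in [R[i]] is expressed by a real sequence of
    norms that tends to 0. *)
Lemma cint_dcvg (fn : nat -> T -> R[i]) f G : (forall n, cmeas (fn n)) ->
  cmeas f -> rintg G -> (forall n x, normc (fn n x) <= G x) ->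
  (forall x, normc (fn n x - f x) @[n --> \oo] --> (0 : R)) ->
  normc (cint (fn n) - cint f) @[n --> \oo] --> (0 : R).
Proof.
move=> mfn mf iG fnG fnf.
have fG x : normc (f x) <= G x.
  apply/ler_addgt0Pr => e e0.
  have /cvgrPdist_lt/(_ _ e0)[N _ /(_ N (leqnn N))] := fnf x.
  rewrite /= sub0r normrN ger0_norm ?normc_ge0// => h.
  have := le_normcB (f x) (fn N x); rewrite normc_dist; have := fnG N x.
  lra.
have cfn n : cintg (fn n) by exact: cintg_dom iG (fnG n).
have cf : cintg f by exact: cintg_dom iG fG.
have cd n : cintg (fun x => fn n x - f x) by exact: cintgB.
have iG2 : rintg (fun x => G x + G x) by exact: rintgD.
have lim0 : (\int[mu]_x (normc (fn n x - f x))%:E)%E @[n --> \oo] --> (0 : \bar R)%E.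
  have m1 n : measurable_fun setT (fun x => (normc (fn n x - f x))%:E).
    apply/measurable_EFinP; apply: measurable_normc; exact: cmeasB.
  have c1 : {ae mu, forall x, setT x ->
      (normc (fn n x - f x))%:E @[n --> \oo] --> (0%:E : \bar R)}.
    by apply: aeW => x _; apply: cvg_EFin; [exact: nearW|exact: fnf].
  have b1 : {ae mu, forall x n, setT x ->
      (`|(normc (fn n x - f x))%:E| <= (EFin \o (fun x => G x + G x)%R) x)%E}.
    apply: aeW => x n _ /=; rewrite lee_fin ger0_norm ?normc_ge0//.
    by apply: le_trans (normcB _ _) _; rewrite lerD.
  have [_ _] := dominated_convergence measurableT m1 (measurable_cst _) c1 iG2 b1.
  by rewrite integral0.
have lim0' : \int[mu]_x normc (fn n x - f x) @[n --> \oo] --> (0 : R).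
  exact: (fine_cvg lim0).
apply: cvg0_le lim0' => n; apply/andP; split; first exact: normc_ge0.
by rewrite -cintB//; exact: normc_cint.
Qed.

Lemma rintg_dcvg (fn : nat -> T -> R) (f g : T -> R) : (forall n, measurable_fun setT (fn n)) ->
  measurable_fun setT f -> rintg g -> (forall n x, `|fn n x| <= g x) ->
  (forall x, fn n x @[n --> \oo] --> f x) ->
  \int[mu]_x fn n x @[n --> \oo] --> \int[mu]_x f x.
Proof.
move=> mfn mf ig fg fnf.
have m1 n : measurable_fun setT (EFin \o fn n) by exact/measurable_EFinP.
have mE : measurable_fun setT (EFin \o f) by exact/measurable_EFinP.
have c1 : {ae mu, forall x, setT x -> (EFin \o fn n) x @[n --> \oo] --> (EFin \o f) x}.
  by apply: aeW => x _; apply: cvg_EFin; [exact: nearW|exact: fnf].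
have b1 : {ae mu, forall x n, setT x -> (`|(EFin \o fn n) x| <= (EFin \o g) x)%E}.
  by apply: aeW => x n _ /=; rewrite lee_fin.
have [iF _ h] := dominated_convergence measurableT m1 mE c1 ig b1.
apply: fine_cvg; rewrite fineK//.
exact: integrable_fin_num.
Qed.

End ComplexIntegral.

(** * Iterated integrals and Fubini *)

Section IteratedIntegrals.
Context d1 d2 (T1 : measurableType d1) (T2 : measurableType d2) (R : realType).
Variable m1 : {sigma_finite_measure set T1 -> \bar R}.
Variable m2 : {sigma_finite_measure set T2 -> \bar R}.

(** The real integral is the difference of the integrals of the positive and negative parts, each
    measurable in [x] by Tonelli. *)
Lemma measurable_Rintegral (F : T1 * T2 -> R) : measurable_fun setT F ->
  measurable_fun setT (fun x => \int[m2]_y F (x, y)).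
Proof.
move=> mF.
have mE : measurable_fun setT (EFin \o F) by exact/measurable_EFinP.
apply: (measurableT_comp (fine_measurable _)) => //.
have -> : (fun x => \int[m2]_y (F (x, y))%:E)%E =
    (fubini_F m2 ((EFin \o F)^\+)%E \- fubini_F m2 ((EFin \o F)^\-)%E)%E.
  apply/funext => x; rewrite [LHS]integralE /fubini_F /=.
  by congr (_ - _)%E; apply: eq_integral => y _; rewrite ?funeposE ?funenegE.
apply: emeasurable_funB; apply: measurable_fun_fubini_tonelli_F => //.
- exact: measurable_funepos.
- exact: measurable_funeneg.
Qed.

Lemma cmeas_cint (F : T1 * T2 -> R[i]) : cmeas F ->
  cmeas (fun x => cint m2 (fun y => F (x, y))).
Proof.
move=> [F1 F2]; split => /=.
- exact: (measurable_Rintegral F1).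
- exact: (measurable_Rintegral F2).
Qed.

Variables (a : T1 -> R) (b : T2 -> R).
Hypotheses (ia : rintg m1 a) (ib : rintg m2 b).

Lemma Rintegral_EFin d (T : measurableType d) (m : {measure set T -> \bar R})
  (G : T -> R) : rintg m G -> ((\int[m]_x G x)%R%:E = \int[m]_x (G x)%:E)%E.
Proof. by move=> iG; rewrite fineK//; exact: integrable_fin_num. Qed.

(** A majorant of product form reduces integrability on the product to two integrals in one
    variable; it is the form of domination in every later use of Fubini. *)
Lemma rintg_prod (F : T1 * T2 -> R) : measurable_fun setT F ->
  (forall x y, `|F (x, y)| <= a x * b y) ->
  (m1 \x m2)%E.-integrable setT (EFin \o F).
Proof.
move=> mF Fab; apply/integrable12ltyP; first exact/measurable_EFinP.
have ib' : rintg m2 (fun y => `|b y|) by exact: (integrable_norm ib).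
have ia' : rintg m1 (fun y => `|a y|) by exact: (integrable_norm ia).
set B := \int[m2]_y `|b y|.
have B0 : 0 <= B by exact: Rintegral_ge0.
apply: (@le_lt_trans _ _ (\int[m1]_x (B * `|a x|)%:E)%E).
  apply: ge0_le_integral => //.
  - by move=> x _; exact: integral_ge0.
  - apply: (@measurable_fun_fubini_tonelli_F _ _ _ _ _ _ (fun z => `|(EFin \o F) z|%E)) => //.
    by apply: measurableT_comp => //; exact/measurable_EFinP.
  - by apply/measurable_EFinP; apply: rintg_meas; apply: rintgZ ia'.
  - move=> x _; rewrite EFinM Rintegral_EFin// muleC -ge0_integralZl//.
    + apply: ge0_le_integral => //.
      * apply/measurable_EFinP.
        by apply: (@measurableT_comp _ _ _ _ _ _ (@Num.norm _ R)) => //; exact: measurableT_comp mF _.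
      * apply/measurable_EFinP; apply: measurable_funM => //; exact: rintg_meas ib'.
      * move=> y _; rewrite /= lee_fin (le_trans (Fab x y))//.
        by apply: le_trans (ler_norm _) _; rewrite normrM; first [exact: lexx|rewrite mulrC].
    + by apply/measurable_EFinP; exact: rintg_meas ib'.
exact: (integrable_lty _ (rintgZ B ia')).
Qed.

Lemma rintg_section1 (F : T1 * T2 -> R) x : measurable_fun setT F ->
  (forall x y, `|F (x, y)| <= a x * b y) -> rintg m2 (fun y => F (x, y)).
Proof.
move=> mF Fab; apply: rintg_dom (rintgZ (a x) ib) _ => //.
exact: measurableT_comp mF _.
Qed.

Lemma rintg_section2 (F : T1 * T2 -> R) y : measurable_fun setT F ->
  (forall x y, `|F (x, y)| <= a x * b y) -> rintg m1 (fun x => F (x, y)).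
Proof.
move=> mF Fab; apply: rintg_dom (rintgZ (b y) ia) _ => //.
- exact: measurableT_comp mF _.
- by move=> x; rewrite mulrC.
Qed.

Lemma Rintegral_fubini (F : T1 * T2 -> R) : measurable_fun setT F ->
  (forall x y, `|F (x, y)| <= a x * b y) ->
  \int[m1]_x \int[m2]_y F (x, y) = \int[m2]_y \int[m1]_x F (x, y).
Proof.
move=> mF Fab; rewrite /Rintegral.
have e1 x := Rintegral_EFin (rintg_section1 x mF Fab).
have e2 y := Rintegral_EFin (rintg_section2 y mF Fab).
congr fine; under eq_integral do rewrite e1.
under [in RHS]eq_integral do rewrite e2.
exact: (Fubini (rintg_prod mF Fab)).
Qed.

Lemma cint_fubini (F : T1 * T2 -> R[i]) : cmeas F ->
  (forall x y, normc (F (x, y)) <= a x * b y) ->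
  cint m1 (fun x => cint m2 (fun y => F (x, y))) =
  cint m2 (fun y => cint m1 (fun x => F (x, y))).
Proof.
move=> [F1 F2] Fab; rewrite /cint /=; congr (_ +i* _).
- apply: (@Rintegral_fubini (fun z => complex.Re (F z)) F1) => x y.
  exact: le_trans (normc_Re _) (Fab x y).
- apply: (@Rintegral_fubini (fun z => complex.Im (F z)) F2) => x y.
  exact: le_trans (normc_Im _) (Fab x y).
Qed.

End IteratedIntegrals.

(** * Continuity of parametric integrals *)

Section ParametricIntegrals.
Context d (T : measurableType d) (R : realType).
Variable mu : {measure set T -> \bar R}.

Definition ccont (f : R -> R[i]) : Prop :=
  continuous (fun x => complex.Re (f x)) /\
  continuous (fun x => complex.Im (f x)).

Lemma ccont_cint (F : R -> T -> R[i]) (G : T -> R) : (forall x, cmeas (F x)) ->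
  rintg mu G -> (forall x y, normc (F x y) <= G y) ->
  (forall y, ccont (F ^~ y)) -> ccont (fun x => cint mu (F x)).
Proof.
move=> mF iG FG cF.
have H (P : R[i] -> R) : (forall x, measurable_fun setT (fun y => P (F x y))) ->
    (forall z, `|P z| <= normc z) ->
    (forall y, continuous (fun x => P (F x y))) ->
    continuous (fun x => \int[mu]_y P (F x y)).
  move=> mP Pn cP x.
  (* Continuity is local, so that a bounded neighbourhood of [x] serves as the interval of
     parameters. *)
  have Ix : x \in `](x - 1), (x + 1)[%classic.
    by rewrite inE /= in_itv /= ltrBlDr !ltrDl ltr01.
  apply: (@continuity_under_integral _ _ _ mu (fun x y => P (F x y)) setT
     measurableT (x - 1) (x + 1) _ _ G) => //.
  - move=> y _; apply: rintg_dom iG _ => //.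
    by move=> t; rewrite (le_trans (Pn _)).
  - by apply: aeW => y _ t _; exact: cP.
  - by move=> t _; apply: aeW => y _; rewrite (le_trans (Pn _)).
split.
- apply: (H (@complex.Re R)) => [x|z|y].
  + by have [] := mF x.
  + exact: normc_Re.
  + by have [] := cF y.
- apply: (H (@complex.Im R)) => [x|z|y].
  + by have [] := mF x.
  + exact: normc_Im.
  + by have [] := cF y.
Qed.

Lemma ccontM (f g : R -> R[i]) : ccont f -> ccont g -> ccont (fun x => f x * g x).
Proof.
move=> [f1 f2] [g1 g2]; split => x.
- under eq_fun do rewrite ReM.
  by apply: cvgB; apply: cvgM; [exact: f1|exact: g1|exact: f2|exact: g2].
- under eq_fun do rewrite ImM.
  by apply: cvgD; apply: cvgM; [exact: f1|exact: g2|exact: f2|exact: g1].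
Qed.

Lemma ccontD (f g : R -> R[i]) : ccont f -> ccont g -> ccont (fun x => f x + g x).
Proof.
move=> [f1 f2] [g1 g2]; split => x.
- under eq_fun do rewrite ReD.
  by apply: cvgD; [exact: f1|exact: g1].
- under eq_fun do rewrite ImD.
  by apply: cvgD; [exact: f2|exact: g2].
Qed.

Lemma ccont_cst (z : R[i]) : ccont (fun=> z).
Proof. by split => x; exact: cvg_cst. Qed.

Lemma ccontB (f g : R -> R[i]) : ccont f -> ccont g -> ccont (fun x => f x - g x).
Proof.
move=> cf cg; apply: ccontD => //.
under eq_fun do rewrite -mulN1r.
by apply: ccontM => //; exact: ccont_cst.
Qed.

Lemma ccont_real (g : R -> R) : continuous g -> ccont (fun x => (g x)%:C).
Proof. by move=> cg; split => // x; exact: cvg_cst. Qed.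

Lemma ccont_cis (g : R -> R) : continuous g -> ccont (fun x => cis (g x)).
Proof.
move=> cg; split => x /=.
- by apply: continuous_comp; [exact: cg|exact: continuous_cos].
- by apply: continuous_comp; [exact: cg|exact: continuous_sin].
Qed.

Lemma ccont_comp (f : R -> R[i]) (g : R -> R) : ccont f -> continuous g ->
  ccont (fun x => f (g x)).
Proof.
move=> [f1 f2] cg; split => x.
- by apply: (@continuous_comp _ _ _ g (fun x => complex.Re (f x))); [exact: cg|exact: f1].
- by apply: (@continuous_comp _ _ _ g (fun x => complex.Im (f x))); [exact: cg|exact: f2].
Qed.

Lemma ccont_meas (f : R -> R[i]) : ccont f -> cmeas f.
Proof. by move=> [f1 f2]; split; exact: continuous_measurable_fun. Qed.

End ParametricIntegrals.

(** * Derivatives and the fundamental theorem on the line *)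

Section Derivatives.
Variable R : realType.
Implicit Types (f g : R -> R) (x a b c : R).

Lemma is_deriveMf f g x a b : is_derive x 1 f a -> is_derive x 1 g b ->
  is_derive x 1 (fun y => f y * g y) (a * g x + f x * b).
Proof.
move=> df dg; apply: (is_derive_eq (is_deriveM df dg)).
by rewrite addrC mulrC.
Qed.

Lemma is_deriveDf f g x a b : is_derive x 1 f a -> is_derive x 1 g b ->
  is_derive x 1 (fun y => f y + g y) (a + b).
Proof. by move=> df dg; apply: is_deriveD. Qed.

Lemma is_deriveBf f g x a b : is_derive x 1 f a -> is_derive x 1 g b ->
  is_derive x 1 (fun y => f y - g y) (a - b).
Proof. by move=> df dg; apply: is_deriveB. Qed.

Lemma is_deriveNf f x a : is_derive x 1 f a ->
  is_derive x 1 (fun y => - f y) (- a).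
Proof. by move=> df; apply: is_deriveN. Qed.

Lemma is_deriveZf f x a c : is_derive x 1 f a ->
  is_derive x 1 (fun y => c * f y) (c * a).
Proof. by move=> df; apply: is_deriveZ. Qed.

Lemma is_derive_compf f g x a b : is_derive (g x) 1 f a -> is_derive x 1 g b ->
  is_derive x 1 (fun y => f (g y)) (a * b).
Proof. exact: is_derive1_comp. Qed.

Lemma is_derive_sqr x : is_derive x 1 (fun y : R => y ^+ 2) (2 * x).
Proof.
apply: (is_derive_eq (is_deriveMf (is_derive_id x 1) (is_derive_id x 1))).
by ring.
Qed.

Lemma is_derive_continuous f f' : (forall x, is_derive x 1 f (f' x)) ->
  continuous f.
Proof.
move=> df x; apply/differentiable_continuous/derivable1_diffP.
exact: (@ex_derive _ _ _ _ _ _ _ (df x)).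
Qed.

Notation mu := (@lebesgue_measure R).

(** The fundamental theorem on growing intervals, followed by dominated convergence with majorant
    [|f'|]. The boundary values are needed along the integers only. *)
Lemma Rintegral_derive_eq0 f f' : (forall x, is_derive x 1 f (f' x)) ->
  continuous f' -> rintg mu f' ->
  f n%:R @[n --> \oo] --> (0 : R) -> f (- n%:R) @[n --> \oo] --> (0 : R) ->
  \int[mu]_x f' x = 0.
Proof.
move=> df cf' if' fy fNy.
(* The shift to [n.+1] keeps the interval nondegenerate at [n = 0], as the fundamental theorem
   requires. *)
pose D (n : nat) : set R := `[- n.+1%:R, n.+1%:R]%classic.
have mD n : measurable (D n) by exact: measurable_itv.
pose fn n := f' \_ (D n).
have mfn n : measurable_fun setT (fn n).
  apply: (measurable_restrictT f' (mD n)).1; apply: measurable_funTS.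
  exact: continuous_measurable_fun.
have h1 : \int[mu]_x fn n x @[n --> \oo] --> \int[mu]_x f' x.
  apply: (@rintg_dcvg _ _ R mu fn f' (fun x => `|f' x|)).
  - exact: mfn.
  - exact: rintg_meas if'.
  - exact: integrable_norm.
  - by move=> n x; rewrite /fn patchE; case: ifPn; rewrite ?normr0.
  - move=> x; apply: cvg_near_cst; near=> n.
    rewrite /fn patchE mem_set// /D /= in_itv /= -ler_norml.
    apply/ltW/(@lt_le_trans _ _ n%:R); last by rewrite ler_nat.
    by near: n; exact: nbhs_infty_gtr.
have h2 n : \int[mu]_x fn n x = f n.+1%:R - f (- n.+1%:R).
  rewrite -Rintegral_mkcond /Rintegral (@continuous_FTC2 _ f' f).
  - by rewrite -EFinB.
  - by rewrite gtrN.
  - by apply: continuous_subspaceT.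
  - split.
    + by move=> x _; exact: (@ex_derive _ _ _ _ _ _ _ (df x)).
    + apply: cvg_at_right_filter; exact: (is_derive_continuous df).
    + apply: cvg_at_left_filter; exact: (is_derive_continuous df).
  - by move=> x _; rewrite derive1E; exact: (@derive_val _ _ _ _ _ _ _ (df x)).
have h3 : \int[mu]_x fn n x @[n --> \oo] --> (0 - 0 : R).
  under eq_cvg do rewrite h2.
  apply: cvgB.
  - by have := fy; rewrite -(cvg_shiftS (fun n => f n%:R)).
  - by have := fNy; rewrite -(cvg_shiftS (fun n => f (- n%:R))).
rewrite subr0 in h3.
exact: (cvg_unique _ h1 h3).
Unshelve. all: by end_near. Qed.

(** Differentiation under the integral sign for [c] a cosine or a sine; the first moment [|x * h x|]
    dominates the partial derivative. *)
Lemma is_derive_param (h : R -> R) (c s : R -> R) (y : R) :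
  rintg mu h -> rintg mu (fun x => x * h x) ->
  (forall x, is_derive x 1 c (s x)) -> continuous s ->
  (forall x, `|c x| <= 1) -> (forall x, `|s x| <= 1) ->
  is_derive y 1 (fun y : R => \int[mu]_x (c (x * y) * h x))
    (\int[mu]_x (s (x * y) * (x * h x))).
Proof.
move=> ih ixh dc cs c1 s1.
have cc : continuous c by exact: is_derive_continuous dc.
have mlin (z : R) : measurable_fun setT (fun x : R => x * z).
  exact: measurable_funM.
have d1 (x z : R) : is_derive z 1 (fun z : R => c (x * z) * h x) (s (x * z) * (x * h x)).
  have dz : is_derive z 1 (fun z : R => x * z) x.
    by apply: (is_derive_eq (is_deriveZf x (is_derive_id z 1))); rewrite mulr1.
  have := is_deriveZf (h x) (is_derive_compf (g := fun z => x * z) (dc _) dz).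
  under eq_fun do rewrite mulrC; move=> dd.
  by apply: (is_derive_eq dd); ring.
have Iy : `](y - 1), (y + 1)[%classic y.
  by rewrite /= in_itv /= ltrBlDr !ltrDl ltr01.
have H1 x : `](y - 1), (y + 1)[%classic x -> mu.-integrable setT
   (EFin \o (fun t => c (t * x) * h t)).
  move=> _; apply: (@rintg_dom _ _ R mu _ (fun t => `|h t|)).
  - apply: measurable_funM; last exact: rintg_meas ih.
    apply: (measurableT_comp (continuous_measurable_fun cc)).
    exact: mlin.
  - exact: (integrable_norm ih).
  - by move=> t; rewrite normrM ler_piMl.
have H2 x t : `](y - 1), (y + 1)[%classic x -> setT t ->
    derivable (fun x => c (t * x) * h t) x 1.
  by move=> _ _; exact: (@ex_derive _ _ _ _ _ _ _ (d1 t x)).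
have H3 x t : `](y - 1), (y + 1)[%classic x -> setT t ->
   `|partial1of2 (fun x t => c (t * x) * h t) x t| <= `|t * h t|.
  move=> _ _; rewrite partial1of2E (@derive_val _ _ _ _ _ _ _ (d1 t x)).
  by rewrite normrM ler_piMl.
have ixh' : mu.-integrable setT (EFin \o (fun t => `|t * h t|)).
  exact: (integrable_norm ixh).
have P := @derivable_under_integral R _ _ mu (fun x t => c (t * x) * h t) setT
  measurableT y _ _ Iy H1 H2 _ (fun=> normr_ge0 _) ixh' H3.
have Q := @differentiation_under_integral R _ _ mu (fun x t => c (t * x) * h t) setT
  measurableT y _ _ Iy H1 H2 _ (fun=> normr_ge0 _) ixh' H3.
apply: DeriveDef => //; rewrite -derive1E Q.
apply: eq_Rintegral => t _.
by rewrite partial1of2E (@derive_val _ _ _ _ _ _ _ (d1 t y)).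
Qed.

End Derivatives.

(** * Gaussians *)

Section Gaussian.
Variable R : realType.
Notation mu := (@lebesgue_measure R).
Implicit Types (s x y : R).

(** The density of the centred normal law of standard deviation [s], used as mollifier. *)
Definition gk s x := (s * Num.sqrt (2 * pi))^-1 * expR (- (x ^+ 2 / (2 * s ^+ 2))).

Lemma sqrt2pi_gt0 : 0 < Num.sqrt (2 * pi) :> R.
Proof. by rewrite sqrtr_gt0 mulr_gt0// pi_gt0. Qed.

Variable s : R.
Hypothesis s0 : 0 < s.

Lemma gk_gt0 x : 0 < gk s x.
Proof. by rewrite mulr_gt0 ?expR_gt0// invr_gt0 mulr_gt0// sqrt2pi_gt0. Qed.

Lemma gk_ge0 x : 0 <= gk s x.
Proof. exact/ltW/gk_gt0. Qed.

Lemma gkN x : gk s (- x) = gk s x.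
Proof. by rewrite /gk sqrrN. Qed.

Lemma gk_le x : gk s x <= (s * Num.sqrt (2 * pi))^-1.
Proof.
rewrite ler_piMr ?invr_ge0 ?mulr_ge0 ?(ltW s0) ?(ltW sqrt2pi_gt0)//.
rewrite -[leRHS]expR0 ler_expR oppr_le0; apply: divr_ge0; first exact: sqr_ge0.
by apply: mulr_ge0 => //; exact: sqr_ge0.
Qed.

Lemma is_derive_gk x : is_derive x 1 (gk s) (- (x / s ^+ 2) * gk s x).
Proof.
have d1 : is_derive x 1 (fun x : R => - (2 * s ^+ 2)^-1 * x ^+ 2) (- (x / s ^+ 2)).
  apply: (is_derive_eq (is_deriveZf _ (is_derive_sqr x))).
  by field; rewrite lt0r_neq0.
have d2 := is_deriveZf ((s * Num.sqrt (2 * pi))^-1)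
  (is_derive_compf (is_derive_expR _) d1).
have -> : gk s = fun x => (s * Num.sqrt (2 * pi))^-1 * expR (- (2 * s ^+ 2)^-1 * x ^+ 2).
  by apply/funext => y; rewrite /gk mulNr mulrC (mulrC (y ^+ 2)) mulrC.
by apply: (is_derive_eq d2) => /=; ring.
Qed.

Lemma continuous_gk : continuous (gk s).
Proof. exact: is_derive_continuous is_derive_gk. Qed.

Lemma gk_normal_pdf : gk s = normal_pdf 0 s.
Proof.
apply/funext => x; rewrite normal_pdfE ?lt0r_neq0// /gk /normal_peak /normal_fun.
congr (_^-1 * expR _).
  rewrite -{1}(@ger0_norm _ s) ?(ltW s0)// -sqrtr_sqr -sqrtrM ?sqr_ge0//.
  by congr Num.sqrt; rewrite -mulr_natl; ring.
by rewrite subr0 mulNr -(mulr_natl (s ^+ 2)).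
Qed.

Lemma rintg_gk : rintg mu (gk s).
Proof. rewrite gk_normal_pdf; exact: integrable_normal_pdf. Qed.

Lemma Rintegral_gk : \int[mu]_x gk s x = 1.
Proof.
by rewrite gk_normal_pdf /Rintegral integral_normal_pdf.
Qed.

End Gaussian.

(** * Exponential moments and Fourier transform of a Gaussian *)

Section GaussianDecay.
Variable R : realType.
Notation mu := (@lebesgue_measure R).
Variables s : R.
Hypothesis s0 : 0 < s.

(** With [a = c s] and [w = |x| / s], completing the square gives [a w - w^2 / 2 <= a^2 - w^2 / 8].
    A Gaussian of twice the width thus absorbs any exponential weight; the factor 2 adjusts its
    normalization. *)
Lemma gk_expR_le (c x : R) : 0 <= c ->
  expR (c * `|x|) * gk s x <= 2 * expR (c ^+ 2 * s ^+ 2) * gk (2 * s) x.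
Proof.
move=> c0; rewrite /gk.
have -> : 2 * expR (c ^+ 2 * s ^+ 2) * ((2 * s * Num.sqrt (2 * pi))^-1 *
    expR (- (x ^+ 2 / (2 * (2 * s) ^+ 2)))) = (s * Num.sqrt (2 * pi))^-1 *
    expR (c ^+ 2 * s ^+ 2 - x ^+ 2 / (2 * (2 * s) ^+ 2)).
  rewrite expRD; set e1 := expR _; set e2 := expR _; set q := Num.sqrt _.
  have q0 : q != 0 by rewrite lt0r_neq0// sqrt2pi_gt0.
  by field; rewrite q0 lt0r_neq0.
rewrite mulrCA -expRD ler_pM2l; last by rewrite invr_gt0 mulr_gt0// sqrt2pi_gt0.
rewrite ler_expR; set t := `|x|.
have -> : x ^+ 2 = t ^+ 2 by rewrite real_normK ?num_real.
have -> : t = (t / s) * s by rewrite divfK// lt0r_neq0.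
set w := t / s.
have -> : (w * s) ^+ 2 / (2 * s ^+ 2) = w ^+ 2 / 2 by field; rewrite lt0r_neq0.
have -> : (w * s) ^+ 2 / (2 * (2 * s) ^+ 2) = w ^+ 2 / 8 by field; rewrite lt0r_neq0.
have -> : c * (w * s) = (c * s) * w by ring.
have -> : c ^+ 2 * s ^+ 2 = (c * s) ^+ 2 by ring.
set a := c * s; rewrite -subr_ge0.
have -> : a ^+ 2 - w ^+ 2 / 8 - (a * w - w ^+ 2 / 2) =
  (a - w / 2) ^+ 2 + w ^+ 2 / 8 by field.
by rewrite addr_ge0 ?divr_ge0 ?sqr_ge0.
Qed.

Lemma measurable_gk_expR (c : R) :
  measurable_fun setT (fun x : R => expR (c * `|x|) * gk s x).
Proof.
apply: measurable_funM.
- apply: measurableT_comp => //; apply: measurable_funM => //.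
- by apply: continuous_measurable_fun; exact: continuous_gk.
Qed.

Lemma rintg_gk_expR (c : R) : 0 <= c -> rintg mu (fun x => expR (c * `|x|) * gk s x).
Proof.
move=> c0; have s20 : 0 < 2 * s by rewrite mulr_gt0.
apply: (@rintg_dom _ _ R mu _ (fun x => 2 * expR (c ^+ 2 * s ^+ 2) * gk (2 * s) x)).
- exact: measurable_gk_expR.
- by apply: rintgZ; exact: rintg_gk.
- by move=> x; rewrite ger0_norm ?gk_expR_le// mulr_ge0 ?expR_ge0// gk_ge0.
Qed.

Lemma norm_le_expR (x : R) : `|x| <= expR `|x|.
Proof. by apply: le_trans (expR_ge1Dx _); rewrite lerDr. Qed.

Lemma rintg_idgk : rintg mu (fun x => x * gk s x).
Proof.
apply: (@rintg_dom _ _ R mu _ (fun x => expR (1 * `|x|) * gk s x)).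
- apply: measurable_funM => //.
  by apply: continuous_measurable_fun; exact: continuous_gk.
- exact: rintg_gk_expR.
- by move=> x; rewrite normrM mul1r (ger0_norm (gk_ge0 s0 x)) ler_wpM2r ?gk_ge0// norm_le_expR.
Qed.

Lemma cvg0_gk (u : nat -> R) (v : nat -> R) : (forall n, `|v n| <= 1) ->
  (forall n, `|u n| = n%:R) -> (v n * gk s (u n)) @[n --> \oo] --> (0 : R).
Proof.
move=> v1 un; set C := 2 * expR (1 ^+ 2 * s ^+ 2) * (2 * s * Num.sqrt (2 * pi))^-1.
have s20 : 0 < 2 * s by rewrite mulr_gt0.
have C0 : 0 <= C.
  by rewrite !mulr_ge0 ?expR_ge0// invr_ge0 mulr_ge0 ?(ltW s20)// ltW// sqrt2pi_gt0.
have h n : `|v n * gk s (u n)| <= C * n.+1%:R^-1.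
  rewrite normrM (ger0_norm (gk_ge0 s0 _)); apply: (@le_trans _ _ (gk s (u n))).
    by rewrite ler_piMl// gk_ge0.
  rewrite -[leLHS]mul1r ler_pdivlMr ?ltr0n// mul1r mulrC.
  apply: (@le_trans _ _ (expR (1 * `|u n|) * gk s (u n))).
    rewrite ler_wpM2r ?gk_ge0// mul1r un -natr1 addrC; exact: expR_ge1Dx.
  apply: le_trans (gk_expR_le _ _) _ => //.
  by rewrite ler_wpM2l ?mulr_ge0 ?expR_ge0// gk_le.
have hl : C * n.+1%:R^-1 @[n --> \oo] --> (0 : R).
  by rewrite -(mulr0 C); apply: cvgM; [exact: cvg_cst|exact: cvg_harmonic].
apply/norm_cvg0P; apply: cvg0_le hl => n.
by rewrite normr_ge0 h.
Qed.

Let a (y : R) := \int[mu]_x (cos (x * y) * gk s x).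
Let b (y : R) := \int[mu]_x (sin (x * y) * gk s x).

Let trig_bnd : (forall x : R, `|cos x| <= 1) * (forall x : R, `|sin x| <= 1) *
  (forall x : R, `|- sin x| <= 1).
Proof.
have h1 (x : R) : `|cos x| <= 1 by rewrite ler_norml cos_geN1 cos_le1.
have h2 (x : R) : `|sin x| <= 1 by rewrite ler_norml sin_geN1 sin_le1.
by split => // x; rewrite normrN.
Qed.

(** Integration by parts: [x * gk s x] is [- s ^+ 2] times the derivative of the Gaussian. It turns
    the derivative of the cosine and sine transforms into a linear equation of first order. *)
Lemma gk_by_parts (c c' : R -> R) (y : R) : (forall x : R, is_derive x 1 c (c' x)) ->
  continuous c' -> (forall x, `|c x| <= 1) -> (forall x, `|c' x| <= 1) ->
  \int[mu]_x (c (x * y) * (x * gk s x)) =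
  s ^+ 2 * y * \int[mu]_x (c' (x * y) * gk s x).
Proof.
move=> dc cc' c1 c'1; have cc : continuous c by exact: is_derive_continuous dc.
pose f' (x : R) := y * (c' (x * y) * gk s x) - (s ^+ 2)^-1 * (c (x * y) * (x * gk s x)).
have mlin : continuous (fun x : R => x * y) by move=> x; exact: mulrr_continuous.
have df (x : R) : is_derive x 1 (fun x : R => c (x * y) * gk s x) (f' x).
  have dz : is_derive x 1 (fun z : R => z * y) y.
    under eq_fun do rewrite mulrC.
    by apply: (is_derive_eq (is_deriveZf y (is_derive_id x 1))); rewrite mulr1.
  have d1 := is_deriveMf (is_derive_compf (g := fun z => z * y) (dc _) dz)
    (is_derive_gk s0 x).
  by apply: (is_derive_eq d1); rewrite /f' /=; field; rewrite lt0r_neq0.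
have comp_c (g : R -> R) : continuous g -> continuous (fun x : R => g (x * y)).
  by move=> cg x; apply: (@continuous_comp _ _ _ (fun x : R => x * y) g); [exact: mlin|exact: cg].
have i1 : rintg mu (fun x => c' (x * y) * gk s x).
  apply: (@rintg_dom _ _ R mu _ (gk s)); last 2 first.
  - exact: rintg_gk.
  - by move=> x; rewrite normrM (ger0_norm (gk_ge0 s0 x)) ler_piMl// gk_ge0.
  - apply: measurable_funM; apply: continuous_measurable_fun;
      [exact: comp_c|exact: continuous_gk].
have i2 : rintg mu (fun x => c (x * y) * (x * gk s x)).
  apply: (@rintg_dom _ _ R mu _ (fun x => `|x * gk s x|)); last 2 first.
  - exact: (integrable_norm rintg_idgk).
  - by move=> x; rewrite normrM ler_piMl.
  - apply: measurable_funM; last exact: rintg_meas rintg_idgk.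
    by apply: continuous_measurable_fun; exact: comp_c.
have if' : rintg mu f' by apply: rintgB; exact: rintgZ.
have cf' : continuous f'.
  have cg := continuous_gk s0.
  have c1' : continuous (fun x : R => c' (x * y)) by exact: comp_c.
  have c2' : continuous (fun x : R => c (x * y)) by exact: comp_c.
  move=> x; apply: cvgB.
  + by apply: cvgM; [exact: cvg_cst|apply: cvgM; [exact: c1'|exact: cg]].
  + apply: cvgM; [exact: cvg_cst|apply: cvgM; [exact: c2'|apply: cvgM; last exact: cg]].
    exact: cvg_id.
have := Rintegral_derive_eq0 df cf' if'.
rewrite /f' RintegralB//; last 2 first.
- exact: (rintgZ y i1).
- exact: (rintgZ (s ^+ 2)^-1 i2).
rewrite !RintegralZl// => h.
have {h}/eqP : y * (\int[mu]_x (c' (x * y) * gk s x)) -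
   (s ^+ 2)^-1 * (\int[mu]_x (c (x * y) * (x * gk s x))) = 0.
  by apply: h; apply: cvg0_gk => // n; rewrite ?normrN normr_nat.
rewrite subr_eq0 => /eqP h; rewrite -mulrA h mulrA mulfV ?mul1r//.
by rewrite expf_neq0// lt0r_neq0.
Qed.

Let da (y : R) : is_derive y 1 a (- (s ^+ 2 * y * a y)).
Proof.
have cN : continuous (fun x : R => - sin x).
  by move=> x; apply: cvgN; exact: continuous_sin.
have := is_derive_param y (rintg_gk s0) rintg_idgk (@is_derive_cos R) cN.
move=> /(_ trig_bnd.1.1 trig_bnd.2) h; apply: (is_derive_eq h).
rewrite (@gk_by_parts (fun x => - sin x) (fun x => - cos x)).
- rewrite -mulrN; congr (_ * _); rewrite -mulN1r -RintegralZl//.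
    by apply: eq_Rintegral => x _; rewrite mulN1r mulNr.
  apply: (@rintg_dom _ _ R mu _ (gk s)); last 2 first.
  + exact: rintg_gk.
  + by move=> x; rewrite normrM (ger0_norm (gk_ge0 s0 x)) ler_piMl ?gk_ge0// trig_bnd.
  + apply: measurable_funM; apply: continuous_measurable_fun; last exact: continuous_gk.
    move=> x; apply: (@continuous_comp _ _ _ (fun x : R => x * y) cos).
      exact: mulrr_continuous.
    exact: continuous_cos.
- by move=> x; apply: cvgN; exact: continuous_cos.
- exact: trig_bnd.2.
- by move=> x; rewrite normrN trig_bnd.
Qed.

Let db (y : R) : is_derive y 1 b (- (s ^+ 2 * y * b y)).
Proof.
have := is_derive_param y (rintg_gk s0) rintg_idgk (@is_derive_sin R) (@continuous_cos R).
move=> /(_ trig_bnd.1.2 trig_bnd.1.1) h; apply: (is_derive_eq h).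
rewrite (@gk_by_parts (fun x => cos x) (fun x => - sin x)).
- rewrite -mulrN; congr (_ * _); rewrite -mulN1r -RintegralZl//.
    by apply: eq_Rintegral => x _; rewrite mulN1r mulNr.
  apply: (@rintg_dom _ _ R mu _ (gk s)); last 2 first.
  + exact: rintg_gk.
  + by move=> x; rewrite normrM (ger0_norm (gk_ge0 s0 x)) ler_piMl ?gk_ge0// trig_bnd.
  + apply: measurable_funM; apply: continuous_measurable_fun; last exact: continuous_gk.
    move=> x; apply: (@continuous_comp _ _ _ (fun x : R => x * y) sin).
      exact: mulrr_continuous.
    exact: continuous_sin.
- by move=> x; apply: cvgN; exact: continuous_sin.
- exact: trig_bnd.1.1.
- exact: trig_bnd.2.
Qed.

(** With the integrating factor [expR (s ^+ 2 / 2 * y ^+ 2)] the product has derivative 0. The value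
    at 0 is 1 for the cosine transform and 0 for the sine transform. *)
Let ode (f : R -> R) : (forall y : R, is_derive y 1 f (- (s ^+ 2 * y * f y))) ->
  forall y, f y = f 0 * expR (- (s ^+ 2 * y ^+ 2 / 2)).
Proof.
move=> df y; pose g (y : R) := f y * expR (s ^+ 2 / 2 * y ^+ 2).
have dg (x : R) : is_derive x 1 g 0.
  have d1 : is_derive x 1 (fun y : R => s ^+ 2 / 2 * y ^+ 2) (s ^+ 2 * x).
    by apply: (is_derive_eq (is_deriveZf _ (is_derive_sqr x))); field.
  apply: (is_derive_eq (is_deriveMf (df x) (is_derive_compf (is_derive_expR _) d1))).
  by ring.
have := is_derive_0_is_cst y 0 dg.
rewrite /g expr0n/= mulr0 expR0 mulr1 => <-.
by rewrite -mulrA -expRD (_ : _ + _ = 0) ?expR0 ?mulr1//; field.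
Qed.

Lemma Rintegral_cos_gk (y : R) :
  \int[mu]_x (cos (x * y) * gk s x) = expR (- (s ^+ 2 * y ^+ 2 / 2)).
Proof.
rewrite -/(a y) (ode da) /a.
under eq_Rintegral do rewrite mulr0 cos0 mul1r.
by rewrite Rintegral_gk// mul1r.
Qed.

Lemma Rintegral_sin_gk (y : R) : \int[mu]_x (sin (x * y) * gk s x) = 0.
Proof.
rewrite -/(b y) (ode db) /b.
under eq_Rintegral do rewrite mulr0 sin0 mul0r.
by rewrite Rintegral_cst// mul0r mul0r.
Qed.

Lemma cint_cis_gk (y : R) :
  cint mu (fun x => cis (x * y) * (gk s x)%:C) = (expR (- (s ^+ 2 * y ^+ 2 / 2)))%:C.
Proof.
rewrite /cint; congr (_ +i* _).
- rewrite -Rintegral_cos_gk; apply: eq_Rintegral => x _.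
  by rewrite /= mulr0 subr0.
- rewrite -(Rintegral_sin_gk y); apply: eq_Rintegral => x _.
  by rewrite /= mulr0 add0r.
Qed.

End GaussianDecay.

(** * Reflections and translations of Lebesgue measure *)

Section Reflection.
Variable R : realType.

(** Reflections generate the translations, [x - a] being obtained from two of them, and also give
    the change of variable [y] to [x - y] in convolutions. *)
Definition reflection (a : R) : measurableTypeR R -> measurableTypeR R :=
  fun x => a - x.

Lemma measurable_reflection a : measurable_fun setT (reflection a).
Proof.
have : measurable_fun [set: R] (fun x : R => a - x) by exact: measurable_funB.
exact.
Qed.

HB.instance Definition _ (a : R) :=
  isMeasurableFun.Build _ _ _ _ (reflection a) (measurable_reflection a).

Notation mu := (@lebesgue_measure R).

(** By uniqueness it is enough to compare half-open intervals; the preimage is open at the other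
    end, which does not change the length. *)
Lemma lebesgue_measure_reflection a (A : set (measurableTypeR R)) : measurable A ->
  pushforward mu (reflection a) A = mu A.
Proof.
move=> mA; apply/esym/lebesgue_measure_unique => //= _ [[u v]] _ <-.
rewrite /pushforward /=.
have -> : reflection a @^-1` `]u, v] = `[(a - v), (a - u)[%classic.
  apply/seteqP; split => x /=; rewrite /reflection !in_itv /= => /andP[h1 h2];
  apply/andP; split; lra.
rewrite !lebesgue_measure_itv /= !lte_fin ltrD2l ltrN2.
by case: ifPn => // _; rewrite -!EFinD; congr EFin; lra.
Qed.

Lemma rintg_reflection a (f : R -> R) : rintg mu f -> rintg mu (fun x => f (a - x)).
Proof.
move=> if_; apply/integrableP; split.
  apply/measurable_EFinP; apply: (@measurableT_comp _ _ _ _ _ _ f) => //.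
    exact: rintg_meas if_.
  exact: measurable_reflection.
have mf : measurable_fun setT (fun x : measurableTypeR R => `|(f x)%:E|%E).
  apply: measurableT_comp => //; apply/measurable_EFinP; exact: rintg_meas if_.
have := @ge0_integral_pushforward _ _ _ _ R _ (measurable_reflection a) mu setT
  (fun x => `|(f x)%:E|%E) measurableT (measurable_funTS mf) (fun _ _ => abse_ge0 _).
rewrite preimage_setT /= => h.
have -> : (\int[mu]_x `|(f (a - x))%:E| = \int[mu]_x `|(f x)%:E|)%E.
  rewrite [LHS](_ : _ = (\int[mu]_x ((fun x => `|(f x)%:E|) \o reflection a) x)%E)//.
  rewrite -h; apply: eq_measure_integral => A mA _.
  exact: lebesgue_measure_reflection.
by have /integrableP[] := if_.
Qed.

Lemma Rintegral_reflection a (f : R -> R) : rintg mu f ->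
  \int[mu]_x f (a - x) = \int[mu]_x f x.
Proof.
move=> if_.
have mf : measurable_fun setT (EFin \o (f : measurableTypeR R -> R)).
  apply/measurable_EFinP; exact: rintg_meas if_.
have h := @integral_pushforward _ _ _ _ R _ (measurable_reflection a) mu setT
  (EFin \o f) mf (rintg_reflection a if_) measurableT.
rewrite preimage_setT in h; rewrite /Rintegral; congr fine.
rewrite [LHS](_ : _ = (\int[mu]_x ((EFin \o f) \o reflection a) x)%E)//.
rewrite -h; apply: eq_measure_integral => A mA _.
exact: lebesgue_measure_reflection.
Qed.

Lemma rintg_shift a (f : R -> R) : rintg mu f -> rintg mu (fun x => f (x - a)).
Proof.
move=> /(rintg_reflection (- a)) h.
have := rintg_reflection 0 h.
by under eq_fun do rewrite sub0r opprK addrC.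
Qed.

Lemma Rintegral_shift a (f : R -> R) : rintg mu f ->
  \int[mu]_x f (x - a) = \int[mu]_x f x.
Proof.
move=> if_; rewrite -[RHS](Rintegral_reflection (- a))//.
rewrite -[RHS](Rintegral_reflection 0); last exact: rintg_reflection.
by apply: eq_Rintegral => x _; rewrite sub0r opprK addrC.
Qed.

Lemma cintg_reflection a (f : R -> R[i]) : cintg mu f -> cintg mu (fun x => f (a - x)).
Proof. by move=> [f1 f2]; split; exact: (@rintg_reflection a (fun x => _ (f x))). Qed.

Lemma cintg_shift a (f : R -> R[i]) : cintg mu f -> cintg mu (fun x => f (x - a)).
Proof. by move=> [f1 f2]; split; exact: (@rintg_shift a (fun x => _ (f x))). Qed.

Lemma cint_shift a (f : R -> R[i]) : cintg mu f ->
  cint mu (fun x => f (x - a)) = cint mu f.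
Proof.
by move=> [f1 f2]; rewrite /cint; congr (_ +i* _);
   exact: (@Rintegral_shift a (fun x => _ (f x))).
Qed.

End Reflection.

(** * The Cauchy weight *)

Section CauchyWeight.
Variable R : realType.
Notation mu := (@lebesgue_measure R).
Variable N : R.
Hypothesis N0 : 0 < N.
Implicit Types x y : R.

(** For [y] between 0 and [x] the product of [exp (- a |y|)] and [exp (- a |x - y|)] equals
    [exp (- a |x|)], so that exponentials alone would lose a factor [|x|] under convolution. This
    factor of the weight keeps the integral in [y] bounded uniformly in [x]. *)
Definition hw x := (1 + (x / N) ^+ 2)^-1.

Let den_gt0 x : 0 < 1 + (x / N) ^+ 2.
Proof. by rewrite ltr_wpDr// sqr_ge0. Qed.

Lemma hw_gt0 x : 0 < hw x.
Proof. by rewrite invr_gt0. Qed.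

Lemma hw_ge0 x : 0 <= hw x.
Proof. exact/ltW/hw_gt0. Qed.

Lemma hw_le1 x : hw x <= 1.
Proof. by rewrite invf_le1// lerDl sqr_ge0. Qed.

Lemma hwN x : hw (- x) = hw x.
Proof. by rewrite /hw mulNr sqrrN. Qed.

(** Without denominators this is [1 + (a + b)^2 <= 2 (1 + a^2) + 2 (1 + b^2)], whose two sides
    differ by [3 + (a - b)^2]. *)
Lemma hw_conv x y : hw y * hw (x - y) <= 2 * hw x * (hw y + hw (x - y)).
Proof.
rewrite /hw; set a := y / N; set b := (x - y) / N.
have -> : x / N = a + b by rewrite /a /b; field; rewrite lt0r_neq0.
have A0 : 0 < 1 + a ^+ 2 by rewrite ltr_wpDr// sqr_ge0.
have B0 : 0 < 1 + b ^+ 2 by rewrite ltr_wpDr// sqr_ge0.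
have C0 : 0 < 1 + (a + b) ^+ 2 by rewrite ltr_wpDr// sqr_ge0.
rewrite -subr_ge0.
have -> : 2 * (1 + (a + b) ^+ 2)^-1 * ((1 + a ^+ 2)^-1 + (1 + b ^+ 2)^-1) -
  (1 + a ^+ 2)^-1 * (1 + b ^+ 2)^-1 =
  (3 + (a - b) ^+ 2) / ((1 + (a + b) ^+ 2) * (1 + a ^+ 2) * (1 + b ^+ 2)).
  by field; rewrite !lt0r_neq0.
apply: divr_ge0; first by rewrite addr_ge0 ?sqr_ge0.
by rewrite !mulr_ge0// ltW.
Qed.

(** For [t >= 0] one has [exp t >= (1 + t / 2)^2 >= (1 + t^2) / 4]. *)
Lemma expR_hw x : expR (- (`|x| / N)) <= 4 * hw x.
Proof.
rewrite /hw -[4 * _]invrK invfM invrK expRN lef_pV2 ?posrE ?expR_gt0//; last first.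
  by rewrite mulr_gt0// invr_gt0.
have -> : (x / N) ^+ 2 = (`|x| / N) ^+ 2 by rewrite !exprMn real_normK ?num_real.
have t0 : 0 <= `|x| / N by rewrite divr_ge0// ltW.
have := expR_ge1Dx (`|x| / N / 2); set t := `|x| / N in t0 *.
have -> : expR t = expR (t / 2) ^+ 2 by rewrite -expRM_natl; congr expR; field.
move=> h; apply: (@le_trans _ _ ((1 + t / 2) ^+ 2)); first by nra.
by rewrite ler_pXn2r// nnegrE; lra.
Qed.

Lemma continuous_hw : continuous hw.
Proof.
move=> x; apply: cvgV; first by rewrite lt0r_neq0.
apply: cvgD; first exact: cvg_cst.
apply: (@continuous_comp _ _ _ (fun x => x / N) (fun x => x ^+ 2)).
  exact: mulrr_continuous.
exact: exprn_continuous.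
Qed.

Lemma Rintegral_hw : rintg mu hw /\ \int[mu]_x hw x = pi * N.
Proof.
have h1 : (\int[mu]_x (hw x)%:E = (pi * N)%:E)%E.
  rewrite ge0_symfun_integralT; last 3 first.
  - exact: hw_ge0.
  - exact: continuous_hw.
  - by move=> x /=; rewrite hwN.
  have dF (x : R) : is_derive x 1 (fun x : R => N * atan (x / N)) (hw x).
    have d1 : is_derive x 1 (fun x : R => x / N) N^-1.
      under eq_fun do rewrite mulrC.
      by apply: (is_derive_eq (is_deriveZf _ (is_derive_id x 1))); rewrite mulr1.
    have d2 : is_derive (x / N) 1 (@atan R) (1 + (x / N) ^+ 2)^-1.
      by apply: DeriveDef; [exact: derivable_atan|rewrite -derive1E derive1_atan].
    have d3 := is_deriveZf N (is_derive_compf (g := fun x : R => x / N) d2 d1).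
    apply: (is_derive_eq d3).
    by rewrite /hw mulrCA mulfV ?mulr1// lt0r_neq0.
  rewrite -set_itvcy (@ge0_continuous_FTC2y _ hw (fun x : R => N * atan (x / N)) 0 (N * (pi / 2))).
  - rewrite mul0r atan0 mulr0 sube0 -EFinM; congr EFin; lra.
  - by move=> x _; exact: hw_ge0.
  - by apply: continuous_subspaceT; exact: continuous_hw.
  - apply: cvgM; first exact: cvg_cst.
    apply: (cvg_comp (fun x : R => x / N) (@atan R)); last exact: cvgy_atan.
    by apply: gt0_cvgMly; rewrite ?invr_gt0//; exact: cvg_cst.
  - by move=> x _; exact: (@ex_derive _ _ _ _ _ _ _ (dF x)).
  - by apply: cvg_at_right_filter; exact: (is_derive_continuous dF).
  - by move=> x _; rewrite derive1E; exact: (@derive_val _ _ _ _ _ _ _ (dF x)).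
split; last by rewrite /Rintegral h1.
apply/integrableP; split.
  apply/measurable_EFinP; apply: continuous_measurable_fun; exact: continuous_hw.
under eq_integral => x _ do rewrite gee0_abs ?lee_fin ?hw_ge0//.
by rewrite h1 ltry.
Qed.

Lemma rintg_hw : rintg mu hw. Proof. by have [] := Rintegral_hw. Qed.

Lemma rintg_expRN : rintg mu (fun x => expR (- (`|x| / N))).
Proof.
apply: (@rintg_dom _ _ R mu _ (fun x => 4 * hw x)).
- apply: measurableT_comp => //; apply: measurableT_comp => //.
  by apply: measurable_funM.
- by apply: rintgZ; exact: rintg_hw.
- by move=> x; rewrite ger0_norm ?expR_ge0// expR_hw.
Qed.

End CauchyWeight.

Section CmeasComp.
Context d1 d2 (T1 : measurableType d1) (T2 : measurableType d2) (R : realType).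

Lemma cmeas_comp (f : T2 -> R[i]) (g : T1 -> T2) : cmeas f ->
  measurable_fun setT g -> cmeas (fun x => f (g x)).
Proof.
move=> [f1 f2] mg; split.
- exact: (measurableT_comp f1 mg).
- exact: (measurableT_comp f2 mg).
Qed.

Lemma cmeas_fst (f : T1 -> R[i]) : cmeas f -> cmeas (fun z : T1 * T2 => f z.1).
Proof.
move=> [f1 f2]; split.
- exact: (measurableT_comp f1 (@measurable_fst _ _ T1 T2)).
- exact: (measurableT_comp f2 (@measurable_fst _ _ T1 T2)).
Qed.

Lemma cmeas_snd (f : T2 -> R[i]) : cmeas f -> cmeas (fun z : T1 * T2 => f z.2).
Proof.
move=> [f1 f2]; split.
- exact: (measurableT_comp f1 (@measurable_snd _ _ T1 T2)).
- exact: (measurableT_comp f2 (@measurable_snd _ _ T1 T2)).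
Qed.

End CmeasComp.

(** * Fourier transform *)

Section FourierTransform.
Variable R : realType.
Notation mu := (@lebesgue_measure R).
Notation RR := (measurableTypeR R * measurableTypeR R)%type.
Implicit Types (f g k : R -> R[i]) (s x y : R).

Lemma cmeas_fstR f : cmeas f -> cmeas (fun z : RR => f z.1).
Proof. by move=> mf; exact: (@cmeas_fst _ _ (measurableTypeR R) (measurableTypeR R)). Qed.

Lemma cmeas_sndR f : cmeas f -> cmeas (fun z : RR => f z.2).
Proof. by move=> mf; exact: (@cmeas_snd _ _ (measurableTypeR R) (measurableTypeR R)). Qed.

Definition c0 : R := (Num.sqrt (2 * pi))^-1.

Lemma c0_gt0 : 0 < c0.
Proof. by rewrite invr_gt0 sqrt2pi_gt0. Qed.

Lemma ifourierE f x :
  ifourier f x = c0%:C * cint mu (fun y => cis (x * y) * f y).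
Proof. by []. Qed.

(** Estimates are proved for [ifourier] only and transferred by this identity. *)
Lemma fourierE f x : fourier f x = ifourier f (- x).
Proof.
rewrite /fourier /ifourier; congr (_ * cintegral _ _); apply/funext => y.
by rewrite mulNr (mulrC x).
Qed.

Lemma cintg_cisM f (h : R -> R) : measurable_fun setT h -> cintg mu f ->
  cintg mu (fun x => cis (h x) * f x).
Proof.
move=> mh; apply: (@cintgM_bnd _ _ R mu _ _ 1).
- exact: (cmeas_cis mh).
- by move=> x; rewrite normc_cis.
Qed.

Lemma measurable_lin x : measurable_fun setT (fun y : R => x * y).
Proof. exact: measurable_funM. Qed.

Lemma normc_ifourier f x : cintg mu f ->
  normc (ifourier f x) <= c0 * \int[mu]_y normc (f y).
Proof.
move=> cf; rewrite normcM normc_real ger0_norm ?(ltW c0_gt0)// ler_wpM2l ?(ltW c0_gt0)//.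
apply: le_trans (normc_cint (cintg_cisM (measurable_lin x) cf)) _.
by rewrite le_eqVlt; apply/orP; left; apply/eqP/eq_Rintegral => y _; rewrite normc_cisM.
Qed.

Lemma ccont_ifourier f : cintg mu f -> ccont (ifourier f).
Proof.
move=> cf; apply: ccontM; first exact: ccont_cst.
apply: (@ccont_cint _ _ R mu (fun x y => cis (x * y) * f y) (fun y => normc (f y))).
- by move=> x; have [] := cintg_cisM (measurable_lin x) cf; move=> /rintg_meas a1 /rintg_meas a2.
- exact: cintg_normc.
- by move=> x y; rewrite normc_cisM.
- move=> y; apply: ccontM; last exact: ccont_cst.
  by apply: ccont_cis => x; exact: mulrr_continuous.
Qed.

(** The characteristic function of [gk s], by [cint_cis_gk]. It has three roles: the cutoff that
    regularizes the Parseval identity, the factor that makes the datum a Schwartz function, and, for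
    [s = 1], an ingredient of the test function. *)
Definition ge s x : R := expR (- (s ^+ 2 * x ^+ 2 / 2)).

(** The convolution of [f] with the even kernel [gk s]. *)
Definition gc s f y : R[i] := cint mu (fun x => (gk s (x - y))%:C * f x).

Section Kernel.
Variable s : R.
Hypothesis s0 : 0 < s.

Lemma ge_gk x : ge s x = (s * c0)^-1 * gk s^-1 x.
Proof.
rewrite /ge /gk /c0 mulrA.
have q0 : Num.sqrt (2 * pi) != 0 :> R by rewrite lt0r_neq0// sqrt2pi_gt0.
have -> : (s * (Num.sqrt (2 * pi))^-1)^-1 * (s^-1 * Num.sqrt (2 * pi))^-1 = 1.
  by field; rewrite lt0r_neq0.
rewrite mul1r; congr expR; congr (- _); field; rewrite lt0r_neq0//.
Qed.

Lemma ge_ge0 x : 0 <= ge s x. Proof. exact: expR_ge0. Qed.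

Lemma ge_le1 x : ge s x <= 1.
Proof.
by rewrite -[leRHS]expR0 ler_expR oppr_le0 mulr_ge0// mulr_ge0// sqr_ge0.
Qed.

Lemma rintg_ge : rintg mu (ge s).
Proof.
have -> : ge s = fun x => (s * c0)^-1 * gk s^-1 x by apply/funext; exact: ge_gk.
by apply: rintgZ; apply: rintg_gk; rewrite invr_gt0.
Qed.

(** Fourier inversion for the Gaussian, by computation: [ge s] is a multiple of [gk s^-1], whose
    transform is known. *)
Lemma cint_ge_cis y : (c0 ^+ 2)%:C * cint mu (fun x => (ge s x)%:C * cis (x * y)) = (gk s y)%:C.
Proof.
have si0 : 0 < s^-1 by rewrite invr_gt0.
have -> : cint mu (fun x => (ge s x)%:C * cis (x * y)) =
   ((s * c0)^-1)%:C * cint mu (fun x => cis (x * y) * (gk s^-1 x)%:C).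
  rewrite -cintZ; last first.
    apply: cintg_cisM; first exact: measurable_funM.
    exact/cintg_real/rintg_gk.
  by apply: eq_cint => x; rewrite ge_gk rmorphM /= -mulrA (mulrC (cis _)).
rewrite cint_cis_gk// -!rmorphM /=; congr (_%:C).
rewrite mulrA /gk (_ : c0 ^+ 2 * (s * c0)^-1 = (s * Num.sqrt (2 * pi))^-1).
  by congr (_ * expR _); congr (- _); field; rewrite lt0r_neq0.
rewrite /c0; field.
by rewrite !lt0r_neq0// sqrt2pi_gt0.
Qed.

Lemma measurable_gk : measurable_fun setT (gk s : R -> R).
Proof. by apply: continuous_measurable_fun; exact: continuous_gk. Qed.

(** The Gaussian makes the triple integral absolutely convergent, so that Fubini applies twice;
    integrating first over the variable [x] of the transforms produces the kernel of [gc]. *)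
Lemma Parseval_ge f k : cintg mu f -> cintg mu k ->
  cint mu (fun x => (ge s x)%:C * (ifourier f x * fourier k x)) =
  cint mu (fun y => k y * gc s f y).
Proof.
move=> cf ck.
pose M := c0 * \int[mu]_y normc (f y).
have mf := cintg_meas cf; have mk := cintg_meas ck.
have nf : rintg mu (fun y => normc (f y)) by exact: cintg_normc.
have nk : rintg mu (fun y => normc (k y)) by exact: cintg_normc.
have m1 : measurable_fun [set: RR] (fun z : RR => z.1 : R) by exact: measurable_fst.
have m2 : measurable_fun [set: RR] (fun z : RR => z.2 : R) by exact: measurable_snd.
have mge : cmeas (fun x : R => (ge s x)%:C) by apply: cmeas_real; exact: rintg_meas rintg_ge.
have mA : cmeas (ifourier f) by apply: ccont_meas; exact: ccont_ifourier.
have inner y : cint mu (fun x => (ge s x)%:C * (ifourier f x * (c0%:C * cis (- (x * y))))) =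
    gc s f y.
  pose F (z : RR) : R[i] := (c0 ^+ 2)%:C * ((ge s z.1)%:C * cis (z.1 * (z.2 - y)) * f z.2).
  transitivity (cint mu (fun x => cint mu (fun t => F (x, t)))).
    apply: eq_cint => x; rewrite /F /=.
    rewrite [RHS](_ : _ = cint mu (fun t => ((c0 ^+ 2)%:C * (ge s x)%:C * cis (- (x * y))) *
      (cis (x * t) * f t))); last first.
      apply: eq_cint => t; rewrite mulrBr cisD; ring.
    rewrite cintZ; last exact: cintg_cisM (measurable_lin x) cf.
    rewrite /ifourier rmorphXn /= -/c0; set I := cintegral _ _.
    rewrite -[cint _ _]/I; ring.
  rewrite (@cint_fubini _ _ _ _ R mu mu (fun x => c0 ^+ 2 * ge s x) (fun t => normc (f t))).
  - apply: eq_cint => t; rewrite /F /=.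
    rewrite [LHS](_ : _ = cint mu (fun x => ((c0 ^+ 2)%:C * f t) *
      ((ge s x)%:C * cis (x * (t - y))))); last first.
      by apply: eq_cint => x; ring.
    rewrite cintZ; last first.
      under eq_fun do rewrite mulrC.
      apply: cintg_cisM; first exact: measurable_funM.
      exact/cintg_real/rintg_ge.
    rewrite mulrAC cint_ge_cis; ring.
  - exact: (rintgZ _ rintg_ge).
  - exact: nf.
  - apply: cmeasM; first exact: cmeas_cst.
    apply: cmeasM; last exact: (cmeas_sndR mf).
    apply: cmeasM; first exact: (cmeas_fstR mge).
    by apply: cmeas_cis; apply: measurable_funM => //; exact: measurable_funB.
  - move=> x t; rewrite /F /= !normcM !normc_real normc_cis mulr1 normrX.
    by rewrite (ger0_norm (ge_ge0 x)) (ger0_norm (ltW c0_gt0)) mulrA.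
pose G (z : RR) : R[i] := (ge s z.1)%:C * (ifourier f z.1 * (c0%:C * cis (- (z.1 * z.2)))) * k z.2.
transitivity (cint mu (fun x => cint mu (fun y => G (x, y)))).
  apply: eq_cint => x; rewrite /G /= /fourier -/c0.
  rewrite [RHS](_ : _ = cint mu (fun t => ((ge s x)%:C * ifourier f x * c0%:C) *
    (cis (- (t * x)) * k t))); last first.
    by apply: eq_cint => t; rewrite (mulrC x); ring.
  rewrite cintZ; first by rewrite -[cint _ _]/(cintegral setT _); ring.
  apply: cintg_cisM => //; apply: measurableT_comp => //; exact: measurable_funM.
rewrite (@cint_fubini _ _ _ _ R mu mu (fun x => M * c0 * ge s x) (fun t => normc (k t))).
- apply: eq_cint => y; rewrite /G /= cintZr ?inner; first by rewrite mulrC.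
  under eq_fun do rewrite mulrC.
  apply: (@cintgM_bnd _ _ R mu _ _ (M * c0)).
  + apply: cmeasM => //; apply: cmeasM; first exact: cmeas_cst.
    by apply: cmeas_cis; apply: measurableT_comp => //; exact: measurable_funM.
  + move=> x; rewrite normcM [normc (_ * cis _)]normcM normc_cis mulr1 normc_real.
    rewrite (ger0_norm (ltW c0_gt0)).
    by rewrite ler_wpM2r ?(ltW c0_gt0)//; exact: normc_ifourier.
  + exact/cintg_real/rintg_ge.
- exact: (rintgZ _ rintg_ge).
- exact: nk.
- apply: cmeasM; last exact: (cmeas_sndR mk).
  apply: cmeasM; first exact: (cmeas_fstR mge).
  apply: cmeasM; first exact: (cmeas_fstR mA).
  apply: cmeasM; first exact: cmeas_cst.
  by apply: cmeas_cis; apply: measurableT_comp => //; exact: measurable_funM.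
- move=> x y; rewrite /G /= normcM normcM normcM [normc (_ * cis _)]normcM.
  rewrite !normc_real normc_cis mulr1.
  rewrite ler_wpM2r ?normc_ge0// (ger0_norm (ge_ge0 x)) (ger0_norm (ltW c0_gt0)) [leLHS]mulrC.
  rewrite ler_wpM2r ?ge_ge0// ler_wpM2r ?(ltW c0_gt0)//; exact: normc_ifourier.
Qed.

End Kernel.
End FourierTransform.

(** * Approximate identity, Parseval and Plancherel *)

Section Regularization.
Variable R : realType.
Notation mu := (@lebesgue_measure R).
Notation RR := (measurableTypeR R * measurableTypeR R)%type.
Implicit Types (f g k : R -> R[i]) (x y : R).

Definition local_cont f y := forall e : R, 0 < e ->
  exists2 d : R, 0 < d & forall x, `|x - y| < d -> normc (f x - f y) <= e.

Lemma ccont_local f y : ccont f -> local_cont f y.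
Proof.
move=> [f1 f2] e e0.
have e20 : 0 < e / 2 by rewrite divr_gt0.
have /cvgrPdist_lt/(_ _ e20) := f1 y => /nbhs_ballP [d1 /= d10 h1].
have /cvgrPdist_lt/(_ _ e20) := f2 y => /nbhs_ballP [d2 /= d20 h2].
exists (Num.min d1 d2); first by rewrite lt_min d10 d20.
move=> x; rewrite lt_min => /andP[xd1 xd2].
apply: le_trans (normc_ReIm _) _; rewrite ReD ImD ReN ImN.
have := h1 x; have := h2 x; rewrite /ball /= !(distrC y) => /(_ xd2) a /(_ xd1) b.
have := ltW a; have := ltW b; rewrite !(distrC _ (_ x)); lra.
Qed.

Lemma rintg_gk_shift s y : 0 < s -> rintg mu (fun x => gk s (x - y)).
Proof. by move=> s0; exact: (rintg_shift y (rintg_gk s0)). Qed.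

Lemma Rintegral_gk_shift s y : 0 < s -> \int[mu]_x gk s (x - y) = 1.
Proof.
by move=> s0; rewrite (Rintegral_shift y (rintg_gk s0)) Rintegral_gk.
Qed.

Lemma measurable_gk_shift s y : 0 < s -> measurable_fun setT (fun x => gk s (x - y)).
Proof. by move=> s0; exact: rintg_meas (rintg_gk_shift y s0). Qed.

Lemma gc_intg s f M y : 0 < s -> cmeas f -> (forall x, normc (f x) <= M) ->
  cintg mu (fun x => (gk s (x - y))%:C * f x).
Proof.
move=> s0 mf fM; under eq_fun do rewrite mulrC.
apply: (@cintgM_bnd _ _ R mu _ _ M) => //.
by apply: cintg_real; exact: rintg_gk_shift.
Qed.

Lemma gc_bound s f M y : 0 < s -> cmeas f -> (forall x, normc (f x) <= M) ->
  normc (gc s f y) <= M.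
Proof.
move=> s0 mf fM.
have ig := rintgZ M (rintg_gk_shift y s0).
apply: (@le_trans _ _ (\int[mu]_x (M * gk s (x - y)))).
  apply: normc_cint_le => //; first exact: cintg_meas (gc_intg y s0 mf fM).
  move=> x; rewrite normcM normc_real ger0_norm ?gk_ge0// mulrC.
  by rewrite ler_wpM2r ?gk_ge0.
by rewrite RintegralZl ?Rintegral_gk_shift ?mulr1//; exact: rintg_gk_shift.
Qed.

Lemma measurable_gk2 s : 0 < s ->
  measurable_fun [set: RR] (fun z : RR => gk s (z.2 - z.1)).
Proof.
move=> s0.
have m1 : measurable_fun [set: RR] (fun z : RR => z.1 : R) by exact: measurable_fst.
have m2 : measurable_fun [set: RR] (fun z : RR => z.2 : R) by exact: measurable_snd.
have h : measurable_fun [set: RR] (fun z : RR => z.2 - z.1 : R) by exact: measurable_funB.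
exact: (measurableT_comp (measurable_gk s0) h).
Qed.

Lemma cmeas_gc s f : 0 < s -> cmeas f -> cmeas (gc s f).
Proof.
move=> s0 mf.
apply: (@cmeas_cint _ _ (measurableTypeR R) (measurableTypeR R) R mu
   (fun z : RR => (gk s (z.2 - z.1))%:C * f z.2)).
apply: cmeasM; last exact: cmeas_sndR.
by apply: cmeas_real; exact: measurable_gk2.
Qed.

(** At distance less than [d] the oscillation of [f] is at most [e]. Farther away it is at most
    [2 * M], while [gk_expR_le] with [c = s^-1] bounds [gk s] by [2 * expR 1 * expR (- (d / s))]
    times the density [gk (2 * s)], of total mass 1. *)
Lemma gc_dist_le s f M y (e d : R) : 0 < s -> cmeas f -> (forall x, normc (f x) <= M) ->
  0 < d -> 0 <= e -> (forall x, `|x - y| < d -> normc (f x - f y) <= e) ->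
  normc (gc s f y - f y) <= e + 4 * M * expR 1 * expR (- (d / s)).
Proof.
move=> s0 mf fM d0 e0 fd.
have s20 : 0 < 2 * s by rewrite mulr_gt0.
have M0 : 0 <= M by apply: le_trans (fM y); exact: normc_ge0.
have -> : gc s f y - f y = cint mu (fun x => (gk s (x - y))%:C * (f x - f y)).
  transitivity (gc s f y - cint mu (fun x => (gk s (x - y))%:C * f y)).
    congr (_ - _); rewrite cintZr; last exact/cintg_real/rintg_gk_shift.
    by rewrite cint_real ?Rintegral_gk_shift ?mul1r//; exact: rintg_gk_shift.
  rewrite /gc -cintB.
  - by apply: eq_cint => x; rewrite mulrBr.
  - exact: gc_intg fM.
  - by apply: (@gc_intg _ (fun=> f y) M) => //; exact: cmeas_cst.
pose G x := e * gk s (x - y) + (2 * M * (2 * expR 1) * expR (- (d / s))) * gk (2 * s) (x - y).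
have iG : rintg mu G.
  by apply: rintgD; apply: rintgZ; exact: rintg_gk_shift.
apply: (@le_trans _ _ (\int[mu]_x G x)).
  apply: normc_cint_le => //.
    apply: cmeasM; first by apply: cmeas_real; exact: measurable_gk_shift.
    by apply: cmeasB => //; exact: cmeas_cst.
  move=> x; rewrite normcM normc_real ger0_norm ?gk_ge0// /G.
  set P := 2 * M * (2 * expR 1) * expR (- (d / s)).
  have P0 : 0 <= P by rewrite !mulr_ge0 ?expR_ge0.
  have g2 := gk_ge0 s20 (x - y); have g1 := gk_ge0 s0 (x - y).
  have [xd|xd] := ltP `|x - y| d.
    apply: (@le_trans _ _ (e * gk s (x - y))); last by rewrite lerDl mulr_ge0.
    by rewrite mulrC ler_wpM2r// fd.
  apply: (@le_trans _ _ (P * gk (2 * s) (x - y))); last by rewrite lerDr mulr_ge0.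
  have b1 : normc (f x - f y) <= 2 * M.
    apply: le_trans (normcB _ _) _; have := fM x; have := fM y; lra.
  have b2 : gk s (x - y) <= expR (- (d / s)) * (2 * expR 1 * gk (2 * s) (x - y)).
    have si0 : 0 <= s^-1 by rewrite invr_ge0 ltW.
    have := gk_expR_le s0 (x - y) si0.
    rewrite -exprMn mulVf ?lt0r_neq0// expr1n => h.
    rewrite expRN -ler_pdivrMl ?invr_gt0 ?expR_gt0// invrK; apply: le_trans h.
    rewrite ler_wpM2r// ler_expR mulrC ler_wpM2l//.
  apply: (@le_trans _ _ (expR (- (d / s)) * (2 * expR 1 * gk (2 * s) (x - y)) * (2 * M))).
    by apply: ler_pM => //; exact: normc_ge0.
  rewrite le_eqVlt; apply/orP; left; apply/eqP; rewrite /P; ring.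
rewrite /G RintegralD//; last 2 first.
- by apply: rintgZ; exact: rintg_gk_shift.
- by apply: rintgZ; exact: rintg_gk_shift.
have e1 (c t : R) : 0 < t -> \int[mu]_x (c * gk t (x - y)) = c.
  by move=> t0; rewrite RintegralZl ?Rintegral_gk_shift ?mulr1//; exact: rintg_gk_shift.
rewrite !e1// lerD2l le_eqVlt; apply/orP; left; apply/eqP; ring.
Qed.

Definition sn (n : nat) : R := n.+1%:R^-1.

Lemma sn_gt0 n : 0 < sn n. Proof. by rewrite invr_gt0. Qed.

Lemma expRN_cvg0 (d : R) : 0 < d -> expR (- (d / sn n)) @[n --> \oo] --> (0 : R).
Proof.
move=> d0; have h : d^-1 * n.+1%:R^-1 @[n --> \oo] --> (0 : R).
  by rewrite -(mulr0 d^-1); apply: cvgM; [exact: cvg_cst|exact: cvg_harmonic].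
apply: cvg0_le h => n; rewrite expR_ge0 /= /sn invrK expRN -invfM.
rewrite lef_pV2 ?posrE ?expR_gt0 ?mulr_gt0//.
by apply: le_trans (expR_ge1Dx _); rewrite lerDr.
Qed.

Lemma gc_cvg f M y : cmeas f -> (forall x, normc (f x) <= M) -> local_cont f y ->
  normc (gc (sn n) f y - f y) @[n --> \oo] --> (0 : R).
Proof.
move=> mf fM cf; apply/cvgrPdist_lt => e e0.
have e20 : 0 < e / 2 by rewrite divr_gt0.
have [d d0 fd] := cf _ e20.
set K := 4 * M * expR 1.
have h : K * expR (- (d / sn n)) @[n --> \oo] --> (0 : R).
  by rewrite -(mulr0 K); apply: cvgM; [exact: cvg_cst|exact: expRN_cvg0].
have /cvgrPdist_lt/(_ _ e20) := h.
apply: filterS => n; rewrite !sub0r !normrN => hn.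
rewrite ger0_norm ?normc_ge0//.
apply: le_lt_trans (gc_dist_le (sn_gt0 n) mf fM d0 (ltW e20) fd) _.
have := ler_norm (K * expR (- (d / sn n))); rewrite -/K; move: hn; lra.
Qed.

Lemma ge_cvg x : ge (sn n) x @[n --> \oo] --> (1 : R).
Proof.
have h : x ^+ 2 * n.+1%:R^-1 @[n --> \oo] --> (0 : R).
  by rewrite -(mulr0 (x ^+ 2)); apply: cvgM; [exact: cvg_cst|exact: cvg_harmonic].
suff : 1 - ge (sn n) x @[n --> \oo] --> (0 : R).
  move=> h1; have -> : (fun n => ge (sn n) x) = (fun n => 1 - (1 - ge (sn n) x)).
    by apply/funext => n; rewrite opprB addrC subrK.
  by rewrite -[X in _ --> X](subr0 (1 : R)); apply: cvgB => //; exact: cvg_cst.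
apply: cvg0_le h => n; rewrite subr_ge0 ge_le1/=.
have := expR_ge1Dx (- (sn n ^+ 2 * x ^+ 2 / 2)); rewrite -/(ge _ _).
have : sn n ^+ 2 * x ^+ 2 <= x ^+ 2 * n.+1%:R^-1.
  rewrite mulrC ler_wpM2l ?sqr_ge0// /sn expr2 ler_piMr ?invr_ge0//.
  by rewrite invf_le1// ler1n.
have : 0 <= sn n ^+ 2 * x ^+ 2 by rewrite mulr_ge0 ?sqr_ge0.
move: (sn n ^+ 2 * x ^+ 2) (x ^+ 2 * n.+1%:R^-1) (ge _ _) => p q r; lra.
Qed.

(** Remove the Gaussian from [Parseval_ge] along [sn n]: on the left [ge (sn n)] tends to 1 below an
    integrable function, on the right [gc (sn n) f] tends to [f] pointwise by continuity and stays
    below [M]. *)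
Lemma Parseval f k M : cintg mu f -> ccont f -> (forall x, normc (f x) <= M) ->
  cintg mu k -> cintg mu (fun x => ifourier f x * fourier k x) ->
  cint mu (fun x => ifourier f x * fourier k x) = cint mu (fun y => f y * k y).
Proof.
move=> cf cc fM ck ci.
have mf := cintg_meas cf.
pose L n := cint mu (fun x => (ge (sn n) x)%:C * (ifourier f x * fourier k x)).
have l1 : normc (L n - cint mu (fun x => ifourier f x * fourier k x)) @[n --> \oo] --> (0 : R).
  apply: (@cint_dcvg _ _ R mu _ _ (fun x => normc (ifourier f x * fourier k x))).
  - move=> n; apply: cmeasM; last exact: cintg_meas ci.
    by apply: cmeas_real; exact: rintg_meas (rintg_ge (sn_gt0 n)).
  - exact: cintg_meas ci.
  - exact: cintg_normc ci.
  - move=> n x; rewrite [leLHS]normcM normc_real ger0_norm ?ge_ge0//.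
    by rewrite ler_piMl ?normc_ge0// ge_le1.
  - move=> x; set z := ifourier f x * fourier k x.
    have h : normc z * (1 - ge (sn n) x) @[n --> \oo] --> (0 : R).
      rewrite -(mulr0 (normc z)); apply: cvgM; first exact: cvg_cst.
      by rewrite -(subrr (1 : R)); apply: cvgB; [exact: cvg_cst|exact: ge_cvg].
    apply: cvg0_le h => n; rewrite normc_ge0 andTb normc_dist -{1}(mul1r z) -mulrBl.
    by rewrite normcM mulrC normc_1B ger0_norm// subr_ge0 ge_le1.
have l2 : normc (L n - cint mu (fun y => f y * k y)) @[n --> \oo] --> (0 : R).
  have -> : L = fun n => cint mu (fun y => gc (sn n) f y * k y).
    apply/funext => n; rewrite /L Parseval_ge//; last exact: sn_gt0.
    by apply: eq_cint => y; rewrite mulrC.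
  have nk := cintg_normc ck; have mk := cintg_meas ck.
  apply: (@cint_dcvg _ _ R mu _ _ (fun y => M * normc (k y))).
  - by move=> n; apply: cmeasM => //; apply: cmeas_gc => //; exact: sn_gt0.
  - exact: cmeasM.
  - exact: rintgZ.
  - move=> n x; rewrite normcM ler_wpM2r ?normc_ge0//; apply: gc_bound => //.
    exact: sn_gt0.
  - move=> y; under eq_fun do rewrite -mulrBl normcM mulrC.
    rewrite -(mulr0 (normc (k y))); apply: cvgM; first exact: cvg_cst.
    by apply: gc_cvg mf fM _; exact: ccont_local.
set I := cint mu _ in l1 *; set J := cint mu _ in l2 *.
have l3 : normc (I - J) @[n --> \oo] --> (0 : R).
  have h : normc (L n - I) + normc (L n - J) @[n --> \oo] --> (0 : R).
    by rewrite -[X in _ --> X](addr0 (0 : R)); exact: cvgD.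
  apply: cvg0_le h => n; rewrite normc_ge0 andTb (normc_dist _ I).
  by rewrite -{1}(subrKA (L n)) normcD.
have : normc (I - J) = 0 by exact: (cvg_unique _ (@cvg_cst _ _ _ _ _) l3).
by move=> /Normc.eq0_normc/eqP; rewrite subr_eq0 => /eqP.
Qed.

Definition cconj (z : R[i]) : R[i] := complex.Re z -i* complex.Im z.

Lemma cconjM_normc z : z * cconj z = (normc z ^+ 2)%:C.
Proof.
rewrite sqr_normc; apply: complexP; rewrite ?ReM ?ImM /cconj /=.
- by rewrite mulrN opprK !expr2.
- by rewrite mulrN (mulrC (complex.Re z)) addNr.
Qed.

Lemma normc_cconj z : normc (cconj z) = normc z.
Proof. by rewrite !normcE /= sqrrN. Qed.

Lemma cintg_cconj f : cintg mu f -> cintg mu (fun x => cconj (f x)).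
Proof. by move=> [f1 f2]; split => //=; exact: rintgN. Qed.

Lemma fourier_cconj f x : cintg mu f ->
  fourier (fun y => cconj (f y)) x = cconj (ifourier f x).
Proof.
move=> cf; rewrite /fourier /ifourier -/c0.
have [h1 h2] := cintg_cisM (measurable_lin x) cf.
have e y : cis (- (y * x)) * cconj (f y) = cconj (cis (x * y) * f y).
  by apply: complexP; rewrite ?ReM ?ImM /= ?ReM ?ImM /= cosN sinN (mulrC y); ring.
under [X in cintegral _ X]eq_fun do rewrite e.
rewrite /cintegral /re_fun /im_fun; apply: complexP; rewrite ?ReM ?ImM /= ?ReM ?ImM /=.
- by rewrite !mul0r !subr0.
- rewrite !mul0r !addr0 -mulrN; congr (_ * _).
  rewrite -mulN1r -RintegralZl//; apply: eq_Rintegral => y _.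
  by rewrite mulN1r.
Qed.

(** Take the conjugate of [f] for [k] in [Parseval_ge]. The regularized left side increases with
    [n], so that monotone convergence yields the square integrability of [ifourier f] along with the
    value. *)
Lemma Plancherel f M : cintg mu f -> ccont f -> (forall x, normc (f x) <= M) ->
  (\int[mu]_x (normc (ifourier f x) ^+ 2)%:E = \int[mu]_x (normc (f x) ^+ 2)%:E)%E.
Proof.
move=> cf cc fM; have mf := cintg_meas cf; have nf := cintg_normc cf.
have M0 : 0 <= M by apply: le_trans (fM 0); exact: normc_ge0.
have ckf := cintg_cconj cf.
have i2 : rintg mu (fun x => normc (f x) ^+ 2).
  apply: (@rintg_dom _ _ R mu _ (fun x => M * normc (f x))).
  - by apply: measurable_funX; exact: measurable_normc.
  - exact: rintgZ.
  - by move=> x; rewrite ger0_norm ?exprn_ge0 ?normc_ge0// expr2 ler_wpM2r ?normc_ge0.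
have nI : measurable_fun setT (fun x => normc (ifourier f x)).
  by apply: measurable_normc; apply: ccont_meas; exact: ccont_ifourier.
pose L n := \int[mu]_x (ge (sn n) x * normc (ifourier f x) ^+ 2).
pose K := c0 R * \int[mu]_y normc (f y).
have K1 x : normc (ifourier f x) <= K by exact: normc_ifourier.
have iL n : rintg mu (fun x => ge (sn n) x * normc (ifourier f x) ^+ 2).
  apply: (@rintg_dom _ _ R mu _ (fun x => K ^+ 2 * ge (sn n) x)).
  - apply: measurable_funM; first exact: rintg_meas (rintg_ge (sn_gt0 n)).
    exact: measurable_funX.
  - by apply: rintgZ; exact: rintg_ge (sn_gt0 n).
  - move=> x; rewrite ger0_norm ?mulr_ge0 ?exprn_ge0 ?normc_ge0 ?ge_ge0// mulrC.
    rewrite ler_wpM2r ?ge_ge0// ler_pXn2r ?nnegrE ?normc_ge0//.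
    by apply: le_trans (K1 0); exact: normc_ge0.
have Lcvg : L n @[n --> \oo] --> \int[mu]_x (normc (f x) ^+ 2).
  have e1 n : (L n)%:C = cint mu (fun y => cconj (f y) * gc (sn n) f y).
    rewrite -Parseval_ge//; last exact: sn_gt0.
    rewrite /L -cint_real//; apply: eq_cint => x.
    by rewrite fourier_cconj// cconjM_normc -rmorphM.
  have h : normc ((L n)%:C - cint mu (fun y => cconj (f y) * f y)) @[n --> \oo] --> (0 : R).
    under eq_fun do rewrite e1.
    apply: (@cint_dcvg _ _ R mu _ _ (fun y => M * normc (f y))).
    - move=> n; apply: cmeasM; first exact: cintg_meas ckf.
      by apply: cmeas_gc => //; exact: sn_gt0.
    - by apply: cmeasM => //; exact: cintg_meas ckf.
    - exact: rintgZ.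
    - move=> n x; rewrite normcM normc_cconj mulrC ler_wpM2r ?normc_ge0//.
      by apply: gc_bound => //; exact: sn_gt0.
    - move=> y; under eq_fun do rewrite -mulrBr normcM.
      rewrite -(mulr0 (normc (cconj (f y)))); apply: cvgM; first exact: cvg_cst.
      by apply: gc_cvg mf fM _; exact: ccont_local.
  apply/cvgrPdist_lt => e e0; have /cvgrPdist_lt/(_ _ e0) := h.
  apply: filterS => n; rewrite sub0r normrN ger0_norm ?normc_ge0//.
  rewrite (_ : cint mu _ = (\int[mu]_x (normc (f x) ^+ 2))%:C).
    by rewrite -rmorphB normc_real distrC.
  by rewrite -cint_real//; apply: eq_cint => x; rewrite mulrC cconjM_normc.
have e2 : (\int[mu]_x (normc (ifourier f x) ^+ 2)%:E =
    limn (fun n => \int[mu]_x (ge (sn n) x * normc (ifourier f x) ^+ 2)%:E))%E.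
  rewrite -(monotone_convergence mu measurableT).
  - apply: eq_integral => x _; apply/esym/cvg_lim => //.
    apply: cvg_EFin; first exact: nearW.
    rewrite -[X in _ --> X]mul1r; apply: cvgM; [exact: ge_cvg|exact: cvg_cst].
  - by move=> n; apply/measurable_EFinP; exact: rintg_meas (iL n).
  - by move=> n x _; rewrite lee_fin mulr_ge0 ?exprn_ge0 ?normc_ge0 ?ge_ge0.
  - move=> x _ n m nm; rewrite lee_fin ler_wpM2r ?exprn_ge0 ?normc_ge0//.
    rewrite ler_expR lerN2 ler_wpM2r ?invr_ge0// ler_wpM2r ?sqr_ge0//.
    rewrite ler_pXn2r ?nnegrE ?(ltW (sn_gt0 _))// /sn lef_pV2 ?posrE//.
    by rewrite ler_nat ltnS.
rewrite e2 -[RHS](Rintegral_EFin i2); apply/cvg_lim => //.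
under eq_fun do rewrite -Rintegral_EFin//.
by apply: cvg_EFin => //; exact: nearW.
Qed.

End Regularization.

(** * Convolutions and exponential decay *)

Section Convolution.
Variable R : realType.
Notation mu := (@lebesgue_measure R).
Notation RR := (measurableTypeR R * measurableTypeR R)%type.
Implicit Types (f g v w : R -> R[i]) (x y : R).

Definition conv v w x : R[i] := cint mu (fun y => v y * w (x - y)).

Lemma measurable_sub2 : measurable_fun [set: RR] (fun z : RR => z.1 - z.2 : R).
Proof.
have m1 : measurable_fun [set: RR] (fun z : RR => z.1 : R) by exact: measurable_fst.
have m2 : measurable_fun [set: RR] (fun z : RR => z.2 : R) by exact: measurable_snd.
exact: measurable_funB.
Qed.

Lemma cmeas_convF v w : cmeas v -> cmeas w ->
  cmeas (fun z : RR => v z.2 * w (z.1 - z.2)).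
Proof.
move=> mv mw; apply: cmeasM; first exact: cmeas_sndR.
exact: (cmeas_comp mw measurable_sub2).
Qed.

Lemma cmeas_conv v w : cmeas v -> cmeas w -> cmeas (conv v w).
Proof.
move=> mv mw.
exact: (@cmeas_cint _ _ (measurableTypeR R) (measurableTypeR R) R mu _ (cmeas_convF mv mw)).
Qed.

Lemma ccont_conv v w M : cintg mu v -> ccont w -> (forall x, normc (w x) <= M) ->
  ccont (conv v w).
Proof.
move=> cv cw wM.
apply: (@ccont_cint _ _ R mu (fun x y => v y * w (x - y)) (fun y => M * normc (v y))).
- move=> x; apply: cmeasM; first exact: cintg_meas cv.
  apply: (cmeas_comp (ccont_meas cw)).
  exact: measurable_funB.
- by apply: rintgZ; exact: cintg_normc.
- by move=> x y; rewrite normcM mulrC ler_wpM2r ?normc_ge0.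
- move=> y; apply: ccontM; first exact: ccont_cst.
  apply: (ccont_comp cw) => x; apply: cvgB; [exact: cvg_id|exact: cvg_cst].
Qed.

(** Fubini and a translation in the inner integral. Since the transform is unitarily normalized, one
    factor [c0] remains. *)
Lemma ifourier_conv v w (a b : R -> R) : cintg mu v -> cintg mu w ->
  rintg mu a -> rintg mu b ->
  (forall x y, normc (v y * w (x - y)) <= a x * b y) ->
  forall x, ifourier v x * ifourier w x = (c0 R)%:C * ifourier (conv v w) x.
Proof.
move=> cv cw ia ib vw x.
have mv := cintg_meas cv; have mw := cintg_meas cw.
have cwx := cintg_cisM (measurable_lin x) cw.
pose F (z : RR) : R[i] := cis (x * z.1) * (v z.2 * w (z.1 - z.2)).
have swap : cint mu (fun t => cint mu (fun y => F (t, y))) =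
            cint mu (fun y => cint mu (fun t => F (t, y))).
  apply: (@cint_fubini _ _ _ _ R mu mu a b) => //.
  - apply: cmeasM; last exact: cmeas_convF.
    by apply: cmeas_cis; apply: measurable_funM => //; exact: measurable_fst.
  - by move=> t y; rewrite /F /= normc_cisM.
have e1 : ifourier (conv v w) x = (c0 R)%:C * cint mu (fun t => cint mu (fun y => F (t, y))).
  rewrite ifourierE; congr (_ * _).
  apply: eq_cint => t.
  refine (esym (@cintZ _ _ R mu (fun y => v y * w (t - y)) (cis (x * t)) _)).
  apply: (@cintg_dom _ _ R mu _ (fun y => a t * b y)).
  - apply: cmeasM; first exact: mv.
    apply: (cmeas_comp mw).
    exact: measurable_funB.
  - exact: rintgZ.
  - by move=> y; exact: vw.
rewrite e1 swap.
have -> : cint mu (fun y => cint mu (fun t => F (t, y))) =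
    cint mu (fun y => cis (x * y) * v y) * cint mu (fun t => cis (x * t) * w t).
  rewrite -cintZr; last exact: cintg_cisM (measurable_lin x) cv.
  apply: eq_cint => y; rewrite -(cint_shift y cwx) -cintZ; last exact: cintg_shift cwx.
  apply: eq_cint => t; rewrite /F /=.
  have -> : x * t = x * y + x * (t - y) by ring.
  rewrite cisD; ring.
rewrite !ifourierE; ring.
Qed.

(** Mollification preserves every weight that varies at most exponentially in the distance. Both
    [gc_decay] and [bump_upper] are instances. *)
Lemma gc_weight s g (H c : R) y : 0 < s -> cmeas g -> 0 <= c -> 0 <= H ->
  (forall x, normc (g x) <= H * expR (c * `|x - y|)) ->
  normc (gc s g y) <= H * (2 * expR (c ^+ 2 * s ^+ 2)).
Proof.
move=> s0 mg c_0 H0 gH; have s20 : 0 < 2 * s by rewrite mulr_gt0.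
set K := 2 * expR _.
have ig : rintg mu (fun x => H * K * gk (2 * s) (x - y)).
  by apply: rintgZ; exact: rintg_gk_shift.
apply: (@le_trans _ _ (\int[mu]_x (H * K * gk (2 * s) (x - y)))).
  apply: normc_cint_le => //.
    apply: cmeasM => //; apply: cmeas_real; exact: measurable_gk_shift.
  move=> x; rewrite normcM normc_real ger0_norm ?gk_ge0//.
  have h1 := gk_expR_le s0 (x - y) c_0; rewrite -/K in h1.
  apply: (@le_trans _ _ (gk s (x - y) * (H * expR (c * `|x - y|)))).
    by rewrite ler_wpM2l ?gk_ge0.
  rewrite [leLHS](_ : _ = H * (expR (c * `|x - y|) * gk s (x - y))); last by ring.
  by rewrite -[leRHS]mulrA ler_wpM2l.
rewrite RintegralZl ?Rintegral_gk_shift ?mulr1//; exact: rintg_gk_shift.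
Qed.

Lemma gc_decay s g (A c : R) y : 0 < s -> cmeas g -> 0 <= c ->
  (forall x, normc (g x) <= A * expR (- (c * `|x|))) ->
  normc (gc s g y) <= A * (2 * expR (c ^+ 2 * s ^+ 2)) * expR (- (c * `|y|)).
Proof.
move=> s0 mg c_0 gA.
have A0 : 0 <= A.
  have := le_trans (normc_ge0 _) (gA 0).
  by rewrite normr0 mulr0 oppr0 expR0 mulr1.
rewrite mulrAC; apply: gc_weight => //; first by rewrite mulr_ge0// expR_ge0.
move=> x; apply: le_trans (gA x) _; rewrite -mulrA ler_wpM2l// -expRD ler_expR.
have h : `|y| <= `|x - y| + `|x|.
  by have := ler_distD x y 0; rewrite !subr0 (distrC y).
by have := ler_wpM2l c_0 h; rewrite mulrDr; lra.
Qed.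

Lemma rintg_expRc (c : R) : 0 < c -> rintg mu (fun x => expR (- (c * `|x|))).
Proof.
move=> c_0; have ci : 0 < c^-1 by rewrite invr_gt0.
have := rintg_expRN ci; under eq_fun do rewrite invrK mulrC.
exact.
Qed.

Lemma cintg_exp g (A c : R) : 0 < c -> cmeas g ->
  (forall x, normc (g x) <= A * expR (- (c * `|x|))) -> cintg mu g.
Proof.
move=> c_0 mg gA.
apply: (@cintg_dom _ _ R mu _ (fun x => A * expR (- (c * `|x|)))) => //.
by apply: rintgZ; exact: rintg_expRc.
Qed.

Lemma gk_exp_le s (c : R) : 0 < s -> 0 <= c -> exists K : R, 0 <= K /\
  forall x, gk s x <= K * expR (- (c * `|x|)).
Proof.
move=> s0 c_0; have s20 : 0 < 2 * s by rewrite mulr_gt0.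
exists (2 * expR (c ^+ 2 * s ^+ 2) * (2 * s * Num.sqrt (2 * pi))^-1); split.
  by rewrite !mulr_ge0 ?expR_ge0// invr_ge0 mulr_ge0 ?(ltW s20) ?(ltW (@sqrt2pi_gt0 R)).
move=> x; rewrite expRN ler_pdivlMr ?expR_gt0// mulrC.
apply: le_trans (gk_expR_le s0 x c_0) _.
by rewrite ler_wpM2l ?mulr_ge0 ?expR_ge0// gk_le.
Qed.

(** Mollifying in frequency multiplies by a Gaussian in space, which is the reason why the initial
    datum is a Schwartz function. *)
Lemma ifourier_gc s g (A c : R) x : 0 < s -> 0 < c -> cmeas g ->
  (forall x, normc (g x) <= A * expR (- (c * `|x|))) ->
  ifourier (gc s g) x = (ge s x)%:C * ifourier g x.
Proof.
move=> s0 c_0 mg gA.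
have ig : cintg mu g by exact: cintg_exp c_0 mg gA.
have A0 : 0 <= A.
  have := le_trans (normc_ge0 _) (gA 0).
  by rewrite normr0 mulr0 oppr0 expR0 mulr1.
have gA' y : normc (g y) <= A.
  apply: le_trans (gA y) _; rewrite ler_piMr//.
  by rewrite -[leRHS]expR0 ler_expR oppr_le0 mulr_ge0// ltW.
(* Half of the rate is spent on [|t| <= |y - t| + |y|], which separates the variables in the
   majorant. *)
have c20 : 0 < c / 2 by rewrite divr_gt0.
have [K [K0 HK]] := gk_exp_le s0 (ltW c20).
pose F (z : RR) : R[i] := cis (x * z.1) * ((gk s (z.2 - z.1))%:C * g z.2).
have FE t y : normc (F (t, y)) <= K * A * expR (- (c / 2 * `|t|)) * expR (- (c / 2 * `|y|)).
  rewrite /F /= normc_cisM normcM normc_real ger0_norm ?gk_ge0//.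
  apply: (@le_trans _ _ (K * expR (- (c / 2 * `|y - t|)) * (A * expR (- (c * `|y|))))).
    by apply: ler_pM => //; [exact: gk_ge0|exact: normc_ge0].
  rewrite [leLHS](_ : _ = K * A * expR (- (c / 2 * `|y - t|) + - (c * `|y|))); last first.
    by rewrite expRD; ring.
  rewrite -[leRHS]mulrA -expRD ler_wpM2l ?mulr_ge0// ler_expR.
  have : `|t| <= `|y - t| + `|y|.
    by have := ler_distD y t 0; rewrite !subr0 distrC.
  by move: `|t| `|y - t| `|y| => p q r; nra.
have swap : cint mu (fun t => cint mu (fun y => F (t, y))) =
            cint mu (fun y => cint mu (fun t => F (t, y))).
  apply: (@cint_fubini _ _ _ _ R mu mu (fun t => K * A * expR (- (c / 2 * `|t|)))
     (fun y => expR (- (c / 2 * `|y|)))) => //.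
  - by apply: rintgZ; exact: rintg_expRc.
  - exact: rintg_expRc.
  - apply: cmeasM.
      by apply: cmeas_cis; apply: measurable_funM => //; exact: measurable_fst.
    apply: cmeasM; last exact: cmeas_sndR.
    by apply: cmeas_real; exact: measurable_gk2.
rewrite !ifourierE mulrCA; congr (_ * _).
transitivity (cint mu (fun t => cint mu (fun y => F (t, y)))).
  apply: eq_cint => t.
  refine (esym (@cintZ _ _ R mu (fun y => (gk s (y - t))%:C * g y) (cis (x * t)) _)).
  exact: (@gc_intg _ s g A t s0 mg gA').
rewrite swap -cintZ; last exact: cintg_cisM (measurable_lin x) ig.
apply: eq_cint => y; rewrite /F /=.
have e1 : cint mu (fun t => cis (t * x) * (gk s t)%:C) = (ge s x)%:C by exact: cint_cis_gk.
have c1 : cintg mu (fun t => cis (t * x) * (gk s t)%:C).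
  apply: cintg_cisM; first exact: measurable_funM.
  exact/cintg_real/rintg_gk.
rewrite -e1 -(cint_shift y c1) -cintZr; last exact: cintg_shift c1.
apply: eq_cint => t.
have -> : gk s (y - t) = gk s (t - y) by rewrite -gkN opprB.
have -> : x * t = (t - y) * x + x * y by ring.
rewrite cisD; ring.
Qed.

Lemma ccont_gc s g (A c : R) : 0 < s -> 0 < c -> cmeas g ->
  (forall x, normc (g x) <= A * expR (- (c * `|x|))) -> ccont (gc s g).
Proof.
move=> s0 c_0 mg gA.
have ig : cintg mu g by exact: cintg_exp c_0 mg gA.
apply: (@ccont_cint _ _ R mu (fun y x => (gk s (x - y))%:C * g x)
  (fun x => (s * Num.sqrt (2 * pi))^-1 * normc (g x))).
- by move=> x; apply: cmeasM => //; apply: cmeas_real; exact: measurable_gk_shift.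
- by apply: rintgZ; exact: cintg_normc.
- move=> x y; rewrite normcM normc_real ger0_norm ?gk_ge0//.
  by rewrite ler_wpM2r ?normc_ge0// gk_le.
- move=> y; apply: ccontM; last exact: ccont_cst.
  apply: ccont_real => x; apply: (@continuous_comp _ _ _ (fun x : R => y - x) (gk s)).
    by apply: cvgB; [exact: cvg_cst|exact: cvg_id].
  exact: continuous_gk.
Qed.

End Convolution.

(** * Differentiation of complex-valued functions *)

Section ComplexDerivative.
Variable R : realType.
Notation mu := (@lebesgue_measure R).
Implicit Types (f g h : R -> R[i]) (x y : R) (z : R[i]).

Definition is_cder f x z : Prop :=
  is_derive x 1 (fun y => complex.Re (f y)) (complex.Re z) /\
  is_derive x 1 (fun y => complex.Im (f y)) (complex.Im z).

Lemma is_cder_eq f x z w : is_cder f x z -> z = w -> is_cder f x w.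
Proof. by move=> h <-. Qed.

Lemma is_cderM f g x z w : is_cder f x z -> is_cder g x w ->
  is_cder (fun y => f y * g y) x (z * g x + f x * w).
Proof.
move=> [f1 f2] [g1 g2]; split.
- under eq_fun do rewrite ReM.
  apply: (is_derive_eq (is_deriveBf (is_deriveMf f1 g1) (is_deriveMf f2 g2))).
  by rewrite ReD !ReM; ring.
- under eq_fun do rewrite ImM.
  apply: (is_derive_eq (is_deriveDf (is_deriveMf f1 g2) (is_deriveMf f2 g1))).
  by rewrite ImD !ImM; ring.
Qed.

Lemma is_cderD f g x z w : is_cder f x z -> is_cder g x w ->
  is_cder (fun y => f y + g y) x (z + w).
Proof.
move=> [f1 f2] [g1 g2]; split.
- under eq_fun do rewrite ReD.
  by apply: (is_derive_eq (is_deriveDf f1 g1)); rewrite ReD.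
- under eq_fun do rewrite ImD.
  by apply: (is_derive_eq (is_deriveDf f2 g2)); rewrite ImD.
Qed.

Lemma is_cder_cst z x : is_cder (fun=> z) x 0.
Proof. by split; exact: is_derive_cst. Qed.

Lemma is_cderZ f x z w : is_cder f x z -> is_cder (fun y => w * f y) x (w * z).
Proof.
by move=> h; apply: (is_cder_eq (is_cderM (is_cder_cst w x) h)); rewrite mul0r add0r.
Qed.

Lemma is_cder_real (r : R -> R) x (a : R) : is_derive x 1 r a ->
  is_cder (fun y => (r y)%:C) x a%:C.
Proof. by move=> h; split => //=; exact: is_derive_cst. Qed.

Lemma is_cder_cis x y : is_cder (fun y => cis (x * y)) y ('i * x%:C * cis (x * y)).
Proof.
have dz : is_derive y 1 (fun z : R => x * z) x.
  by apply: (is_derive_eq (is_deriveZf x (is_derive_id y 1))); rewrite mulr1.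
split => /=.
- have d := is_derive_compf (f := cos) (g := fun z : R => x * z) (is_derive_cos (x * y)) dz.
  apply: (is_derive_eq d).
  by rewrite !(mul0r, mulr0, add0r, subr0, mul1r, addr0); ring.
- have d := is_derive_compf (f := sin) (g := fun z : R => x * z) (is_derive_sin (x * y)) dz.
  apply: (is_derive_eq d).
  by rewrite !(mul0r, mulr0, add0r, subr0, mul1r, addr0); ring.
Qed.

Lemma is_cder_ccont f f' : (forall x, is_cder f x (f' x)) -> ccont f.
Proof.
move=> df; split.
- by apply: (@is_derive_continuous _ _ (fun x => complex.Re (f' x))) => x; have [] := df x.
- by apply: (@is_derive_continuous _ _ (fun x => complex.Im (f' x))) => x; have [] := df x.
Qed.

Lemma cint_derive_eq0 f f' : (forall x, is_cder f x (f' x)) -> ccont f' ->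
  cintg mu f' -> normc (f n%:R) @[n --> \oo] --> (0 : R) ->
  normc (f (- n%:R)) @[n --> \oo] --> (0 : R) -> cint mu f' = 0.
Proof.
move=> df [c1 c2] [i1 i2] f0 f0N.
have H (P : R[i] -> R) u : (forall z, `|P z| <= normc z) ->
    normc (f (u n)) @[n --> \oo] --> (0 : R) -> P (f (u n)) @[n --> \oo] --> (0 : R).
  move=> hP hu; apply/norm_cvg0P; apply: cvg0_le hu => n.
  by rewrite normr_ge0 hP.
rewrite /cint; apply: complexP => /=.
- apply: (@Rintegral_derive_eq0 R (fun x => complex.Re (f x)) _ _ c1 i1).
  + by move=> x; have [] := df x.
  + exact: (H (@complex.Re R) (fun n => n%:R) (@normc_Re R) f0).
  + exact: (H (@complex.Re R) (fun n => - n%:R) (@normc_Re R) f0N).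
- apply: (@Rintegral_derive_eq0 R (fun x => complex.Im (f x)) _ _ c2 i2).
  + by move=> x; have [] := df x.
  + exact: (H (@complex.Im R) (fun n => n%:R) (@normc_Im R) f0).
  + exact: (H (@complex.Im R) (fun n => - n%:R) (@normc_Im R) f0N).
Qed.

Lemma trig_intg (k : R -> R) x : rintg mu k ->
  rintg mu (fun t => cos (t * x) * k t) /\ rintg mu (fun t => sin (t * x) * k t).
Proof.
move=> ik; have nk : rintg mu (fun t => `|k t|) by exact: (integrable_norm ik).
have ml : measurable_fun setT (fun t : R => t * x) by exact: measurable_funM.
split; (apply: (@rintg_dom _ _ R mu _ (fun t => `|k t|)) nk _; last first).
- by move=> t; rewrite normrM ler_piMl// ler_norml cos_geN1 cos_le1.
- apply: measurable_funM; last exact: rintg_meas ik.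
  exact: (measurableT_comp (continuous_measurable_fun (@continuous_cos R)) ml).
- by move=> t; rewrite normrM ler_piMl// ler_norml sin_geN1 sin_le1.
- apply: measurable_funM; last exact: rintg_meas ik.
  exact: (measurableT_comp (continuous_measurable_fun (@continuous_sin R)) ml).
Qed.

Lemma Re_ifourier h x : cintg mu h -> complex.Re (ifourier h x) =
  c0 R * (\int[mu]_t (cos (t * x) * complex.Re (h t)) -
          \int[mu]_t (sin (t * x) * complex.Im (h t))).
Proof.
move=> [h1 h2]; rewrite ifourierE ReM /cint /= mul0r subr0; congr (_ * _).
have [a1 _] := trig_intg x h1; have [_ a2] := trig_intg x h2.
by rewrite -RintegralB//; apply: eq_Rintegral => t _; rewrite ReM /= (mulrC x).
Qed.

Lemma Im_ifourier h x : cintg mu h -> complex.Im (ifourier h x) =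
  c0 R * (\int[mu]_t (cos (t * x) * complex.Im (h t)) +
          \int[mu]_t (sin (t * x) * complex.Re (h t))).
Proof.
move=> [h1 h2]; rewrite ifourierE ImM /cint /= mul0r addr0; congr (_ * _).
have [_ a1] := trig_intg x h1; have [a2 _] := trig_intg x h2.
by rewrite -RintegralD//; apply: eq_Rintegral => t _; rewrite ImM /= (mulrC x).
Qed.

(** Split into real cosine and sine transforms, to which [is_derive_param] applies; the four
    derivatives recombine into the factor ['i * y]. *)
Lemma is_cder_ifourier h x : cintg mu h -> cintg mu (fun y => y%:C * h y) ->
  is_cder (ifourier h) x (ifourier (fun y => 'i * (y%:C * h y)) x).
Proof.
move=> ch ch1; have [h1 h2] := ch.
have ch2 := cintgZ 'i ch1.
have [h3' h4'] := ch1.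
have h3 : rintg mu (fun y => y * complex.Re (h y)).
  move: h3'; rewrite (_ : (fun y => _) = (fun y => y * complex.Re (h y)))//.
  by apply/funext => y; rewrite ReM /= mul0r subr0.
have h4 : rintg mu (fun y => y * complex.Im (h y)).
  move: h4'; rewrite (_ : (fun y => _) = (fun y => y * complex.Im (h y)))//.
  by apply/funext => y; rewrite ImM /= mul0r addr0.
have cN : continuous (fun x : R => - sin x).
  by move=> t; apply: cvgN; exact: continuous_sin.
have b1 (t : R) : `|cos t| <= 1 by rewrite ler_norml cos_geN1 cos_le1.
have b2 (t : R) : `|sin t| <= 1 by rewrite ler_norml sin_geN1 sin_le1.
have b3 (t : R) : `|- sin t| <= 1 by rewrite normrN.
have dc (k : R -> R) (k1 : rintg mu k) (k2 : rintg mu (fun y => y * k y)) :=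
  is_derive_param x k1 k2 (@is_derive_cos R) cN b1 b3.
have ds (k : R -> R) (k1 : rintg mu k) (k2 : rintg mu (fun y => y * k y)) :=
  is_derive_param x k1 k2 (@is_derive_sin R) (@continuous_cos R) b2 b1.
split.
- under eq_fun do rewrite Re_ifourier//.
  apply: (is_derive_eq (is_deriveZf _ (is_deriveBf (dc _ h1 h3) (ds _ h2 h4)))).
  rewrite Re_ifourier//; congr (_ * _).
  have [_ a1] := trig_intg x h3; have [a2 _] := trig_intg x h4.
  have e1 : \int[mu]_t (- sin (t * x) * (t * complex.Re (h t))) =
      - (\int[mu]_t (sin (t * x) * (t * complex.Re (h t)))).
    rewrite -mulN1r -RintegralZl//; apply: eq_Rintegral => t _.
    by rewrite mulN1r mulNr.
  have e2 : \int[mu]_t (cos (t * x) * complex.Re ('i * (t%:C * h t))) =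
      - (\int[mu]_t (cos (t * x) * (t * complex.Im (h t)))).
    rewrite -mulN1r -RintegralZl//; apply: eq_Rintegral => t _.
    by rewrite ReM ImM /=; ring.
  rewrite e1 e2 addrC; congr (_ - _); apply: eq_Rintegral => t _.
  by rewrite ImM ReM /=; ring.
- under eq_fun do rewrite Im_ifourier//.
  apply: (is_derive_eq (is_deriveZf _ (is_deriveDf (dc _ h2 h4) (ds _ h1 h3)))).
  rewrite Im_ifourier//; congr (_ * _); rewrite addrC; congr (_ + _).
  + by apply: eq_Rintegral => t _; rewrite ImM /= ReM /=; ring.
  + apply: eq_Rintegral => t _; rewrite ReM /= ImM /=; ring.
Qed.

End ComplexDerivative.

(** * Schwartz functions *)

Section SchwartzFunctions.
Variable R : realType.
Notation mu := (@lebesgue_measure R).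
Implicit Types (f g h : R -> R[i]) (x y : R) (z : R[i]).

Lemma is_cder_derive f x z : is_cder f x z ->
  (re_fun f)^`()%classic x = complex.Re z /\ (im_fun f)^`()%classic x = complex.Im z.
Proof.
move=> [h1 h2]; rewrite !derive1E; split.
- exact: (@derive_val _ _ _ _ _ _ _ h1).
- exact: (@derive_val _ _ _ _ _ _ _ h2).
Qed.

(** A class stable under differentiation contains all iterated derivatives of its members, so that
    bounded moments of the members themselves are enough. *)
Lemma schwartz_class (C : (R -> R[i]) -> Prop) :
  (forall f, C f -> exists f', C f' /\ forall x, is_cder f x (f' x)) ->
  (forall f, C f -> forall k, exists M : R, forall x, `|x| ^+ k * normc (f x) <= M) ->
  forall f, C f -> schwartz f.
Proof.
move=> Cd Cb f Cf.
have H n : exists fn, C fn /\ (forall x,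
    derive1n n (re_fun f) x = complex.Re (fn x) /\
    derive1n n (im_fun f) x = complex.Im (fn x)).
  elim: n => [|n [g [Cg gE]]]; first by exists f.
  have [g' [Cg' dg]] := Cd _ Cg; exists g'; split => // x.
  rewrite !derive1nS.
  have -> : derive1n n (re_fun f) = re_fun g by apply/funext => y; have [] := gE y.
  have -> : derive1n n (im_fun f) = im_fun g by apply/funext => y; have [] := gE y.
  exact: is_cder_derive.
split.
  move=> n x; have [g [Cg gE]] := H n.
  have -> : derive1n n (re_fun f) = re_fun g by apply/funext => y; have [] := gE y.
  have -> : derive1n n (im_fun f) = im_fun g by apply/funext => y; have [] := gE y.
  have [g' [Cg' dg]] := Cd _ Cg; have [h1 h2] := dg x; split.
  - exact: (@ex_derive _ _ _ _ _ _ _ h1).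
  - exact: (@ex_derive _ _ _ _ _ _ _ h2).
move=> k n; have [g [Cg gE]] := H n; have [M hM] := Cb _ Cg k.
exists M => x; rewrite /cderiven; have [-> ->] := gE x.
by have := hM x; case: (g x).
Qed.

Lemma schwartz_is_cder f n x : schwartz f ->
  is_cder (cderiven n f) x (cderiven n.+1 f x).
Proof.
move=> [sf _]; have [h1 h2] := sf n x.
by split; [have := DeriveDef h1 erefl|have := DeriveDef h2 erefl]; rewrite -derive1E.
Qed.

Lemma cderiven0 f : cderiven 0 f = f.
Proof. by apply/funext => x; rewrite /cderiven /= /re_fun /im_fun; case: (f x). Qed.

Lemma schwartz_decay f n : schwartz f -> exists M : R, 0 <= M /\
  forall x, normc (cderiven n f x) <= M * hw 1 x.
Proof.
move=> [_ hs]; have [M0 h0] := hs 0 n; have [M2 h2] := hs 2 n.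
have b x : normc (cderiven n f x) * (1 + x ^+ 2) <= M0 + M2.
  rewrite mulrDr mulr1; apply: lerD; first by have := h0 x; rewrite expr0 mul1r.
  by have := h2 x; rewrite real_normK ?num_real// mulrC.
exists (M0 + M2); split.
  by apply: le_trans (b 0); rewrite mulr_ge0 ?normc_ge0// addr_ge0// sqr_ge0.
by move=> x; rewrite /hw divr1 ler_pdivlMr// ltr_wpDr// sqr_ge0.
Qed.

Lemma schwartz_ccont f n : schwartz f -> ccont (cderiven n f).
Proof.
by move=> sf; apply: (is_cder_ccont (f' := cderiven n.+1 f)) => x; exact: schwartz_is_cder.
Qed.

Lemma schwartz_cintg f n : schwartz f -> cintg mu (cderiven n f).
Proof.
move=> sf; have [M [M0 hM]] := schwartz_decay n sf.
apply: (@cintg_dom _ _ R mu _ (fun x => M * hw 1 x)) => //.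
- by apply: ccont_meas; exact: schwartz_ccont.
- by apply: rintgZ; exact: rintg_hw.
Qed.

Lemma hw1_cvg0 (u : nat -> R) : (forall n, `|u n| = n%:R) ->
  hw 1 (u n) @[n --> \oo] --> (0 : R).
Proof.
move=> un; have h : 2 * n.+1%:R^-1 @[n --> \oo] --> (0 : R).
  by rewrite -(mulr0 (2 : R)); apply: cvgM; [exact: cvg_cst|exact: cvg_harmonic].
apply: cvg0_le h => n; rewrite hw_ge0//= /hw divr1.
have -> : u n ^+ 2 = n%:R ^+ 2 by rewrite -[LHS]real_normK ?num_real// un.
rewrite -[leRHS]invrK invfM invrK lef_pV2 ?posrE; last 2 first.
- by rewrite ltr_wpDr// sqr_ge0.
- by rewrite mulr_gt0// invr_gt0.
rewrite -(@natr1 _ n); have := sqr_ge0 (n%:R - 1 : R).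
by move: (n%:R) => t; nra.
Qed.

(** The derivative of [cis (x * y) * cderiven n f y] in [y] has integral 0. *)
Lemma schwartz_ifourier_derive f n x : schwartz f ->
  'i * x%:C * ifourier (cderiven n f) x = - ifourier (cderiven n.+1 f) x.
Proof.
move=> sf; set D := cderiven n f; set D' := cderiven n.+1 f.
have iD : cintg mu D by exact: schwartz_cintg.
have iD' : cintg mu D' by exact: schwartz_cintg.
have cD : ccont D by exact: schwartz_ccont.
have cD' : ccont D' by exact: schwartz_ccont.
have e1 := cintg_cisM (measurable_lin x) iD.
have e2 := cintg_cisM (measurable_lin x) iD'.
have [M [M0 hM]] := schwartz_decay n sf.
have lim (u : nat -> R) : (forall n, `|u n| = n%:R) ->
    normc (cis (x * u n) * D (u n)) @[n --> \oo] --> (0 : R).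
  move=> /hw1_cvg0 h.
  have h' : M * hw 1 (u n) @[n --> \oo] --> (0 : R).
    by rewrite -(mulr0 M); apply: cvgM => //; exact: cvg_cst.
  by apply: cvg0_le h' => k; rewrite normc_ge0 andTb normc_cisM hM.
have ccis : ccont (fun y => cis (x * y)).
  by apply: ccont_cis => y; exact: mulrl_continuous.
have := @cint_derive_eq0 R (fun y => cis (x * y) * D y)
  (fun y => 'i * x%:C * (cis (x * y) * D y) + cis (x * y) * D' y) _ _ _ _ _.
rewrite cintD ?cintZ//; last exact: cintgZ.
move=> H; rewrite !ifourierE.
have {}H : 'i * x%:C * cint mu (fun y => cis (x * y) * D y) +
    cint mu (fun y => cis (x * y) * D' y) = 0.
  apply: H.
  - move=> y; apply: is_cder_eq (is_cderM (is_cder_cis x y) (schwartz_is_cder n y sf)) _.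
    by rewrite mulrA.
  - apply: ccontD; last exact: ccontM.
    by apply: ccontM; [exact: ccont_cst|exact: ccontM].
  - by apply: cintgD => //; exact: cintgZ.
  - by apply: lim => k; rewrite normr_nat.
  - by apply: lim => k; rewrite normrN normr_nat.
move/eqP: H; rewrite addr_eq0 => /eqP H.
by rewrite mulrCA H mulrN.
Qed.

Lemma schwartz_ifourier_bound f k : schwartz f -> exists M : R,
  forall x, `|x| ^+ k * normc (ifourier f x) <= M.
Proof.
move=> sf; exists (c0 R * \int[mu]_y normc (cderiven k f y)) => x.
have e n : `|x| ^+ n * normc (ifourier f x) = normc (ifourier (cderiven n f) x).
  elim: n => [|n ih]; first by rewrite expr0 mul1r cderiven0.
  rewrite exprS -mulrA ih; have := schwartz_ifourier_derive n x sf.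
  move: (ifourier _ x) (ifourier _ x) => B A h.
  have ni : normc ('i : R[i]) = 1 by rewrite normcE /= expr0n /= add0r expr1n sqrtr1.
  by rewrite -(normc_opp B) -h normcM [normc ('i * _)]normcM ni mul1r normc_real.
by rewrite e; apply: normc_ifourier; exact: schwartz_cintg.
Qed.

(** Moments of order 0 to 3 give an integrable majorant for the transform and for its product with
    [x]; the latter is needed because the nonlinearity contains a derivative. *)
Lemma schwartz_ifourier_decay f : schwartz f -> exists M : R, 0 <= M /\
  (forall x, normc (ifourier f x) <= M * hw 1 x) /\
  (forall x, `|x| * normc (ifourier f x) <= M * hw 1 x).
Proof.
move=> sf; have [M0 h0] := schwartz_ifourier_bound 0 sf.
have [M1 h1] := schwartz_ifourier_bound 1 sf.
have [M2 h2] := schwartz_ifourier_bound 2 sf.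
have [M3 h3] := schwartz_ifourier_bound 3 sf.
have p0 : 0 <= M0 by apply: le_trans (h0 0); rewrite mulr_ge0 ?normc_ge0 ?exprn_ge0.
have p1 : 0 <= M1 by apply: le_trans (h1 0); rewrite mulr_ge0 ?normc_ge0 ?exprn_ge0.
have p2 : 0 <= M2 by apply: le_trans (h2 0); rewrite mulr_ge0 ?normc_ge0 ?exprn_ge0.
have p3 : 0 <= M3 by apply: le_trans (h3 0); rewrite mulr_ge0 ?normc_ge0 ?exprn_ge0.
exists (M0 + M1 + M2 + M3); split; first by rewrite !addr_ge0.
have den x : 0 < 1 + x ^+ 2 by rewrite ltr_wpDr// sqr_ge0.
split=> x; rewrite /hw divr1 ler_pdivlMr//;
  have := h0 x; have := h1 x; have := h2 x; have := h3 x;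
  rewrite expr0 expr1 mul1r -[x ^+ 2]real_normK ?num_real//;
  move: (normc _) `|x| => a t; rewrite !exprS expr0; lra.
Qed.

Lemma cderiven1_fourier h : cintg mu h -> cintg mu (fun y => y%:C * h y) ->
  cderiven 1 (fourier h) = fourier (fun y => - ('i * (y%:C * h y))).
Proof.
move=> ch ch1; apply/funext => x.
have ci : cintg mu (fun y => 'i * (y%:C * h y)) by exact: cintgZ.
have [d1 d2] := is_cder_ifourier (- x) ch ch1.
have dN : is_derive x 1 (fun y : R => - y) (-1).
  exact: (is_deriveNf (is_derive_id x 1)).
have k1 := is_derive_compf (f := fun y => complex.Re (ifourier h y)) (g := fun y : R => - y) d1 dN.
have k2 := is_derive_compf (f := fun y => complex.Im (ifourier h y)) (g := fun y : R => - y) d2 dN.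
have e1 : is_cder (fourier h) x (- ifourier (fun y => 'i * (y%:C * h y)) (- x)).
  split.
  - under eq_fun do rewrite fourierE.
    by apply: (is_derive_eq k1); rewrite ReN mulrN1.
  - under eq_fun do rewrite fourierE.
    by apply: (is_derive_eq k2); rewrite ImN mulrN1.
rewrite /cderiven /=; have [-> ->] := is_cder_derive e1.
rewrite fourierE !ifourierE -mulrN -cintN; last exact: cintg_cisM (measurable_lin _) ci.
rewrite [LHS](_ : _ = (c0 R)%:C * cint mu (fun x0 => - (cis (- x * x0) * ('i * (x0%:C * h x0))))); last first.
  by case: (_ * _).
by congr (_ * _); apply: eq_cint => t; rewrite mulrN.
Qed.

End SchwartzFunctions.

(** * A class of Schwartz functions *)

Section GaussianClass.
Variable R : realType.
Notation mu := (@lebesgue_measure R).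
Implicit Types (f g h : R -> R[i]) (x y : R) (z : R[i]).

Definition exp_decay h : Prop := cmeas h /\ exists A c : R,
  [/\ 0 <= A, 0 < c & forall x, normc (h x) <= A * expR (- (c * `|x|))].

Lemma exp_decay_cintg h : exp_decay h -> cintg mu h.
Proof. by move=> [mh [A [c [A0 c_0 hA]]]]; exact: cintg_exp c_0 mh hA. Qed.

(** Half of the exponential rate absorbs the factor [x]. *)
Lemma exp_decayX h : exp_decay h -> exp_decay (fun x => x%:C * h x).
Proof.
move=> [mh [A [c [A0 c_0 hA]]]]; split.
  by apply: cmeasM => //; apply: cmeas_real.
have c20 : 0 < c / 2 by rewrite divr_gt0.
exists (2 / c * A), (c / 2); split => //; first by rewrite mulr_ge0 ?divr_ge0// ltW.
move=> x; rewrite normcM normc_real.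
have e1 : `|x| <= 2 / c * expR (c / 2 * `|x|).
  have h1 := expR_ge1Dx (c / 2 * `|x|).
  rewrite -ler_pdivrMl ?divr_gt0// invf_div; lra.
have -> : 2 / c * A * expR (- (c / 2 * `|x|)) =
    (2 / c * expR (c / 2 * `|x|)) * (A * expR (- (c * `|x|))).
  rewrite (_ : - (c * `|x|) = - (c / 2 * `|x|) - (c / 2 * `|x|)); last by field.
  rewrite expRD; have := expRxMexpNx_1 (c / 2 * `|x|).
  by set e := expR (- _); set E := expR _ => hE; rewrite -[LHS]mulr1 -hE; ring.
by apply: ler_pM => //; exact: normc_ge0.
Qed.

Lemma exp_decayZ h z : exp_decay h -> exp_decay (fun x => z * h x).
Proof.
move=> [mh [A [c [A0 c_0 hA]]]]; split.
  by apply: cmeasM => //; exact: cmeas_cst.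
exists (normc z * A), c; split => //; first by rewrite mulr_ge0// normc_ge0.
by move=> x; rewrite normcM -mulrA ler_wpM2l ?normc_ge0.
Qed.

Variable s : R.
Hypothesis s0 : 0 < s.

(* A class of functions with bounded moments, closed under differentiation, which contains
   both the data and the test function. *)
Inductive gclass : (R -> R[i]) -> Prop :=
| GClassFourier k h : exp_decay h ->
    gclass (fun x => (x ^+ k * ge s x)%:C * ifourier h x)
| GClassGauss k : gclass (fun x => (x ^+ k * ge s x)%:C)
| GClassD f g : gclass f -> gclass g -> gclass (fun x => f x + g x)
| GClassZ z f : gclass f -> gclass (fun x => z * f x).

Lemma is_derive_ge x : is_derive x 1 (ge s) (- (s ^+ 2 * x) * ge s x).
Proof.
have d1 : is_derive x 1 (fun x : R => - (s ^+ 2 / 2) * x ^+ 2) (- (s ^+ 2 * x)).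
  by apply: (is_derive_eq (is_deriveZf _ (is_derive_sqr x))); field.
have d2 := is_derive_compf (is_derive_expR _) d1.
have E : ge s = fun x => expR (- (s ^+ 2 / 2) * x ^+ 2).
  by apply/funext => y; rewrite /ge; congr expR; field.
by rewrite E; apply: (is_derive_eq d2) => /=; ring.
Qed.

(** For [k = 0] the coefficient [k%:R] vanishes, so the truncated exponent [k.-1] is harmless. *)
Lemma is_derive_xge k x : is_derive x 1 (fun x => x ^+ k * ge s x)
  (k%:R * (x ^+ k.-1 * ge s x) - s ^+ 2 * (x ^+ k.+1 * ge s x)).
Proof.
have d1 : is_derive x 1 (fun x : R => x ^+ k) (k%:R * x ^+ k.-1).
  elim: k => [|k ih].
    by rewrite mul0r; under eq_fun do rewrite expr0; exact: is_derive_cst.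
  under eq_fun do rewrite exprS.
  apply: (is_derive_eq (is_deriveMf (is_derive_id x 1) ih)).
  rewrite mul1r; case: k {ih} => [|k] /=; first by rewrite mul0r mulr0 expr0 addr0 mulr1.
  by rewrite mulrCA -exprS -[in RHS]natr1 mulrDl mul1r addrC.
apply: (is_derive_eq (is_deriveMf d1 (is_derive_ge x))).
by rewrite [x ^+ k.+1]exprS; ring.
Qed.

Lemma gclass_derive f : gclass f ->
  exists f', gclass f' /\ forall x, is_cder f x (f' x).
Proof.
elim=> {f} [k h dh|k|f g _ [f' [cf' df]] _ [g' [cg' dg]]|z f _ [f' [cf' df]]].
- have dh' := exp_decayX dh.
  have dih : exp_decay (fun y => 'i * (y%:C * h y)) by exact: exp_decayZ.
  exists (fun x => (k%:R%:C * ((x ^+ k.-1 * ge s x)%:C * ifourier h x) +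
      (- (s ^+ 2)%:C) * ((x ^+ k.+1 * ge s x)%:C * ifourier h x)) +
      (x ^+ k * ge s x)%:C * ifourier (fun y => 'i * (y%:C * h y)) x); split.
  + apply: GClassD; last exact: GClassFourier.
    by apply: GClassD; apply: GClassZ; exact: GClassFourier.
  + move=> x; have d2 := is_cder_ifourier x (exp_decay_cintg dh) (exp_decay_cintg dh').
    apply: is_cder_eq (is_cderM (is_cder_real (is_derive_xge k x)) d2) _.
    by congr (_ + _); rewrite rmorphB !rmorphM /=; ring.
- exists (fun x => k%:R%:C * (x ^+ k.-1 * ge s x)%:C +
      (- (s ^+ 2)%:C) * (x ^+ k.+1 * ge s x)%:C); split.
  + by apply: GClassD; apply: GClassZ; exact: GClassGauss.
  + move=> x; apply: is_cder_eq (is_cder_real (is_derive_xge k x)) _.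
    by rewrite rmorphB !rmorphM /=; ring.
- exists (fun x => f' x + g' x); split; first exact: GClassD.
  by move=> x; exact: is_cderD.
- exists (fun x => z * f' x); split; first exact: GClassZ.
  by move=> x; exact: is_cderZ.
Qed.

Lemma xge_bound k : exists M : R, forall x, `|x| ^+ k * ge s x <= M.
Proof.
have si0 : 0 < s^-1 by rewrite invr_gt0.
have [K [K0 hK]] := gk_exp_le si0 (ler0n R k).
exists ((s * c0 R)^-1 * K) => x; rewrite (ge_gk s0).
have h1 : `|x| ^+ k <= expR (k%:R * `|x|).
  by rewrite expRM_natl; apply: lerXn2r; rewrite ?nnegrE ?expR_ge0 ?norm_le_expR.
rewrite mulrCA ler_wpM2l ?invr_ge0 ?mulr_ge0 ?(ltW s0) ?(ltW (c0_gt0 R))//.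
apply: (@le_trans _ _ (expR (k%:R * `|x|) * (K * expR (- (k%:R * `|x|))))).
  by apply: ler_pM => //; exact: gk_ge0.
by rewrite mulrCA -expRD subrr expR0 mulr1.
Qed.

Lemma gclass_bound f : gclass f ->
  forall k, exists M : R, forall x, `|x| ^+ k * normc (f x) <= M.
Proof.
elim=> {f} [j h dh|j|f g _ IHf _ IHg|z f _ IHf] k.
- have [M hM] := xge_bound (k + j).
  have ch := exp_decay_cintg dh.
  exists (M * (c0 R * \int[mu]_y normc (h y))) => x.
  rewrite normcM normc_real normrM normrX (ger0_norm (ge_ge0 s x)) !mulrA -exprD -[leRHS]mulrA.
  apply: ler_pM; [|exact: normc_ge0|exact: hM|exact: normc_ifourier].
  by rewrite mulr_ge0 ?exprn_ge0 ?ge_ge0.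
- have [M hM] := xge_bound (k + j); exists M => x.
  by rewrite normc_real normrM normrX (ger0_norm (ge_ge0 s x)) mulrA -exprD.
- have [M1 h1] := IHf k; have [M2 h2] := IHg k; exists (M1 + M2) => x.
  apply: le_trans (lerD (h1 x) (h2 x)); rewrite -mulrDr.
  by rewrite ler_wpM2l ?exprn_ge0// normcD.
- have [M hM] := IHf k; exists (normc z * M) => x.
  by rewrite normcM mulrCA ler_wpM2l ?normc_ge0.
Qed.

Lemma gclass_schwartz f : gclass f -> schwartz f.
Proof.
move: f; apply: schwartz_class; [exact: gclass_derive|exact: gclass_bound].
Qed.

Lemma schwartz_ge_ifourier h : exp_decay h ->
  schwartz (fun x => (ge s x)%:C * ifourier h x).
Proof.
move=> dh; have := gclass_schwartz (GClassFourier 0 dh).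
by under eq_fun do rewrite expr0 mul1r.
Qed.

Lemma schwartz_xge : schwartz (fun x => (x * ge s x)%:C).
Proof. exact: gclass_schwartz (GClassGauss 1). Qed.

End GaussianClass.

(** * Integrals over time intervals *)

Section Indicator.
Variable R : realType.
Notation mu := (@lebesgue_measure R).
Notation RR := (measurableTypeR R * measurableTypeR R)%type.

(** The indicator of [[0, t]] at [r], identically 0 for [t < 0]. Being jointly measurable in both
    arguments, it allows Fubini for integrals with a variable end point. *)
Definition chi (t r : R) : R := if (0 <= r) && (r <= t) then 1 else 0.

Lemma chi_ge0 t r : 0 <= chi t r.
Proof. by rewrite /chi; case: ifP. Qed.

Lemma chiE t r : chi t r = (fun=> 1 : R) \_ (`[0, t]%classic) r.
Proof.
rewrite /chi patchE; case: ifPn => h.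
- by rewrite mem_set//= in_itv.
- by rewrite memNset//= in_itv; exact/negP.
Qed.

Lemma measurable_chi d (T : measurableType d) (f g : T -> R) :
  measurable_fun setT f -> measurable_fun setT g ->
  measurable_fun setT (fun z => chi (f z) (g z)).
Proof.
move=> mf mg; apply: measurable_fun_ifT => //.
apply: measurable_and.
- exact: measurable_fun_ler.
- exact: measurable_fun_ler.
Qed.

Lemma cintegral_chi (t : R) (f : R -> R[i]) :
  cintegral `[0, t]%classic f = cint mu (fun r => (chi t r)%:C * f r).
Proof.
rewrite /cintegral /cint; congr (_ +i* _).
- rewrite Rintegral_mkcond; apply: eq_Rintegral => r _.
  rewrite ReM /= mul0r subr0 chiE !patchE /re_fun.
  by case: ifP; rewrite ?mul1r ?mul0r.
- rewrite Rintegral_mkcond; apply: eq_Rintegral => r _.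
  rewrite ImM /= mul0r addr0 chiE !patchE /im_fun.
  by case: ifP; rewrite ?mul1r ?mul0r.
Qed.

Lemma rintg_chi t : rintg mu (chi t).
Proof.
have -> : chi t = (fun=> 1 : R) \_ (`[0, t]%classic) by apply/funext => r; exact: chiE.
have h : mu.-integrable `[0, t]%classic (EFin \o (fun=> 1 : R)).
  apply: continuous_compact_integrable; first exact: segment_compact.
  by apply: continuous_subspaceT => x; exact: cvg_cst.
rewrite /rintg -restrict_EFin; apply/integrable_restrict => //=.
by rewrite setTI.
Qed.

Lemma Rintegral_chi t : 0 <= t -> \int[mu]_r chi t r = t.
Proof.
move=> t0; have -> : \int[mu]_r chi t r = \int[mu]_(r in `[0, t]%classic) 1.
  rewrite [RHS]Rintegral_mkcond; apply: eq_Rintegral => r _; exact: chiE.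
rewrite Rintegral_cst// mul1r /= lebesgue_measure_itv /=.
by rewrite lte_fin; case: ltgtP t0 => //= h _; rewrite ?oppr0 ?addr0 ?subr0 -?h.
Qed.

(** The factor [k] stands on the left so that [k = 0], which corresponds to frequency 0, is
    included. The degenerate cases are separated because the primitive divides by [k] and the
    fundamental theorem needs [0 < t]. *)
Lemma Rintegral_chi_expR (t k : R) : 0 <= t -> 0 <= k ->
  k * (\int[mu]_r (chi t r * expR (k * r))) <= expR (k * t).
Proof.
move=> t0 k0; have [->|kn0] := eqVneq k 0; first by rewrite mul0r expR_ge0.
have [->|tn0] := eqVneq t 0.
  rewrite mulr0 expR0 (_ : \int[mu]_r _ = 0) ?mulr0//.
  rewrite -[RHS](Rintegral_set1 (fun=> 1 : R) 0) [RHS]Rintegral_mkcond; apply: eq_Rintegral => r _.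
  rewrite /chi patchE; case: ifPn => [/andP[h1 h2]|h].
  - have -> : r = 0 by apply/eqP; rewrite eq_le h1 h2.
    by rewrite mem_set// mulr0 expR0 mul1r.
  - rewrite mul0r; case: ifPn => //; rewrite inE /= => r0.
    by move: h; rewrite r0 lexx.
have tp : 0 < t by rewrite lt_def tn0.
have kp : 0 < k by rewrite lt_def kn0.
have dF (x : R) : is_derive x 1 (fun x : R => k^-1 * expR (k * x)) (expR (k * x)).
  have d1 : is_derive x 1 (fun x : R => k * x) k.
    by apply: (is_derive_eq (is_deriveZf k (is_derive_id x 1))); rewrite mulr1.
  apply: (is_derive_eq (is_deriveZf k^-1 (is_derive_compf (f := expR) (g := fun x : R => k * x) (is_derive_expR _) d1))).
  by rewrite mulrCA mulVf ?mulr1.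
have cexp : continuous (fun x : R => expR (k * x)).
  move=> x; apply: (@continuous_comp _ _ _ (fun x : R => k * x) expR).
    exact: mulrl_continuous.
  exact: continuous_expR.
have -> : \int[mu]_r (chi t r * expR (k * r)) = \int[mu]_(r in `[0, t]) expR (k * r).
  rewrite [RHS]Rintegral_mkcond; apply: eq_Rintegral => r _; rewrite chiE !patchE.
  by case: ifP; rewrite ?mul1r ?mul0r.
rewrite /Rintegral (@continuous_FTC2 _ (fun x : R => expR (k * x)) (fun x : R => k^-1 * expR (k * x)))//.
- rewrite /= mulr0 expR0 mulr1 mulrBr mulrA mulfV// mul1r; lra.
- exact: continuous_subspaceT.
- split.
  + by move=> x _; exact: (@ex_derive _ _ _ _ _ _ _ (dF x)).
  + by apply: cvg_at_right_filter; exact: (is_derive_continuous dF).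
  + by apply: cvg_at_left_filter; exact: (is_derive_continuous dF).
- by move=> x _; rewrite derive1E; exact: (@derive_val _ _ _ _ _ _ _ (dF x)).
Qed.

End Indicator.

(** * The Duhamel iteration *)

Section DuhamelMap.
Variable R : realType.
Notation mu := (@lebesgue_measure R).
Notation RR := (measurableTypeR R * measurableTypeR R)%type.
Implicit Types (v w : R -> R -> R[i]) (q : R -> R -> R[i]) (t x y r : R).

Variables b N T : R.
Hypotheses (N0 : 0 < N) (T0 : 0 < T).

(* The rate of decay in frequency decreases in time: integrating [exp (- alpha r |x|)] in [r]
   gains a factor [1 / |x|], which absorbs the derivative in the nonlinearity. *)
Definition alpha t : R := (2 - t / T) / N.

(** The exponential rate falls from [2 / N] at time 0 to [1 / N] at time [T], so the rate [1 / N] is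
    available throughout. *)
Definition W t x : R := expR (- (alpha t * `|x|)) * hw N x.

Lemma W_ge0 t x : 0 <= W t x.
Proof. by rewrite mulr_ge0 ?expR_ge0 ?hw_ge0. Qed.

Lemma alpha_ge t : t <= T -> N^-1 <= alpha t.
Proof.
move=> tT; rewrite /alpha ler_pdivlMr// mulVf ?lt0r_neq0//.
have : t / T <= 1 by rewrite ler_pdivrMr// mul1r.
lra.
Qed.

Lemma alpha_ge0 t : t <= T -> 0 <= alpha t.
Proof. by move=> /alpha_ge; apply: le_trans; rewrite invr_ge0 ltW. Qed.

Lemma W_le_exp t x : t <= T -> W t x <= expR (- (N^-1 * `|x|)).
Proof.
move=> tT; rewrite /W; apply: (@le_trans _ _ (expR (- (alpha t * `|x|)))).
  by rewrite ler_piMr ?expR_ge0// hw_le1.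
by rewrite ler_expR lerN2 ler_wpM2r// alpha_ge.
Qed.

(** The weight increases with time; hence a bound on the data passes to their free evolution. *)
Lemma W0_le t x : 0 <= t -> W 0 x <= W t x.
Proof.
move=> t0; rewrite ler_wpM2r ?hw_ge0// ler_expR lerN2 ler_wpM2r//.
rewrite /alpha ler_wpM2r ?invr_ge0 ?(ltW N0)// mul0r.
by have : 0 <= t / T by [rewrite divr_ge0// ltW]; lra.
Qed.

(** The exponentials combine by the triangle inequality and [hw_conv] leaves the integral of
    [hw N y + hw N (x - y)], which is [2 * pi * N]; its factor 2 completes the constant. *)
Lemma conv_bound (f g : R -> R[i]) (a A1 A2 : R) x : 0 <= a -> cmeas f -> cmeas g ->
  (forall y, normc (f y) <= A1 * (expR (- (a * `|y|)) * hw N y)) ->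
  (forall y, normc (g y) <= A2 * (expR (- (a * `|y|)) * hw N y)) ->
  normc (conv f g x) <= A1 * A2 * (4 * pi * N) * (expR (- (a * `|x|)) * hw N x).
Proof.
move=> a0 mf mg fA gA.
have pos (h : R -> R[i]) (A : R) :
    (forall y, normc (h y) <= A * (expR (- (a * `|y|)) * hw N y)) -> 0 <= A.
  move=> hA; have := le_trans (normc_ge0 _) (hA 0).
  by rewrite normr0 mulr0 oppr0 expR0 mul1r pmulr_lge0// hw_gt0.
have A10 := pos _ _ fA; have A20 := pos _ _ gA.
set E := expR (- (a * `|x|)).
have ih : rintg mu (fun y => hw N y + hw N (x - y)).
  by apply: rintgD; [exact: rintg_hw|exact: (rintg_reflection x (rintg_hw N0))].
apply: (@le_trans _ _ (\int[mu]_y (A1 * A2 * E * (2 * hw N x) * (hw N y + hw N (x - y))))).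
  apply: normc_cint_le.
  - apply: cmeasM; first exact: mf.
    apply: (cmeas_comp mg); exact: measurable_funB.
  - exact: rintgZ.
  move=> y; rewrite normcM.
  apply: (@le_trans _ _ ((A1 * (expR (- (a * `|y|)) * hw N y)) *
     (A2 * (expR (- (a * `|x - y|)) * hw N (x - y))))).
    by apply: ler_pM; [exact: normc_ge0|exact: normc_ge0|exact: fA|exact: gA].
  have e1 : expR (- (a * `|y|)) * expR (- (a * `|x - y|)) <= E.
    rewrite -expRD ler_expR -opprD lerN2 -mulrDr ler_wpM2l//.
    have := ler_distD y x 0; rewrite !subr0; lra.
  have e2 := hw_conv N0 x y.
  rewrite [leLHS](_ : _ = A1 * A2 * ((expR (- (a * `|y|)) * expR (- (a * `|x - y|))) *
    (hw N y * hw N (x - y)))); last by ring.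
  rewrite [leRHS](_ : _ = A1 * A2 * (E * (2 * hw N x * (hw N y + hw N (x - y))))); last by ring.
  apply: ler_wpM2l; first exact: mulr_ge0.
  by apply: ler_pM; [rewrite mulr_ge0 ?expR_ge0|rewrite mulr_ge0 ?hw_ge0|exact: e1|exact: e2].
rewrite RintegralZl// RintegralD//; last 2 first.
- exact: rintg_hw.
- exact: (rintg_reflection x (rintg_hw N0)).
rewrite (Rintegral_reflection x (rintg_hw N0)) (Rintegral_hw N0).2.
by rewrite le_eqVlt; apply/orP; left; apply/eqP; ring.
Qed.

(** The factor ['i * (c0 R * x)%:C], due to the derivative and to the normalization of convolutions,
    is kept outside this integral. *)
Definition Duh q t x : R[i] := cint mu (fun r => (chi t r)%:C *
  (kawahara_multiplier b (t - r) x * q r x)).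

Lemma continuous_symbol : continuous (fun x : R => x ^+ 5 + b * x ^+ 3).
Proof.
move=> x; apply: cvgD; first exact: exprn_continuous.
by apply: cvgM; [exact: cvg_cst|exact: exprn_continuous].
Qed.

Lemma measurable_symbol : measurable_fun setT (fun x : R => x ^+ 5 + b * x ^+ 3).
Proof. apply: continuous_measurable_fun; exact: continuous_symbol. Qed.

Lemma cmeas_mult d (S : measurableType d) (f g : S -> R) :
  measurable_fun setT f -> measurable_fun setT g ->
  cmeas (fun z => kawahara_multiplier b (f z) (g z)).
Proof.
move=> mf mg; apply: cmeas_cis; apply: measurable_funM => //.
exact: (measurableT_comp measurable_symbol mg).
Qed.

Lemma normc_mult t x : normc (kawahara_multiplier b t x) = 1.
Proof. exact: normc_cis. Qed.

Lemma ccont_mult t : ccont (kawahara_multiplier b t).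
Proof.
apply: ccont_cis => x; apply: cvgM; first exact: cvg_cst.
exact: continuous_symbol.
Qed.

Lemma cmeas_slice q t : cmeas (fun z : RR => q z.1 z.2) -> cmeas (q t).
Proof.
move=> mq; apply: (@cmeas_comp _ _ (measurableTypeR R) _ R (fun z : RR => q z.1 z.2) (fun x => (t, x)) mq).
exact: pair1_measurable.
Qed.

Lemma cmeas_DuhF q : cmeas (fun z : RR => q z.1 z.2) ->
  cmeas (fun z : RR * measurableTypeR R => (chi z.1.1 z.2)%:C *
    (kawahara_multiplier b (z.1.1 - z.2) z.1.2 * q z.2 z.1.2)).
Proof.
move=> mq.
have m1 : measurable_fun setT (fun z : RR * measurableTypeR R => z.1.1 : R).
  by apply: (measurableT_comp (@measurable_fst _ _ (measurableTypeR R) (measurableTypeR R))); exact: measurable_fst.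
have m2 : measurable_fun setT (fun z : RR * measurableTypeR R => z.1.2 : R).
  by apply: (measurableT_comp (@measurable_snd _ _ (measurableTypeR R) (measurableTypeR R))); exact: measurable_fst.
have m3 : measurable_fun setT (fun z : RR * measurableTypeR R => z.2 : R).
  exact: measurable_snd.
apply: cmeasM; first by apply: cmeas_real; exact: measurable_chi.
apply: cmeasM; first by apply: cmeas_mult => //; exact: measurable_funB.
apply: (cmeas_comp mq (g := fun z : RR * measurableTypeR R => (z.2, z.1.2))).
exact/measurable_fun_pairP.
Qed.

Lemma cmeas_Duh q : cmeas (fun z : RR => q z.1 z.2) ->
  cmeas (fun z : RR => Duh q z.1 z.2).
Proof.
move=> mq; exact: (@cmeas_cint _ _ _ (measurableTypeR R) R mu _ (cmeas_DuhF mq)).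
Qed.

Lemma cmeas_Duh_integrand q t x : cmeas (fun z : RR => q z.1 z.2) ->
  cmeas (fun r : R => (chi t r)%:C * (kawahara_multiplier b (t - r) x * q r x)).
Proof.
move=> mq; apply: (@cmeas_comp _ _ (measurableTypeR R) _ R _ (fun r => ((t, x), r)) (cmeas_DuhF mq)).
exact: pair1_measurable.
Qed.

(** As a function of [r] the weight [W r x] is a constant times [expR (k * r)] with
    [k = |x| / (T N)]. Integration in time gains [1 / k], which pays for the factor [|x|]. *)
Lemma Duh_bound q D t x : 0 <= D -> t <= T -> cmeas (fun z : RR => q z.1 z.2) ->
  (forall r, 0 <= r <= T -> normc (q r x) <= D * W r x) ->
  `|x| * normc (Duh q t x) <= D * (T * N) * W t x.
Proof.
move=> D0 tT mq qD.
have [t0|t0] := ltP t 0.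
  rewrite (_ : Duh q t x = 0) ?Normc.normc0 ?mulr0.
    by rewrite !mulr_ge0 ?(ltW T0) ?(ltW N0) ?expR_ge0 ?hw_ge0.
  rewrite /Duh (_ : (fun r => _) = fun=> 0) ?/cint /= ?Rintegral_cst ?mul0r//.
  apply/funext => r; rewrite /chi; case: ifPn; rewrite ?mul0r// => /andP[h1 h2].
  by have := lt_le_trans t0 (le_trans h1 h2); rewrite ltxx.
pose k := `|x| / (T * N).
have k0 : 0 <= k by rewrite divr_ge0// mulr_ge0 ?(ltW T0) ?(ltW N0).
have WE r : W r x = expR (- (2 / N * `|x|)) * hw N x * expR (k * r).
  rewrite /W [RHS]mulrAC -expRD; congr (expR _ * _); rewrite /alpha /k.
  by field; rewrite !lt0r_neq0.
set P := expR (- (2 / N * `|x|)) * hw N x in WE.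
have P0 : 0 <= P by rewrite mulr_ge0 ?expR_ge0 ?hw_ge0.
have ich : rintg mu (fun r => chi t r * expR (k * r)).
  apply: (@rintg_dom _ _ R mu _ (fun r => expR (k * t) * chi t r)).
  - apply: measurable_funM.
      exact: rintg_meas (rintg_chi t).
    by apply: measurableT_comp => //; exact: measurable_funM.
  - by apply: rintgZ; exact: rintg_chi.
  - move=> r; rewrite normrM !ger0_norm ?chi_ge0 ?expR_ge0//.
    rewrite /chi; case: ifPn => [/andP[r0 rt]|_]; last by rewrite !(mul0r, mulr0).
    by rewrite mul1r mulr1 ler_expR ler_wpM2l.
have h1 : normc (Duh q t x) <= D * P * \int[mu]_r (chi t r * expR (k * r)).
  rewrite -RintegralZl//.
  apply: normc_cint_le.
  - exact: cmeas_Duh_integrand.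
  - exact: rintgZ.
  - move=> r; rewrite normcM normcM normc_mult mul1r normc_real ger0_norm ?chi_ge0//.
    rewrite /chi; case: ifPn => [/andP[r0 rt]|_]; last by rewrite !(mul0r, mulr0).
    rewrite !mul1r; apply: le_trans (qD r _) _; first by rewrite r0 (le_trans rt tT).
    by rewrite WE mulrA.
apply: (@le_trans _ _ (`|x| * (D * P * \int[mu]_r (chi t r * expR (k * r))))).
  by rewrite ler_wpM2l.
have -> : `|x| = T * N * k by rewrite /k; field; rewrite !lt0r_neq0.
have h2 := Rintegral_chi_expR t0 k0.
rewrite WE; set I := Rintegral _ _ _ in h2 *.
rewrite [leLHS](_ : _ = D * (T * N) * (P * (k * I))); last by ring.
by rewrite ler_wpM2l ?mulr_ge0 ?(ltW T0) ?(ltW N0)// ler_wpM2l.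
Qed.

Definition Q v r x : R[i] := conv (v r) (v r) x.

Lemma cmeas_Qgen v w : cmeas (fun z : RR => v z.1 z.2) -> cmeas (fun z : RR => w z.1 z.2) ->
  cmeas (fun z : RR => conv (v z.1) (w z.1) z.2).
Proof.
move=> mv mw.
apply: (@cmeas_cint _ _ _ (measurableTypeR R) R mu
  (fun z : RR * measurableTypeR R => v z.1.1 z.2 * w z.1.1 (z.1.2 - z.2))).
have m1 : measurable_fun setT (fun z : RR * measurableTypeR R => z.1.1 : R).
  by apply: (measurableT_comp (@measurable_fst _ _ (measurableTypeR R) (measurableTypeR R))); exact: measurable_fst.
have m2 : measurable_fun setT (fun z : RR * measurableTypeR R => z.1.2 : R).
  by apply: (measurableT_comp (@measurable_snd _ _ (measurableTypeR R) (measurableTypeR R))); exact: measurable_fst.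
have m3 : measurable_fun setT (fun z : RR * measurableTypeR R => z.2 : R).
  exact: measurable_snd.
apply: cmeasM.
- apply: (cmeas_comp mv (g := fun z : RR * measurableTypeR R => (z.1.1, z.2))).
  exact/measurable_fun_pairP.
- apply: (cmeas_comp mw (g := fun z : RR * measurableTypeR R => (z.1.1, z.1.2 - z.2))).
  apply/measurable_fun_pairP; split => //.
  exact: measurable_funB.
Qed.

End DuhamelMap.

(** * Sequences with geometric increments *)

Section GeometricLimits.
Variable R : realType.

Lemma geometric_cvg (x : nat -> R) (C : R) :
  (forall n, `|x n.+1 - x n| <= C / 2 ^+ n) ->
  cvgn x /\ forall n, `|limn x - x n| <= 2 * C / 2 ^+ n.
Proof.
move=> hx.
have C0 : 0 <= C by apply: le_trans (normr_ge0 _) _; have := hx 0%N; rewrite expr0 divr1; apply.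
(* Subtracting the remaining tail is what lets the induction on [k] close. *)
have hd n k : `|x (n + k)%N - x n| <= 2 * C / 2 ^+ n - 2 * C / 2 ^+ (n + k).
  elim: k => [|k ih]; first by rewrite addn0 !subrr normr0.
  rewrite addnS; have h := hx (n + k)%N.
  apply: le_trans (ler_distD (x (n + k)%N) _ _) _.
  have -> : 2 * C / 2 ^+ (n + k).+1 = 2 * C / 2 ^+ (n + k) - C / 2 ^+ (n + k).
    by rewrite exprS; field; rewrite expf_neq0.
  move: h ih; lra.
have hd' n k : `|x (n + k)%N - x n| <= 2 * C / 2 ^+ n.
  apply: le_trans (hd n k) _; rewrite gerBl divr_ge0 ?exprn_ge0//.
  by rewrite mulr_ge0.
have p0 : 2 * C / 2 ^+ n @[n --> \oo] --> (0 : R).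
  rewrite -(mulr0 (2 * C)); under eq_fun do rewrite -exprVn.
  apply: cvgM; first exact: cvg_cst.
  by apply: cvg_expr; rewrite ger0_norm ?invr_ge0// invf_lt1// ltr1n.
have cx : cvgn x.
  apply/cauchy_cvgP; apply: cauchy_exP => e e0.
  have /cvgrPdist_lt/(_ _ e0)[n _ /(_ n (leqnn n))] := p0.
  rewrite /= sub0r normrN => hn; exists (x n); exists n => // m /= nm.
  rewrite /ball /= distrC -(subnKC nm); apply: le_lt_trans (hd' n _) _.
  exact: le_lt_trans (ler_norm _) hn.
split => // n; apply/ler_addgt0Pr => e e0.
have /cvgrPdist_lt/(_ _ e0)[m _ hm] := cx.
have /= h1 := hm (n + m)%N (leq_addl _ _).
apply: le_trans (ler_distD (x (n + m)%N) _ _) _.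
by rewrite addrC lerD// ltW.
Qed.

End GeometricLimits.

(** * Bilinear and contraction estimates *)

Section PicardIteration.
Variable R : realType.
Notation mu := (@lebesgue_measure R).
Notation RR := (measurableTypeR R * measurableTypeR R)%type.
Implicit Types (v w : R -> R -> R[i]) (q : R -> R -> R[i]) (t x y r : R).

Lemma ccont_unif (f : R -> R[i]) :
  (forall e : R, 0 < e -> exists g, ccont g /\ forall x, normc (f x - g x) <= e) ->
  ccont f.
Proof.
move=> H.
have K (P : R[i] -> R) : (forall z w : R[i], `|P z - P w| <= normc (z - w)) ->
   (forall g, ccont g -> continuous (fun x => P (g x))) ->
   continuous (fun x => P (f x)).
  move=> hP cP x; apply/cvgrPdist_lt => e e0.
  have e3 : 0 < e / 3 by rewrite divr_gt0.
  have [g [cg fg]] := H _ e3.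
  have /cvgrPdist_lt/(_ _ e3) := cP _ cg x.
  apply: filterS => y hy.
  have h1 := le_trans (hP (f x) (g x)) (fg x).
  have h2 := le_trans (hP (f y) (g y)) (fg y).
  apply: le_lt_trans (ler_distD (P (g x)) _ _) _.
  have := ler_distD (P (g y)) (P (g x)) (P (f y)).
  rewrite (distrC (P (g y)) (P (f y))); lra.
split; apply: K.
- by move=> z w; rewrite -ReN -ReD normc_Re.
- by move=> g [].
- by move=> z w; rewrite -ImN -ImD normc_Im.
- by move=> g [].
Qed.

Variables b N T : R.
Hypotheses (N0 : 0 < N) (T0 : 0 < T).

Notation W := (W N T).

(** The ball of radius [B]. The factor [chi T t] makes members vanish at times outside [[0, T]], so
    that statements may range over all real times. Continuity is imposed in frequency only; for
    fixed points continuity in time follows from [v_lip]. *)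
Definition good (B : R) v := [/\ cmeas (fun z : RR => v z.1 z.2),
  (forall t, ccont (v t)) & forall t x, normc (v t x) <= B * (chi T t * W t x)].

(** The Duhamel formula on the Fourier side: ['i * x] is the symbol of the derivative and [c0] the
    constant of [ifourier_conv]. *)
Definition Phi (v0 : R -> R[i]) v t x : R[i] := (chi T t)%:C *
  (kawahara_multiplier b t x * v0 x - 'i * (c0 R * x)%:C * Duh b (Q v) t x).

Lemma chi_in t : 0 <= t <= T -> chi T t = 1.
Proof. by rewrite /chi => ->. Qed.

Lemma chi_cases t : 0 <= t <= T \/ chi T t = 0.
Proof. by rewrite /chi; case: ifP; [left|right]. Qed.

Lemma good_W B v : good B v -> forall r, 0 <= r <= T ->
  forall x, normc (v r x) <= B * (expR (- (alpha N T r * `|x|)) * hw N x).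
Proof. by move=> [_ _ h] r rT x; have := h r x; rewrite chi_in// mul1r. Qed.

Lemma good_B0 B v : good B v -> 0 <= B.
Proof.
move=> [_ _ /(_ 0 0) h]; have := le_trans (normc_ge0 _) h.
have c1 : chi T 0 = 1 by apply: chi_in; rewrite lexx ltW.
rewrite c1 mul1r pmulr_lge0// mulr_gt0 ?expR_gt0//.
exact: hw_gt0.
Qed.

Lemma good_exp B v : good B v -> forall t x,
  normc (v t x) <= B * expR (- (N^-1 * `|x|)).
Proof.
move=> gv t x; have B0 := good_B0 gv; have [_ _ h] := gv.
apply: le_trans (h t x) _; rewrite ler_wpM2l//.
have [tT|->] := chi_cases t; last by rewrite mul0r expR_ge0.
by rewrite chi_in// mul1r W_le_exp//; case/andP: tT.
Qed.

Lemma good_cintg B v t : good B v -> cintg mu (v t).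
Proof.
move=> gv; have [_ cv _] := gv; have Ni : 0 < N^-1 by rewrite invr_gt0.
exact: (cintg_exp Ni (ccont_meas (cv t)) (good_exp gv t)).
Qed.

Lemma good_bnd B v : good B v -> forall t x, normc (v t x) <= B.
Proof.
move=> gv t x; apply: le_trans (good_exp gv t x) _.
rewrite ler_piMr ?(good_B0 gv)// -[leRHS]expR0 ler_expR oppr_le0 mulr_ge0//.
by rewrite invr_ge0 ltW.
Qed.

(** The constant of the bilinear estimate: [c0] from the transform of a product, [4 * pi * N] from
    [conv_bound], [T * N] from [Duh_bound]. *)
Definition kappa : R := c0 R * (4 * pi * N) * (T * N).

Lemma kappa_ge0 : 0 <= kappa.
Proof. by rewrite /kappa !mulr_ge0 ?pi_ge0 ?(ltW N0) ?(ltW T0) ?(ltW (c0_gt0 R)). Qed.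

Lemma good_conv B1 B2 v w r x : good B1 v -> good B2 w -> 0 <= r <= T ->
  normc (conv (v r) (w r) x) <= B1 * B2 * (4 * pi * N) * W r x.
Proof.
move=> gv gw rT; have [_ cv _] := gv; have [_ cw _] := gw.
apply: conv_bound => //.
- by apply: alpha_ge0 => //; case/andP: rT.
- exact: ccont_meas.
- exact: ccont_meas.
- exact: good_W gv _ rT.
- exact: good_W gw _ rT.
Qed.

Lemma good_conv_cst B1 B2 v w r x : good B1 v -> good B2 w -> 0 <= r <= T ->
  normc (conv (v r) (w r) x) <= B1 * B2 * (4 * pi * N).
Proof.
move=> gv gw rT; apply: le_trans (good_conv x gv gw rT) _.
rewrite ler_piMr ?mulr_ge0 ?(good_B0 gv) ?(good_B0 gw) ?pi_ge0 ?(ltW N0)//.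
have rT' : r <= T by case/andP: rT.
apply: le_trans (W_le_exp N0 T0 x rT') _.
by rewrite -[leRHS]expR0 ler_expR oppr_le0 mulr_ge0// invr_ge0 ltW.
Qed.

Lemma good_Duh_intg B1 B2 v w t x : good B1 v -> good B2 w -> t <= T ->
  cintg mu (fun r => (chi t r)%:C * (kawahara_multiplier b (t - r) x * conv (v r) (w r) x)).
Proof.
move=> gv gw tT; have [mv _ _] := gv; have [mw _ _] := gw.
apply: (@cintg_dom _ _ R mu _ (fun r => B1 * B2 * (4 * pi * N) * chi t r)).
- exact: (cmeas_Duh_integrand b t x (q := fun r => conv (v r) (w r)) (cmeas_Qgen mv mw)).
- by apply: rintgZ; exact: rintg_chi.
- move=> r; rewrite normcM normcM normc_mult mul1r normc_real ger0_norm ?chi_ge0//.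
  rewrite /chi; case: ifPn => [/andP[r0 rt]|_]; last by rewrite !(mul0r, mulr0).
  by rewrite mul1r mulr1; apply: good_conv_cst => //; rewrite r0 (le_trans rt tT).
Qed.

Lemma good_Duh_bound B1 B2 v w t x : good B1 v -> good B2 w -> t <= T ->
  normc ('i * (c0 R * x)%:C * Duh b (fun r => conv (v r) (w r)) t x) <=
  kappa * (B1 * B2) * W t x.
Proof.
move=> gv gw tT; have [mv _ _] := gv; have [mw _ _] := gw.
have D0 : 0 <= B1 * B2 * (4 * pi * N).
  by rewrite !mulr_ge0 ?(good_B0 gv) ?(good_B0 gw) ?pi_ge0 ?(ltW N0).
have := Duh_bound b N0 T0 (q := fun r => conv (v r) (w r)) (x := x) D0 tT (cmeas_Qgen mv mw)
  (fun r rT => good_conv x gv gw rT).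
move: (Duh _ _ _ _) => D h.
have ni : normc ('i : R[i]) = 1 by rewrite normcE /= expr0n /= add0r expr1n sqrtr1.
rewrite normcM [normc ('i * _)]normcM ni mul1r normc_real normrM (ger0_norm (ltW (c0_gt0 R))).
rewrite -[leLHS]mulrA; apply: le_trans (ler_wpM2l (ltW (c0_gt0 R)) h) _.
by rewrite le_eqVlt; apply/orP; left; apply/eqP; rewrite /kappa; ring.
Qed.

Lemma ccont_Duh B1 B2 v w t : good B1 v -> good B2 w -> t <= T ->
  ccont (Duh b (fun r => conv (v r) (w r)) t).
Proof.
move=> gv gw tT; have [mv cv _] := gv; have [mw cw _] := gw.
apply: (@ccont_cint _ _ R mu (fun x r => (chi t r)%:C *
    (kawahara_multiplier b (t - r) x * conv (v r) (w r) x))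
  (fun r => B1 * B2 * (4 * pi * N) * chi t r)).
- by move=> x; exact: (cmeas_Duh_integrand b t x (q := fun r => conv (v r) (w r)) (cmeas_Qgen mv mw)).
- by apply: rintgZ; exact: rintg_chi.
- move=> x r; rewrite normcM normcM normc_mult mul1r normc_real ger0_norm ?chi_ge0//.
  rewrite /chi; case: ifPn => [/andP[r0 rt]|_]; last by rewrite !(mul0r, mulr0).
  by rewrite mul1r mulr1; apply: good_conv_cst => //; rewrite r0 (le_trans rt tT).
- move=> r; apply: ccontM; first exact: ccont_cst.
  apply: ccontM; first exact: ccont_mult.
  exact: (ccont_conv (good_cintg r gv) (cw r) (good_bnd gw r)).
Qed.

(** The distance to the free evolution. It yields the stability of the ball, and later the error
    made when the second iterate is computed from the free evolution. *)
Lemma Phi_free_bound B (v0 : R -> R[i]) v t x : good B v ->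
  normc (Phi v0 v t x - (chi T t)%:C * (kawahara_multiplier b t x * v0 x)) <=
  kappa * (B * B) * (chi T t * W t x).
Proof.
move=> gv; rewrite /Phi -mulrBr addrAC subrr add0r normcM normc_real normc_opp.
rewrite (ger0_norm (chi_ge0 _ _)).
have [tT|->] := chi_cases t; last by rewrite !(mul0r, mulr0).
rewrite chi_in// !mul1r; apply: good_Duh_bound => //.
by case/andP: tT.
Qed.

Lemma Phi_good B0 B (v0 : R -> R[i]) v : ccont v0 -> (forall x, normc (v0 x) <= B0 * W 0 x) ->
  good B v -> B0 + kappa * (B * B) <= B -> good B (Phi v0 v).
Proof.
move=> cv0 hv0 gv hB; have [mv cv _] := gv.
have B00 : 0 <= B0.
  have := le_trans (normc_ge0 _) (hv0 0).
  by rewrite pmulr_lge0// mulr_gt0 ?expR_gt0// hw_gt0.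
have m1 : measurable_fun setT (fun z : RR => z.1 : R) by exact: measurable_fst.
have m2 : measurable_fun setT (fun z : RR => z.2 : R) by exact: measurable_snd.
split.
- apply: cmeasM.
    by apply: cmeas_real; apply: measurable_chi => //; exact: measurable_cst.
  apply: cmeasB.
    by apply: cmeasM; [exact: cmeas_mult|exact: cmeas_sndR (ccont_meas cv0)].
  apply: cmeasM; last exact: (cmeas_Duh b (q := fun r => conv (v r) (v r)) (cmeas_Qgen mv mv)).
  apply: cmeasM; first exact: cmeas_cst.
  by apply: cmeas_real; exact: measurable_funM.
- move=> t; have [tT|h] := chi_cases t; last first.
    rewrite (_ : Phi v0 v t = fun=> 0); first exact: ccont_cst.
    by apply/funext => x; rewrite /Phi h mul0r.
  apply: ccontM; first exact: ccont_cst.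
  apply: ccontB; first by apply: ccontM => //; exact: ccont_mult.
  apply: ccontM; last by apply: (ccont_Duh gv gv); case/andP: tT.
  apply: ccontM; first exact: ccont_cst.
  by apply: ccont_real => x; exact: mulrl_continuous.
- move=> t x.
  have h1 := Phi_free_bound v0 t x gv.
  have h2 : normc ((chi T t)%:C * (kawahara_multiplier b t x * v0 x)) <= B0 * (chi T t * W t x).
    rewrite normcM normcM normc_mult mul1r normc_real (ger0_norm (chi_ge0 _ _)).
    rewrite mulrCA; have [tT|->] := chi_cases t; last by rewrite !mul0r.
    rewrite chi_in// !mul1r; apply: le_trans (hv0 x) _.
    by rewrite ler_wpM2l//; apply: W0_le => //; case/andP: tT.
  apply: le_trans (le_normcB _ ((chi T t)%:C * (kawahara_multiplier b t x * v0 x))) _.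
  apply: le_trans (lerD h2 h1) _; rewrite -mulrDl ler_wpM2r//.
  by rewrite mulr_ge0 ?chi_ge0 ?W_ge0.
Qed.

Lemma conv_sub B v w r x : good B v -> good B w ->
  conv (v r) (v r) x - conv (w r) (w r) x =
  conv (fun y => v r y - w r y) (v r) x + conv (w r) (fun y => v r y - w r y) x.
Proof.
move=> gv gw.
have [_ cv _] := gv; have [_ cw _] := gw.
have I (f g : R -> R -> R[i]) (gf : good B f) (gg : good B g) :
    cintg mu (fun y => f r y * g r (x - y)).
  under eq_fun do rewrite mulrC.
  apply: (@cintgM_bnd _ _ R mu _ _ B); last exact: good_cintg gf.
  - have [_ cg _] := gg; apply: ccont_meas; apply: (ccont_comp (cg r)) => y.
    by apply: cvgB; [exact: cvg_cst|exact: cvg_id].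
  - by move=> y; exact: good_bnd gg _ _.
rewrite /conv.
have e1 : cint mu (fun y => (v r y - w r y) * v r (x - y)) =
    cint mu (fun y => v r y * v r (x - y)) - cint mu (fun y => w r y * v r (x - y)).
  rewrite -cintB; [|exact: I|exact: I].
  by apply: eq_cint => y; rewrite mulrBl.
have e2 : cint mu (fun y => w r y * (v r (x - y) - w r (x - y))) =
    cint mu (fun y => w r y * v r (x - y)) - cint mu (fun y => w r y * w r (x - y)).
  rewrite -cintB; [|exact: I|exact: I].
  by apply: eq_cint => y; rewrite mulrBr.
by rewrite e1 e2 addrA subrK.
Qed.

Lemma good_sub B d v w : good B v -> good B w ->
  (forall t x, normc (v t x - w t x) <= d * (chi T t * W t x)) ->
  good d (fun t x => v t x - w t x).
Proof.
move=> [mv cv _] [mw cw _] h; split => //; first exact: cmeasB.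
by move=> t; exact: ccontB.
Qed.

Lemma Phi_diff B d (v0 : R -> R[i]) v w : good B v -> good B w ->
  (forall t x, normc (v t x - w t x) <= d * (chi T t * W t x)) ->
  forall t x, normc (Phi v0 v t x - Phi v0 w t x) <=
    2 * kappa * B * d * (chi T t * W t x).
Proof.
move=> gv gw hd t x; have gd := good_sub gv gw hd.
have [tT|h] := chi_cases t; last first.
  have z u : Phi v0 u t x = 0 by rewrite /Phi h mul0r.
  by rewrite (z v) (z w) h subr0 Normc.normc0 mul0r mulr0.
have tT' : t <= T by case/andP: tT.
pose dv (t x : R) := v t x - w t x.
have gd' : good d dv by [].
have e : Duh b (Q v) t x - Duh b (Q w) t x =
    Duh b (fun r => conv (dv r) (v r)) t x + Duh b (fun r => conv (w r) (dv r)) t x.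
  have i1 := good_Duh_intg x gv gv tT'; have i2 := good_Duh_intg x gw gw tT'.
  have i3 := good_Duh_intg x gd' gv tT'; have i4 := good_Duh_intg x gw gd' tT'.
  transitivity (cint mu (fun r => (chi t r)%:C * (kawahara_multiplier b (t - r) x * conv (v r) (v r) x) -
      (chi t r)%:C * (kawahara_multiplier b (t - r) x * conv (w r) (w r) x))).
    exact: (esym (cintB i1 i2)).
  transitivity (cint mu (fun r => (chi t r)%:C * (kawahara_multiplier b (t - r) x * conv (dv r) (v r) x) +
      (chi t r)%:C * (kawahara_multiplier b (t - r) x * conv (w r) (dv r) x))); last first.
    exact: (cintD i3 i4).
  apply: eq_cint => r.
  by rewrite -mulrBr -mulrDr -mulrBr -mulrDr (conv_sub _ _ gv gw).
have E u : Phi v0 u t x = kawahara_multiplier b t x * v0 x -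
    'i * (c0 R * x)%:C * Duh b (Q u) t x by rewrite /Phi chi_in// mul1r.
have b1 := good_Duh_bound x gd' gv tT'; have b2 := good_Duh_bound x gw gd' tT'.
rewrite (E v) (E w) chi_in// mul1r.
move: (Duh b (Q v) t x) (Duh b (Q w) t x) (Duh _ _ t x) (Duh _ _ t x) e b1 b2.
move: ('i * _) (kawahara_multiplier b t x * v0 x) => K m D4 D3 D2 D1 e b1 b2.
rewrite (_ : m - K * D1 - (m - K * D2) = - (K * (D1 - D2))); last by ring.
rewrite normc_opp e mulrDr; apply: le_trans (normcD _ _) _.
apply: le_trans (lerD b1 b2) _.
by rewrite le_eqVlt; apply/orP; left; apply/eqP; ring.
Qed.

End PicardIteration.

(** * The fixed point *)

Section PicardFixpoint.
Variable R : realType.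
Notation mu := (@lebesgue_measure R).
Notation RR := (measurableTypeR R * measurableTypeR R)%type.

Lemma le_geometric (a c d : R) : (forall n, a <= c + d / 2 ^+ n) -> a <= c.
Proof.
move=> h; apply/ler_addgt0Pr => e e0.
have p0 : d / 2 ^+ n @[n --> \oo] --> (0 : R).
  rewrite -(mulr0 d); under eq_fun do rewrite -exprVn.
  apply: cvgM; first exact: cvg_cst.
  by apply: cvg_expr; rewrite ger0_norm ?invr_ge0// invf_lt1// ltr1n.
have /cvgrPdist_lt/(_ _ e0)[n _ /(_ n (leqnn n))] := p0.
rewrite /= sub0r normrN => hn; apply: le_trans (h n) _; rewrite lerD2l.
by apply: le_trans (ler_norm _) _; exact: ltW.
Qed.

Variables b N T : R.
Hypotheses (N0 : 0 < N) (T0 : 0 < T).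
Variables (v0 : R -> R[i]) (B0 : R).
Hypotheses (cv0 : ccont v0) (hv0 : forall x, normc (v0 x) <= B0 * W N T 0 x).
Hypothesis small : 8 * kappa N T * B0 <= 1.

Let B00 : 0 <= B0.
Proof.
have := le_trans (normc_ge0 _) (hv0 0).
by rewrite pmulr_lge0// mulr_gt0 ?expR_gt0// hw_gt0.
Qed.

Let cw t x := chi T t * W N T t x.

Let cw_ge0 t x : 0 <= cw t x.
Proof. by rewrite mulr_ge0 ?chi_ge0 ?W_ge0. Qed.

Let cw_le1 t x : cw t x <= 1.
Proof.
rewrite /cw; have [tT|->] := chi_cases T t; last by rewrite mul0r ler01.
rewrite chi_in// mul1r; have tT' : t <= T by case/andP: tT.
apply: le_trans (W_le_exp N0 T0 x tT') _.
by rewrite -[leRHS]expR0 ler_expR oppr_le0 mulr_ge0// invr_ge0 ltW.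
Qed.

Fixpoint picard (n : nat) : R -> R -> R[i] :=
  if n is n.+1 then Phi b T v0 (picard n) else fun _ _ => 0.

(** On the ball of radius [2 * B0] the Lipschitz constant is [4 * kappa * B0], which [small] bounds
    by 1/2; stability of the ball asks that the same quantity be at most 1. *)
Lemma picard_good n : good N T (2 * B0) (picard n).
Proof.
elim: n => [|n ih] /=.
  split; first exact: cmeas_cst.
  - by move=> t; exact: ccont_cst.
  - move=> t x; rewrite Normc.normc0.
    by rewrite !mulr_ge0// ?chi_ge0 ?expR_ge0 ?hw_ge0.
apply: (Phi_good b N0 T0 cv0 hv0 ih).
have k0 := kappa_ge0 N0 T0.
have : kappa N T * (2 * B0 * (2 * B0)) = (8 * kappa N T * B0) * (B0 / 2) by field.
move=> ->; have : (8 * kappa N T * B0) * (B0 / 2) <= 1 * (B0 / 2).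
  by rewrite ler_wpM2r// divr_ge0.
move: (_ * (B0 / 2)) => z; have := B00; lra.
Qed.

Lemma picard_step n t x :
  normc (picard n.+1 t x - picard n t x) <= 2 * B0 / 2 ^+ n * cw t x.
Proof.
elim: n t x => [|n ih] t x.
  have [_ _ h] := picard_good 1; rewrite expr0 divr1 [picard 0 _ _]/= subr0.
  exact: h.
have := Phi_diff b N0 T0 v0 (picard_good n.+1) (picard_good n) ih t x.
rewrite -[Phi _ _ _ (picard n.+1) _ _]/(picard n.+2 t x).
rewrite -[Phi _ _ _ (picard n) _ _]/(picard n.+1 t x) -/(cw t x) => h.
apply: le_trans h _; rewrite ler_wpM2r//.
have -> : 2 * kappa N T * (2 * B0) * (2 * B0 / 2 ^+ n) =
    (8 * kappa N T * B0) * (2 * B0 / 2 ^+ n.+1).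
  by rewrite exprS; field; rewrite expf_neq0.
by rewrite -[leRHS]mul1r ler_wpM2r// divr_ge0 ?mulr_ge0 ?exprn_ge0.
Qed.

Definition picard_lim (t x : R) : R[i] :=
  limn (fun n => complex.Re (picard n t x)) +i* limn (fun n => complex.Im (picard n t x)).

Let cvgRe t x : cvgn (fun n => complex.Re (picard n t x)) /\
  forall n, `|limn (fun n => complex.Re (picard n t x)) - complex.Re (picard n t x)| <=
    2 * (2 * B0 * cw t x) / 2 ^+ n.
Proof.
apply: geometric_cvg => n; rewrite -ReN -ReD.
apply: le_trans (normc_Re _) _; apply: le_trans (picard_step n t x) _.
by rewrite mulrAC.
Qed.

Let cvgIm t x : cvgn (fun n => complex.Im (picard n t x)) /\
  forall n, `|limn (fun n => complex.Im (picard n t x)) - complex.Im (picard n t x)| <=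
    2 * (2 * B0 * cw t x) / 2 ^+ n.
Proof.
apply: geometric_cvg => n; rewrite -ImN -ImD.
apply: le_trans (normc_Im _) _; apply: le_trans (picard_step n t x) _.
by rewrite mulrAC.
Qed.

(** The limits of real and imaginary parts are pointwise, but this rate is uniform since the weight
    is at most 1; it transfers continuity in [x] to the limit. *)
Lemma picard_lim_rate n t x :
  normc (picard_lim t x - picard n t x) <= 8 * B0 / 2 ^+ n * cw t x.
Proof.
have [_ /(_ n) h1] := cvgRe t x; have [_ /(_ n) h2] := cvgIm t x.
apply: le_trans (normc_ReIm _) _; rewrite ReD ImD ReN ImN /picard_lim /=.
apply: le_trans (lerD h1 h2) _.
rewrite le_eqVlt; apply/orP; left; apply/eqP.
by field; rewrite expf_neq0.
Qed.

Lemma picard_lim_good : good N T (2 * B0) picard_lim.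
Proof.
split.
- split.
  + apply: (@measurable_fun_cvg _ _ _ setT (fun n (z : RR) => complex.Re (picard n z.1 z.2))) => //.
    * by move=> n; have [[]] := picard_good n.
    * by move=> z _; have [] := cvgRe z.1 z.2.
  + apply: (@measurable_fun_cvg _ _ _ setT (fun n (z : RR) => complex.Im (picard n z.1 z.2))) => //.
    * by move=> n; have [[]] := picard_good n.
    * by move=> z _; have [] := cvgIm z.1 z.2.
- move=> t; apply: ccont_unif => e e0.
  have p0 : 8 * B0 / 2 ^+ n @[n --> \oo] --> (0 : R).
    rewrite -(mulr0 (8 * B0)); under eq_fun do rewrite -exprVn.
    apply: cvgM; first exact: cvg_cst.
    by apply: cvg_expr; rewrite ger0_norm ?invr_ge0// invf_lt1// ltr1n.
  have /cvgrPdist_lt/(_ _ e0)[n _ /(_ n (leqnn n))] := p0.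
  rewrite /= sub0r normrN => hn; exists (picard n t); split.
    by have [_ + _] := picard_good n; apply.
  move=> x; apply: le_trans (picard_lim_rate n t x) _.
  apply: (@le_trans _ _ (8 * B0 / 2 ^+ n)).
    by rewrite ler_piMr// divr_ge0 ?exprn_ge0// mulr_ge0.
  by apply: le_trans (ler_norm _) _; exact: ltW.
- move=> t x; apply: (@le_geometric _ _ (8 * B0 * cw t x)) => n.
  have [_ _ /(_ t x) h] := picard_good n.
  apply: le_trans (le_normcB _ (picard n t x)) _.
  apply: lerD; first exact: h.
  by apply: le_trans (picard_lim_rate n t x) _; rewrite mulrAC.
Qed.

(** Compare both sides with [picard n.+1]: each distance is at most [4 * B0 / 2 ^+ n] times the
    weight, the second one by contraction. *)
Lemma picard_lim_fixpoint t x : picard_lim t x = Phi b T v0 picard_lim t x.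
Proof.
have rate n t' x' : normc (picard n t' x' - picard_lim t' x') <= 8 * B0 / 2 ^+ n * (chi T t' * W N T t' x').
  by rewrite normc_dist; exact: picard_lim_rate.
have h n : normc (picard_lim t x - Phi b T v0 picard_lim t x) <= 0 + (8 * B0 * cw t x) / 2 ^+ n.
  have h1 := picard_lim_rate n.+1 t x.
  have h2 := Phi_diff b N0 T0 v0 (picard_good n) picard_lim_good (rate n) t x.
  rewrite -[Phi _ _ _ (picard n) _ _]/(picard n.+1 t x) -/(cw t x) in h2.
  move: (picard n.+1 t x) (Phi _ _ _ _ _ _) (picard_lim t x) h1 h2 => p q r h1 h2.
  rewrite (_ : r - q = (r - p) + (p - q)); last by rewrite addrA subrK.
  apply: le_trans (normcD _ _) _; apply: le_trans (lerD h1 h2) _.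
  have -> : 2 * kappa N T * (2 * B0) * (8 * B0 / 2 ^+ n) * cw t x =
      (8 * kappa N T * B0) * (4 * B0 / 2 ^+ n * cw t x).
    by field; rewrite expf_neq0.
  have h3 : (8 * kappa N T * B0) * (4 * B0 / 2 ^+ n * cw t x) <= 1 * (4 * B0 / 2 ^+ n * cw t x).
    by rewrite ler_wpM2r// mulr_ge0// divr_ge0 ?exprn_ge0// mulr_ge0.
  apply: le_trans (lerD (lexx _) h3) _.
  rewrite le_eqVlt; apply/orP; left; apply/eqP; rewrite exprS.
  by field; rewrite expf_neq0.
have h0 := le_geometric h.
apply/eqP; rewrite -subr_eq0; apply/eqP; apply: Normc.eq0_normc.
by apply/eqP; rewrite eq_le h0 normc_ge0.
Qed.

End PicardFixpoint.

(** * From fixed points to solutions *)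

Section L2Norm.
Variable R : realType.
Notation mu := (@lebesgue_measure R).
Implicit Types (f g : R -> R[i]).

Lemma L2normE f : L2norm f = ((\int[mu]_x (normc (f x) ^+ 2)%:E) `^ 2^-1)%E.
Proof.
rewrite /L2norm unlock; congr (_ `^ _)%E; apply: eq_integral => x _.
rewrite gee0_abs ?lee_fin ?normc_ge0// poweR_EFin; congr EFin.
by rewrite -powR_mulrn// normc_ge0.
Qed.

Lemma sqr_powR2V (C : R) : 0 <= C -> (C ^+ 2) `^ 2^-1 = C.
Proof.
by move=> C0; rewrite -powR_mulrn// -powRrM mulfV// powRr1.
Qed.

Lemma L2norm_le f (C : R) : 0 <= C ->
  (\int[mu]_x (normc (f x) ^+ 2)%:E <= (C ^+ 2)%:E)%E -> (L2norm f <= C%:E)%E.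
Proof.
move=> C0 h; rewrite L2normE -[leRHS](_ : ((C ^+ 2)%:E `^ 2^-1)%E = _); last first.
  by rewrite poweR_EFin sqr_powR2V.
apply: gt0_ler_poweR => //.
- by rewrite in_itv /= leey andbT integral_ge0// => x _; rewrite lee_fin sqr_ge0.
- by rewrite in_itv /= leey andbT lee_fin sqr_ge0.
Qed.

Lemma L2norm_ge0 f : (0 <= L2norm f)%E.
Proof. by rewrite L2normE poweR_ge0. Qed.

Lemma L2norm_dom f (G : R -> R) (C : R) : 0 <= C -> cmeas f -> rintg mu G ->
  (forall x, normc (f x) ^+ 2 <= G x) -> \int[mu]_x G x <= C ^+ 2 ->
  (L2norm f <= C%:E)%E.
Proof.
move=> C0 mf iG fG GC; apply: L2norm_le => //.
apply: (@le_trans _ _ (\int[mu]_x (G x)%:E)%E); last first.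
  by rewrite -Rintegral_EFin// lee_fin.
apply: ge0_le_integral => //.
- by move=> x _; rewrite lee_fin sqr_ge0.
- by apply/measurable_EFinP; apply: measurable_funX; exact: measurable_normc.
- by apply/measurable_EFinP; exact: rintg_meas iG.
- by move=> x _; rewrite lee_fin.
Qed.

End L2Norm.

Section MildSolution.
Variable R : realType.
Notation mu := (@lebesgue_measure R).
Notation RR := (measurableTypeR R * measurableTypeR R)%type.
Implicit Types (f g h : R -> R[i]).

Lemma ifourier_swap f g : cintg mu f -> cintg mu g ->
  cint mu (fun x => ifourier f x * g x) = cint mu (fun y => f y * ifourier g y).
Proof.
move=> cf cg.
have mf := cintg_meas cf; have mg := cintg_meas cg.
pose F (z : RR) : R[i] := (c0 R)%:C * (cis (z.1 * z.2) * (g z.1 * f z.2)).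
transitivity (cint mu (fun x => cint mu (fun y => F (x, y)))).
  apply: eq_cint => x.
  rewrite ifourierE -mulrA -(cintZr _ (cintg_cisM (measurable_lin x) cf)).
  rewrite -cintZ; last first.
    under eq_fun do rewrite mulrC.
    by apply: cintgZ; exact: cintg_cisM (measurable_lin x) cf.
  by apply: eq_cint => y; rewrite /F /=; ring.
rewrite (@cint_fubini _ _ _ _ R mu mu (fun x => c0 R * normc (g x)) (fun y => normc (f y))).
- apply: eq_cint => y.
  rewrite ifourierE mulrCA -cintZ; last exact: cintg_cisM (measurable_lin y) cg.
  rewrite -cintZ; last by apply: cintgZ; exact: cintg_cisM (measurable_lin y) cg.
  by apply: eq_cint => x; rewrite /F /= (mulrC x); ring.
- by apply: rintgZ; exact: cintg_normc.
- exact: cintg_normc.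
- apply: cmeasM; first exact: cmeas_cst.
  apply: cmeasM.
    by apply: cmeas_cis; apply: measurable_funM; [exact: measurable_fst|exact: measurable_snd].
  by apply: cmeasM; [exact: cmeas_fstR|exact: cmeas_sndR].
- move=> x y; rewrite /F /= normcM normcM normcM normc_cis mul1r normc_real.
  by rewrite (ger0_norm (ltW (c0_gt0 R))) mulrA.
Qed.

Variables b N T B : R.
Hypotheses (N0 : 0 < N) (T0 : 0 < T).
Variables (v0 : R -> R[i]) (v : R -> R -> R[i]).
Hypothesis gv : good N T B v.
Hypothesis fixv : forall t x, v t x = Phi b T v0 v t x.
Hypothesis cv0 : ccont v0.
Hypothesis iv0 : cintg mu v0.
Variable M0 : R.
Hypothesis bv0 : forall x, normc (v0 x) <= M0.
Hypothesis iu0 : cintg mu (ifourier v0).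

Lemma good_joint : cmeas (fun z : RR => v z.1 z.2).
Proof. by have [] := gv. Qed.

Lemma good_ccont t : ccont (v t).
Proof. by have [_ + _] := gv; apply. Qed.

Lemma fixv_in t x : 0 <= t <= T -> v t x = kawahara_multiplier b t x * v0 x -
  'i * (c0 R * x)%:C * Duh b (Q v) t x.
Proof. by move=> tT; rewrite fixv /Phi chi_in// mul1r. Qed.

Lemma mult0 x : kawahara_multiplier b 0 x = 1 :> R[i].
Proof. by rewrite /kawahara_multiplier mul0r cis0. Qed.

Lemma v_init : v 0 = v0.
Proof.
apply/funext => x; rewrite fixv_in ?lexx ?ltW// mult0 mul1r.
have h : normc (Duh b (Q v) 0 x) <= 0.
  have i1 : rintg mu (fun r => B * B * (4 * pi * N) * chi 0 r).
    by apply: rintgZ; exact: rintg_chi.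
  apply: (@le_trans _ _ (\int[mu]_r (B * B * (4 * pi * N) * chi 0 r))); last first.
    by rewrite RintegralZl ?Rintegral_chi ?mulr0//; exact: rintg_chi.
  apply: normc_cint_le => //.
    exact: (cmeas_Duh_integrand b 0 x (q := Q v) (cmeas_Qgen good_joint good_joint)).
  move=> r; rewrite normcM normcM normc_mult mul1r normc_real ger0_norm ?chi_ge0//.
  rewrite /chi; case: ifPn => [/andP[r0 rt]|_]; last by rewrite !(mul0r, mulr0).
  rewrite mul1r mulr1; apply: (good_conv_cst N0 T0 x gv gv).
  by rewrite r0 (le_trans rt) ?ltW.
have -> : Duh b (Q v) 0 x = 0.
  by apply: Normc.eq0_normc; apply/eqP; rewrite eq_le h normc_ge0.
by rewrite mulr0 subr0.
Qed.

Definition sol t : R -> R[i] := ifourier (v t).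

Lemma good_sqr t : rintg mu (fun x => normc (v t x) ^+ 2).
Proof.
have B0 := good_B0 T0 gv.
apply: (@rintg_dom _ _ R mu _ (fun x => B * normc (v t x))).
- by apply: measurable_funX; apply: measurable_normc; apply: ccont_meas; exact: good_ccont.
- by apply: rintgZ; apply: cintg_normc; exact: good_cintg gv.
- move=> x; rewrite ger0_norm ?sqr_ge0// expr2 ler_wpM2r ?normc_ge0//.
  exact: good_bnd gv _ _.
Qed.

Lemma sol_sqr t : rintg mu (fun x => normc (sol t x) ^+ 2).
Proof.
have cvt := good_cintg N0 T0 t gv.
have P := Plancherel cvt (good_ccont t) (good_bnd N0 T0 gv t).
apply/integrableP; split.
  apply/measurable_EFinP; apply: measurable_funX; apply: measurable_normc.
  by apply: ccont_meas; exact: ccont_ifourier.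
under eq_integral => x _ do rewrite gee0_abs ?lee_fin ?sqr_ge0//.
rewrite P -Rintegral_EFin ?ltry//; exact: good_sqr.
Qed.

Lemma sol_inL2 t : inL2 (sol t).
Proof.
have cvt := good_cintg N0 T0 t gv.
split; first exact: ccont_meas (ccont_ifourier cvt).
rewrite L2normE -(Rintegral_EFin (sol_sqr t)) poweR_EFin ltry//.
Qed.

(* The nonlinear term: Parseval turns the pairing of [u^2] with a Fourier transform
   into the pairing of the convolution [v * v]. *)
Lemma sqr_pairing r k : 0 <= r <= T -> cintg mu k ->
  cint mu (fun x => sol r x ^+ 2 * fourier k x) =
  cint mu (fun y => (c0 R)%:C * conv (v r) (v r) y * k y).
Proof.
move=> rT ck.
have cvt := good_cintg N0 T0 r gv; have B0 := good_B0 T0 gv.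
have mvt := cintg_meas cvt.
have Ni : 0 < N^-1 by rewrite invr_gt0.
have a0 : 0 <= alpha N T r by apply: (alpha_ge0 N0 T0); case/andP: rT.
pose K := B * B * (4 * pi * N).
have K0 : 0 <= K by rewrite !mulr_ge0 ?pi_ge0 ?(ltW N0).
have cb y : normc (conv (v r) (v r) y) <= K * expR (- (N^-1 * `|y|)).
  apply: le_trans (good_conv N0 T0 y gv gv rT) _; rewrite ler_wpM2l//.
  by apply: W_le_exp => //; case/andP: rT.
have cc : ccont (conv (v r) (v r)).
  exact: ccont_conv cvt (good_ccont r) (good_bnd N0 T0 gv r).
have ic : cintg mu (conv (v r) (v r)) by exact: cintg_exp Ni (ccont_meas cc) cb.
(* The rate is halved to separate the variables, since [|x| <= |y| + |x - y|]. *)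
have dom x y : normc (v r y * v r (x - y)) <=
    B * expR (- ((2 * N)^-1 * `|x|)) * (B * expR (- ((2 * N)^-1 * `|y|))).
  have h1 := good_exp N0 T0 gv r y; have h2 := good_exp N0 T0 gv r (x - y).
  rewrite normcM; apply: le_trans (ler_pM (normc_ge0 _) (normc_ge0 _) h1 h2) _.
  rewrite [leLHS](_ : _ = B * B * expR (- (N^-1 * `|y|) - N^-1 * `|x - y|)); last first.
    by rewrite expRD; ring.
  rewrite [leRHS](_ : _ = B * B * expR (- ((2 * N)^-1 * `|x|) - (2 * N)^-1 * `|y|)); last first.
    by rewrite expRD; ring.
  rewrite ler_wpM2l ?mulr_ge0// ler_expR.
  rewrite (_ : N^-1 = 2 * (2 * N)^-1); last by field; rewrite lt0r_neq0.
  have : `|x| <= `|y| + `|x - y| by have := ler_distD y x 0; rewrite !subr0; lra.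
  have : 0 < (2 * N)^-1 by rewrite invr_gt0 mulr_gt0.
  have := normr_ge0 y; have := normr_ge0 (x - y).
  by move: `|x| `|y| `|x - y| (2 * N)^-1 => p q s t; nra.
have N20 : 0 < (2 * N)^-1 by rewrite invr_gt0 mulr_gt0.
have ie : rintg mu (fun x => B * expR (- ((2 * N)^-1 * `|x|))).
  by apply: rintgZ; exact: rintg_expRc.
have cE := ifourier_conv cvt cvt ie ie dom.
have icc : cintg mu (fun y => (c0 R)%:C * conv (v r) (v r) y) by exact: cintgZ.
have e1 x : sol r x ^+ 2 = ifourier (fun y => (c0 R)%:C * conv (v r) (v r) y) x.
  rewrite expr2 /sol cE ifourierE [RHS]ifourierE.
  rewrite -cintZ; last exact: cintg_cisM (measurable_lin x) ic.
  by congr (_ * _); apply: eq_cint => y; rewrite mulrCA.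
have isq : cintg mu (fun x => sol r x ^+ 2).
  apply: (@cintg_dom _ _ R mu _ (fun x => normc (sol r x) ^+ 2)).
  - by apply: cmeasM; apply: ccont_meas; exact: ccont_ifourier.
  - exact: sol_sqr.
  - by move=> x; rewrite normcX.
have isk : cintg mu (fun x => sol r x ^+ 2 * fourier k x).
  under eq_fun do rewrite mulrC.
  apply: (@cintgM_bnd _ _ R mu _ _ (c0 R * \int[mu]_y normc (k y))) => //.
  - apply: ccont_meas; rewrite (_ : fourier k = fun x => ifourier k (- x)); last first.
      by apply/funext => x; exact: fourierE.
    by apply: ccont_comp; [exact: ccont_ifourier|exact: opp_continuous].
  - by move=> x; rewrite fourierE; exact: normc_ifourier.
rewrite (_ : (fun x => _) = fun x =>
    ifourier (fun y => (c0 R)%:C * conv (v r) (v r) y) x * fourier k x); last first.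
  by apply/funext => x; rewrite e1.
apply: (@Parseval _ _ _ (c0 R * K)) => //.
- by apply: ccontM => //; exact: ccont_cst.
- move=> y; rewrite normcM normc_real (ger0_norm (ltW (c0_gt0 R))).
  rewrite ler_wpM2l ?(ltW (c0_gt0 R))//; apply: (good_conv_cst N0 T0 y gv gv rT).
- by move: isk; under eq_fun do rewrite e1.
Qed.

End MildSolution.

Lemma poly_expR (R : realType) (k : nat) (s : R) : 0 < s ->
  exists C : R, 0 <= C /\ forall x : R, `|x| ^+ k <= C * expR (s * `|x|).
Proof.
elim: k s => [|k ih] s s0.
  exists 1; split => // x; rewrite expr0 mul1r -[leLHS]expR0 ler_expR.
  by rewrite mulr_ge0// ltW.
have s20 : 0 < s / 2 by rewrite divr_gt0.
have [C [C0 hC]] := ih _ s20; exists (2 / s * C); split.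
  by rewrite mulr_ge0// divr_ge0// ltW.
move=> x; rewrite exprS.
have e1 : `|x| <= 2 / s * expR (s / 2 * `|x|).
  have h1 := expR_ge1Dx (s / 2 * `|x|).
  rewrite -ler_pdivrMl ?divr_gt0// invf_div; lra.
apply: le_trans (ler_pM (normr_ge0 _) (exprn_ge0 _ (normr_ge0 _)) e1 (hC x)) _.
rewrite (_ : s * `|x| = s / 2 * `|x| + s / 2 * `|x|); last by field.
by rewrite expRD le_eqVlt; apply/orP; left; apply/eqP; ring.
Qed.

(** * Continuity in time *)

Section SolutionProperties.
Variable R : realType.
Notation mu := (@lebesgue_measure R).
Notation RR := (measurableTypeR R * measurableTypeR R)%type.
Implicit Types (f g h : R -> R[i]).

Variables b N T B : R.
Hypotheses (N0 : 0 < N) (T0 : 0 < T).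
Variables (v0 : R -> R[i]) (v : R -> R -> R[i]).
Hypothesis gv : good N T B v.
Hypothesis fixv : forall t x, v t x = Phi b T v0 v t x.
Hypothesis cv0 : ccont v0.
Hypothesis iv0 : cintg mu v0.
Variable M0 : R.
Hypothesis bv0 : forall x, normc (v0 x) <= M0.
Hypothesis iu0 : cintg mu (ifourier v0).

Let P (x : R) : R := `|x ^+ 5 + b * x ^+ 3|.

Lemma mult_lip t t0 x : normc (kawahara_multiplier b t x - kawahara_multiplier b t0 x) <=
  `|t - t0| * P x.
Proof.
rewrite /kawahara_multiplier.
have -> : t * (x ^+ 5 + b * x ^+ 3) = t0 * (x ^+ 5 + b * x ^+ 3) + (t - t0) * (x ^+ 5 + b * x ^+ 3).
  by ring.
rewrite cisD -{2}(mulr1 (cis (t0 * _))) -mulrBr normc_cisM.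
by apply: le_trans (normc_cisB1 _) _; rewrite normrM.
Qed.

(** On [[0, t0]] the two integrands differ by the phase alone; on the rest of [[0, t]] only the
    first one is present. *)
Lemma Duh_lip q (K : R) t t0 x : 0 <= K -> cmeas (fun z : RR => q z.1 z.2) ->
  (forall r, 0 <= r <= T -> normc (q r x) <= K) -> 0 <= t0 -> t0 <= t -> t <= T ->
  normc (Duh b q t x - Duh b q t0 x) <= K * (t - t0) * (1 + T * P x).
Proof.
move=> K0 mq qK t00 t0t tT.
have t0T : t0 <= T by exact: le_trans tT.
have t_0 : 0 <= t by exact: le_trans t0t.
have P0 : 0 <= P x by exact: normr_ge0.
have mi := cmeas_Duh_integrand b _ x mq.
have I (u : R) : u <= T -> cintg mu (fun r => (chi u r)%:C * (kawahara_multiplier b (u - r) x * q r x)).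
  move=> uT; apply: (@cintg_dom _ _ R mu _ (fun r => K * chi u r)); first exact: mi.
  - by apply: rintgZ; exact: rintg_chi.
  - move=> r; rewrite normcM normcM normc_mult mul1r normc_real ger0_norm ?chi_ge0//.
    rewrite /chi; case: ifPn => [/andP[r0 rt]|_]; last by rewrite !(mul0r, mulr0).
    by rewrite mul1r mulr1; apply: qK; rewrite r0 (le_trans rt uT).
rewrite /Duh -cintB; [|exact: I|exact: I].
pose G r := K * (chi t r - chi t0 r) + K * ((t - t0) * P x) * chi t0 r.
have iG : rintg mu G.
  by apply: rintgD; apply: rintgZ; [apply: rintgB|]; exact: rintg_chi.
apply: (@le_trans _ _ (\int[mu]_r G r)).
  apply: normc_cint_le => //; first by apply: cmeasB; exact: mi.
  move=> r; rewrite /G; have [r0|r0] := ltP r 0.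
    have n0 : (0 <= r) = false by rewrite leNgt r0.
    rewrite /chi n0 /= !mul0r !subr0 !mulr0 addr0.
    by rewrite Normc.normc0.
  have [rt0|rt0] := leP r t0.
    rewrite /chi r0 rt0 (le_trans rt0 t0t) /= !mul1r subrr mulr0 add0r mulr1.
    rewrite -mulrBl normcM mulrC; apply: ler_pM; rewrite ?normc_ge0//.
      by apply: qK; rewrite r0 (le_trans rt0).
    apply: le_trans (mult_lip _ _ _) _.
    by rewrite (_ : t - r - (t0 - r) = t - t0) ?ger0_norm ?subr_ge0//; ring.
  have n0 : (r <= t0) = false by rewrite leNgt rt0.
  have c00 : chi t0 r = 0 by rewrite /chi n0 andbF.
  rewrite c00 mul0r !subr0 mulr0 addr0 normcM normcM normc_mult mul1r normc_real.
  rewrite ger0_norm ?chi_ge0// mulrC.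
  rewrite /chi; case: ifPn => [/andP[_ rt]|_]; last by rewrite !(mul0r, mulr0).
  by rewrite !mulr1; apply: qK; rewrite r0 (le_trans rt).
rewrite /G RintegralD//; last 2 first.
- by apply: rintgZ; apply: rintgB; exact: rintg_chi.
- by apply: rintgZ; exact: rintg_chi.
rewrite !RintegralZl//; last 2 first.
- exact: rintg_chi.
- by apply: rintgB; exact: rintg_chi.
rewrite RintegralB ?Rintegral_chi//; [|exact: rintg_chi|exact: rintg_chi].
have h : K * ((t - t0) * P x) * t0 <= K * ((t - t0) * P x) * T.
  by rewrite ler_wpM2l// !mulr_ge0// subr_ge0.
apply: le_trans (lerD (lexx _) h) _.
by rewrite le_eqVlt; apply/orP; left; apply/eqP; ring.
Qed.

(** A time derivative costs a polynomial in the frequency, which half of the rate [1 / N]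
    absorbs. *)
Lemma v_lip : exists C : R, 0 <= C /\ forall t t0 x, 0 <= t <= T -> 0 <= t0 <= T ->
  normc (v t x - v t0 x) <= `|t - t0| * (C * expR (- ((2 * N)^-1 * `|x|))).
Proof.
have B0 := good_B0 T0 gv.
pose K1 := B * B * (4 * pi * N).
have K10 : 0 <= K1 by rewrite !mulr_ge0 ?pi_ge0 ?(ltW N0).
have s0 : 0 < (2 * N)^-1 by rewrite invr_gt0 mulr_gt0.
(* The degrees 5 and 3 are those of the symbol; 1, 6 and 4 arise in the Duhamel term, where the
   factor [|x|] is added. *)
have [C5 [C50 h5]] := poly_expR 5 s0; have [C3 [C30 h3]] := poly_expR 3 s0.
have [D1 [D10 k1]] := poly_expR 1 s0; have [D6 [D60 k6]] := poly_expR 6 s0.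
have [D4 [D40 k4]] := poly_expR 4 s0.
pose e (x : R) := expR ((2 * N)^-1 * `|x|).
have e_ge0 x : 0 <= e x by exact: expR_ge0.
have c00 := ltW (c0_gt0 R).
pose C := B * (C5 + `|b| * C3) + c0 R * K1 * (D1 + T * (D6 + `|b| * D4)).
have bb := normr_ge0 b.
exists C; split.
  have a1 : 0 <= C5 + `|b| * C3 by rewrite addr_ge0// mulr_ge0.
  have a2 : 0 <= D6 + `|b| * D4 by rewrite addr_ge0// mulr_ge0.
  have a3 : 0 <= D1 + T * (D6 + `|b| * D4) by rewrite addr_ge0// mulr_ge0// ltW.
  by apply: addr_ge0; [exact: mulr_ge0|apply: mulr_ge0 => //; exact: mulr_ge0].
have main t t0 x : 0 <= t0 -> t0 <= t -> t <= T ->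
    normc (v t x - v t0 x) <= (t - t0) * (C * expR (- ((2 * N)^-1 * `|x|))).
  move=> t00 t0t tT.
  have tin : 0 <= t <= T by rewrite tT (le_trans t00).
  have t0in : 0 <= t0 <= T by rewrite t00 (le_trans t0t).
  have dt : 0 <= t - t0 by rewrite subr_ge0.
  have Pb : P x <= `|x| ^+ 5 + `|b| * `|x| ^+ 3.
    by apply: le_trans (ler_normD _ _) _; rewrite [`|b * _|]normrM !normrX.
  pose E := expR (- (N^-1 * `|x|)).
  have hv0 : normc (v0 x) <= B * E.
    by rewrite -(v_init N0 T0 gv fixv); exact: (good_exp N0 T0 gv 0 x).
  have hq r : 0 <= r <= T -> normc (Q v r x) <= K1 * E.
    move=> rT; apply: le_trans (good_conv N0 T0 x gv gv rT) _; rewrite ler_wpM2l//.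
    by apply: W_le_exp => //; case/andP: rT.
  have E0 : 0 <= E by exact: expR_ge0.
  have hD := Duh_lip (q := Q v) (mulr_ge0 K10 E0) (cmeas_Qgen (good_joint gv) (good_joint gv)) hq t00 t0t tT.
  rewrite (fixv_in fixv x tin) (fixv_in fixv x t0in).
  have := mult_lip t t0 x; rewrite ger0_norm// => hm.
  have ni : normc ('i : R[i]) = 1 by rewrite normcE /= expr0n /= add0r expr1n sqrtr1.
  have hK : normc ('i * (c0 R * x)%:C) = c0 R * `|x|.
    by rewrite normcM ni mul1r normc_real normrM (ger0_norm c00).
  move: (Duh b (Q v) t x) (Duh b (Q v) t0 x) hD => d1 d2 hD.
  move: ('i * _) hK => K hK.
  move: (kawahara_multiplier b t x) (kawahara_multiplier b t0 x) hm => m1 m2 hm.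
  rewrite (_ : _ - _ = (m1 - m2) * v0 x - K * (d1 - d2)); last by ring.
  apply: le_trans (normcB _ _) _; rewrite normcM [normc (K * _)]normcM hK.
  apply: le_trans (lerD (ler_pM (normc_ge0 _) (normc_ge0 _) hm hv0)
    (ler_wpM2l (mulr_ge0 c00 (normr_ge0 x)) hD)) _.
  have Ee : E * e x = expR (- ((2 * N)^-1 * `|x|)).
    by rewrite /E /e -expRD; congr expR; field; rewrite lt0r_neq0.
  rewrite -Ee.
  have q1 : P x <= (C5 + `|b| * C3) * e x.
    apply: le_trans Pb _; rewrite mulrDl -mulrA lerD//.
    by rewrite ler_wpM2l//; exact: h3.
  have q2 : `|x| * (1 + T * P x) <= (D1 + T * (D6 + `|b| * D4)) * e x.
    rewrite mulrDr mulr1 mulrDl lerD//; first by have := k1 x; rewrite expr1.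
    rewrite mulrCA -mulrA ler_wpM2l ?(ltW T0)//.
    apply: (@le_trans _ _ (`|x| * (`|x| ^+ 5 + `|b| * `|x| ^+ 3))); first by rewrite ler_wpM2l.
    rewrite mulrDr -exprS mulrCA -exprS mulrDl -mulrA lerD//.
    by rewrite ler_wpM2l//; exact: k4.
  rewrite [leLHS](_ : _ = (t - t0) * E * (B * P x + c0 R * K1 * (`|x| * (1 + T * P x)))); last by ring.
  rewrite [leRHS](_ : _ = (t - t0) * E * (C * e x)); last by ring.
  rewrite ler_wpM2l ?mulr_ge0// /C mulrDl; apply: lerD.
  - by rewrite -mulrA ler_wpM2l.
  - by rewrite -[leRHS]mulrA ler_wpM2l// mulr_ge0.
move=> t t0 x /andP[t_0 tT] /andP[t00 t0T].
have [h|h] := leP t0 t.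
- by rewrite ger0_norm ?subr_ge0//; exact: main.
- by rewrite normc_dist distrC ger0_norm ?subr_ge0 ?(ltW h)//; apply: main => //; exact: ltW.
Qed.

(** By Plancherel the increments of [sol v] in [L2] are those of [v], which [v_lip] controls. *)
Lemma sol_in_C_L2 : in_C_L2 T (sol v).
Proof.
split; first by move=> t _; exact: (sol_inL2 N0 T0 gv).
move=> t0 t0T; have [C [C0 hC]] := v_lip.
have s0 : 0 < N^-1 by rewrite invr_gt0.
pose I := \int[mu]_x expR (- (N^-1 * `|x|)).
have I0 : 0 <= I by apply: Rintegral_ge0 => x _; exact: expR_ge0.
pose D := C * Num.sqrt I.
have D0 : 0 <= D by rewrite mulr_ge0// sqrtr_ge0.
have bd t : 0 <= t <= T -> (L2norm (fun x => sol v t x - sol v t0 x)%R <= (`|t - t0| * D)%:E)%E.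
  move=> tT; pose f (y : R) := v t y - v t0 y.
  have c1 := good_cintg N0 T0 t gv; have c2 := good_cintg N0 T0 t0 gv.
  have cf : cintg mu f by exact: cintgB.
  have ccf : ccont f by apply: ccontB; exact: good_ccont gv _.
  have bf x : normc (f x) <= B + B.
    by apply: le_trans (normcB _ _) _; apply: lerD; exact: good_bnd gv _ _.
  have e1 x : sol v t x - sol v t0 x = ifourier f x.
    rewrite /sol !ifourierE -mulrBr -cintB; last 2 first.
    - exact: cintg_cisM (measurable_lin x) c1.
    - exact: cintg_cisM (measurable_lin x) c2.
    by congr (_ * _); apply: eq_cint => y; rewrite mulrBr.
  rewrite (_ : (fun x => _) = ifourier f); last by apply/funext.
  apply: L2norm_le; first exact: mulr_ge0.
  rewrite (Plancherel cf ccf bf).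
  have iG : rintg mu (fun x => (`|t - t0| * C) ^+ 2 * expR (- (N^-1 * `|x|))).
    by apply: rintgZ; exact: rintg_expRc.
  apply: (@le_trans _ _ (\int[mu]_x ((`|t - t0| * C) ^+ 2 * expR (- (N^-1 * `|x|)))%:E)%E).
    apply: ge0_le_integral => //.
    - by move=> x _; rewrite lee_fin sqr_ge0.
    - apply/measurable_EFinP; apply: measurable_funX; apply: measurable_normc.
      exact: ccont_meas.
    - by apply/measurable_EFinP; exact: rintg_meas iG.
    - move=> x _; rewrite lee_fin.
      have h := hC t t0 x tT t0T.
      rewrite (_ : expR (- (N^-1 * `|x|)) = expR (- ((2 * N)^-1 * `|x|)) ^+ 2); last first.
        by rewrite -expRM_natl; congr expR; field; rewrite lt0r_neq0.
      by rewrite -exprMn -mulrA ler_pXn2r ?nnegrE ?normc_ge0// !mulr_ge0 ?expR_ge0.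
  rewrite -Rintegral_EFin// lee_fin RintegralZl//; last exact: rintg_expRc.
  by rewrite -/I /D [leRHS]exprMn [in leRHS]exprMn sqr_sqrtr// exprMn mulrA.
apply: (@squeeze_cvge _ _ _ _ (cst 0%E) _ (fun t => (`|t - t0| * D)%:E)).
- have : \forall t \near within `[0, T]%classic (nbhs t0), `[0, T]%classic t by exact: withinT.
  apply: filterS => t; rewrite /= in_itv /= => tT.
  by rewrite L2norm_ge0 /=; exact: bd.
- exact: cvg_cst.
- apply: cvg_EFin; first exact: nearW.
  apply: cvg_within_filter.
  have h1 : t - t0 @[t --> t0] --> (0 : R).
    by rewrite -[X in _ --> X](subrr t0); apply: cvgB; [exact: cvg_id|exact: cvg_cst].
  have h2 : `|t - t0| @[t --> t0] --> (0 : R).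
    by rewrite -[X in _ --> X](normr0 R); apply: (cvg_norm h1).
  have h3 : `|t - t0| * D @[t --> t0] --> (0 * D : R).
    by apply: cvgM; [exact: h2|exact: cvg_cst].
  by move: h3; rewrite mul0r.
Qed.

End SolutionProperties.

(** * The mild equation tested on Schwartz functions *)

Section KawaharaSolution.
Variable R : realType.
Notation mu := (@lebesgue_measure R).
Notation RR := (measurableTypeR R * measurableTypeR R)%type.
Implicit Types (f g h : R -> R[i]).

Variables b N T B : R.
Hypotheses (N0 : 0 < N) (T0 : 0 < T).
Variables (v0 : R -> R[i]) (v : R -> R -> R[i]).
Hypothesis gv : good N T B v.
Hypothesis fixv : forall t x, v t x = Phi b T v0 v t x.
Hypothesis cv0 : ccont v0.
Hypothesis iv0 : cintg mu v0.
Variable M0 : R.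
Hypothesis bv0 : forall x, normc (v0 x) <= M0.
Hypothesis iu0 : cintg mu (ifourier v0).

Let norm_i : normc ('i : R[i]) = 1.
Proof. by rewrite normcE /= expr0n /= add0r expr1n sqrtr1. Qed.

Lemma free_pairing k : cintg mu k ->
  distr_of (ifourier v0) (fourier k) = cint mu (fun y => v0 y * k y).
Proof.
move=> ck.
rewrite -[LHS]/(cint mu (fun x => ifourier v0 x * fourier k x)).
apply: (@Parseval _ _ _ M0) => //.
under eq_fun do rewrite mulrC.
apply: (@cintgM_bnd _ _ R mu _ _ (c0 R * \int[mu]_y normc (k y))) => //.
- apply: ccont_meas; rewrite (_ : fourier k = fun x => ifourier k (- x)); last first.
    by apply/funext => x; exact: fourierE.
  by apply: ccont_comp; [exact: ccont_ifourier|exact: opp_continuous].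
- by move=> x; rewrite fourierE; exact: normc_ifourier.
Qed.

Section TestFunction.
Variables (psi : R -> R[i]) (spsi : schwartz psi).

Let phi := ifourier psi.

Lemma test_cintg : cintg mu psi.
Proof. by have := schwartz_cintg 0 spsi; rewrite cderiven0. Qed.

Lemma phi_ccont : ccont phi.
Proof. exact: ccont_ifourier test_cintg. Qed.

Lemma phi_cintg : cintg mu phi /\ cintg mu (fun y => y%:C * phi y).
Proof.
have [M [M_0 [h1 h2]]] := schwartz_ifourier_decay spsi.
have iM : rintg mu (fun x => M * hw 1 x) by apply: rintgZ; exact: rintg_hw.
have mphi := ccont_meas phi_ccont.
split; apply: (@cintg_dom _ _ R mu _ (fun x => M * hw 1 x)) => //.
- by apply: cmeasM => //; exact: cmeas_real.
- by move=> x; rewrite normcM normc_real.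
Qed.

Lemma mult_cintg t h : cintg mu h -> cintg mu (fun y => kawahara_multiplier b t y * h y).
Proof.
move=> ch; apply: (@cintgM_bnd _ _ R mu _ _ 1) => //.
- exact: ccont_meas (ccont_mult b t).
- by move=> x; rewrite normc_mult.
Qed.

(** Group and derivative are moved onto the test function. The sign in [distr_deriv] cancels against
    the one in [cderiven1_fourier], and [sqr_pairing] replaces the square by a convolution. *)
Lemma duhamel_pairing t r : 0 <= t <= T -> 0 <= r <= t ->
  kawahara_group b (t - r) (distr_deriv (distr_of (fun x => sol v r x ^+ 2))) psi =
  cint mu (fun y => (c0 R)%:C * conv (v r) (v r) y *
    ('i * (y%:C * (kawahara_multiplier b (t - r) y * phi y)))).
Proof.
move=> tT rt; have rT : 0 <= r <= T.
  by case/andP: rt => -> /le_trans -> //; case/andP: tT.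
have [p1 p2] := phi_cintg.
set h := fun y => kawahara_multiplier b (t - r) y * phi y.
have ch : cintg mu h by exact: mult_cintg.
have ch1 : cintg mu (fun y => y%:C * h y).
  have := mult_cintg (t - r) p2.
  by under eq_fun do rewrite mulrCA.
have ch2 : cintg mu (fun y => 'i * (y%:C * h y)) by exact: cintgZ.
(* This is the left side unfolded: [h] carries the inverse transform of [psi] and the multiplier. *)
transitivity (- cint mu (fun x => sol v r x ^+ 2 * cderiven 1 (fourier h) x)); first by [].
rewrite cderiven1_fourier// (sqr_pairing N0 T0 gv rT); last exact: cintgN.
rewrite -cintN; first by apply: eq_cint => y; rewrite mulrN opprK.
apply: (@cintgM_bnd _ _ R mu _ _ (c0 R * (B * B * (4 * pi * N)))).
- apply: cmeasM; first exact: cmeas_cst.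
  by apply: cmeas_conv; apply: ccont_meas; exact: good_ccont gv _.
- move=> y; rewrite normcM normc_real (ger0_norm (ltW (c0_gt0 R))).
  by rewrite ler_wpM2l ?(ltW (c0_gt0 R))//; exact: (good_conv_cst N0 T0 y gv gv rT).
- exact: cintgN.
Qed.

(** After Parseval this is the fixed point identity integrated against [phi]; Fubini exchanges time
    and frequency in the Duhamel term. *)
Lemma mild_pairing t : 0 <= t <= T ->
  distr_of (sol v t) psi =
      kawahara_group b t (distr_of (ifourier v0)) psi -
      cintegral `[0, t]%classic (fun t' =>
        kawahara_group b (t - t')
          (distr_deriv (distr_of (fun x => sol v t' x ^+ 2))) psi).
Proof.
move=> tT; have [p1 p2] := phi_cintg.
have t_0 : 0 <= t by case/andP: tT.
have tT' : t <= T by case/andP: tT.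
have cvt := good_cintg N0 T0 t gv.
have B0 := good_B0 T0 gv.
have mphi := ccont_meas phi_ccont.
have e1 : distr_of (sol v t) psi = cint mu (fun y => v t y * phi y).
  exact: (ifourier_swap cvt test_cintg).
have e2 : kawahara_group b t (distr_of (ifourier v0)) psi =
    cint mu (fun y => v0 y * (kawahara_multiplier b t y * phi y)).
  exact: (free_pairing (mult_cintg t p1)).
pose K := B * B * (4 * pi * N).
have K0 : 0 <= K by rewrite !mulr_ge0 ?pi_ge0 ?(ltW N0).
pose F (z : RR) : R[i] := (chi t z.1)%:C * ((c0 R)%:C * conv (v z.1) (v z.1) z.2 *
    ('i * (z.2%:C * (kawahara_multiplier b (t - z.1) z.2 * phi z.2)))).
have mF : cmeas F.
  have m1 : measurable_fun setT (fun z : RR => z.1 : R) by exact: measurable_fst.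
  have m2 : measurable_fun setT (fun z : RR => z.2 : R) by exact: measurable_snd.
  apply: cmeasM.
    by apply: cmeas_real; apply: measurable_chi => //; exact: measurable_cst.
  apply: cmeasM.
    apply: cmeasM; first exact: cmeas_cst.
    exact: cmeas_Qgen (good_joint gv) (good_joint gv).
  apply: cmeasM; first exact: cmeas_cst.
  apply: cmeasM; first exact: cmeas_real.
  apply: cmeasM; last exact: cmeas_sndR.
  by apply: cmeas_mult => //; exact: measurable_funB.
have bF r y : normc (F (r, y)) <= c0 R * K * chi t r * normc (y%:C * phi y).
  have -> : normc (F (r, y)) = chi t r * (c0 R * normc (conv (v r) (v r) y) * normc (y%:C * phi y)).
    rewrite -[F (r, y)]/((chi t r)%:C * ((c0 R)%:C * conv (v r) (v r) y *
     ('i * (y%:C * (kawahara_multiplier b (t - r) y * phi y))))).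
    move: (conv _ _ _) (phi y) => z w.
    rewrite 2!normcM [normc ((c0 R)%:C * _)]normcM [normc ('i * _)]normcM.
    rewrite [y%:C * (_ * w)]mulrCA [normc (kawahara_multiplier _ _ _ * _)]normcM.
    rewrite normc_mult norm_i !mul1r !normc_real (ger0_norm (chi_ge0 _ _)).
    by rewrite (ger0_norm (ltW (c0_gt0 R))).
  rewrite /chi; case: ifPn => [/andP[r0 rt]|_]; last by rewrite !(mul0r, mulr0).
  rewrite mul1r mulr1 ler_wpM2r ?normc_ge0// ler_wpM2l ?(ltW (c0_gt0 R))//.
  by apply: (good_conv_cst N0 T0 y gv gv); rewrite r0 (le_trans rt).
have e3 : cintegral `[0, t]%classic (fun t' => kawahara_group b (t - t')
      (distr_deriv (distr_of (fun x => sol v t' x ^+ 2))) psi) =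
    cint mu (fun y => 'i * (c0 R * y)%:C * Duh b (Q v) t y * phi y).
  rewrite cintegral_chi.
  transitivity (cint mu (fun r => cint mu (fun y => F (r, y)))).
    apply: eq_cint => r.
    have [rt|rt] := boolP ((0 <= r) && (r <= t)); last first.
      rewrite /F /chi (negbTE rt) mul0r; apply/esym.
      rewrite (_ : (fun y => _) = fun=> 0); last by apply/funext => y; rewrite /= ?(negbTE rt) mul0r.
      by rewrite /cint /= Rintegral_cst// mul0r.
    rewrite (duhamel_pairing tT rt) /F /chi /= rt mul1r; apply: eq_cint => y.
    by rewrite mul1r.
  rewrite (@cint_fubini _ _ _ _ R mu mu (fun r => c0 R * K * chi t r)
     (fun y => normc (y%:C * phi y)) _ _ F mF bF).
  - apply: eq_cint => y; rewrite /F /= /Duh.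
    have i1 : cintg mu (fun r => (chi t r)%:C * (kawahara_multiplier b (t - r) y * Q v r y)).
      exact: (good_Duh_intg b N0 T0 y gv gv tT').
    transitivity (cint mu (fun r => ('i * (c0 R * y)%:C * phi y) *
        ((chi t r)%:C * (kawahara_multiplier b (t - r) y * Q v r y)))).
      apply: eq_cint => r; rewrite /Q rmorphM /=.
      move: (conv _ _ _) (kawahara_multiplier _ _ _) (phi y) => z w p; ring.
    by rewrite (cintZ _ i1) mulrAC.
  - by apply: rintgZ; exact: rintg_chi.
  - exact: cintg_normc p2.
rewrite e1 e2 e3 -cintB.
- apply: eq_cint => y; rewrite (fixv_in fixv y tT); ring.
- under eq_fun do rewrite mulrCA.
  apply: mult_cintg.
  by apply: (@cintgM_bnd _ _ R mu _ _ M0) => //; exact: cintg_meas iv0.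
- have mD : cmeas (Duh b (Q v) t).
    apply: (@cmeas_slice _ (fun t x => Duh b (Q v) t x)).
    exact: cmeas_Duh (cmeas_Qgen (good_joint gv) (good_joint gv)).
  apply: (@cintgM_bnd _ _ R mu _ _ (kappa N T * (B * B))) => //.
  + apply: cmeasM => //; apply: cmeasM; first exact: cmeas_cst.
    by apply: cmeas_real; exact: measurable_funM.
  + move=> y; apply: le_trans (good_Duh_bound b N0 T0 y gv gv tT') _.
    apply: ler_piMr; first by rewrite mulr_ge0 ?(kappa_ge0 N0 T0)// mulr_ge0.
    apply: le_trans (W_le_exp N0 T0 y tT') _.
    by rewrite -[leRHS]expR0 ler_expR oppr_le0 mulr_ge0// invr_ge0 ltW.
Qed.

End TestFunction.

Lemma sol_kawahara : kawahara_solution b T (sol v 0) (sol v).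
Proof.
split; first exact: (sol_in_C_L2 N0 T0 gv fixv).
move=> t tT psi spsi.
have -> : sol v 0 = ifourier v0 by rewrite /sol (v_init N0 T0 gv fixv).
exact: mild_pairing.
Qed.

Lemma sol_pairing t psi : cintg mu psi -> ccont psi -> cintg mu (fourier psi) ->
  distr_of (sol v t) (fourier psi) = cint mu (fun y => v t y * psi y).
Proof.
move=> cp ccp cfp; have cvt := good_cintg N0 T0 t gv.
rewrite -[LHS]/(cint mu (fun x => ifourier (v t) x * fourier psi x)).
apply: (@Parseval _ _ _ B) => //.
- exact: good_ccont gv _.
- exact: good_bnd gv _.
- apply: (@cintgM_bnd _ _ R mu _ _ (c0 R * \int[mu]_y normc (v t y))) => //.
  + by apply: ccont_meas; exact: ccont_ifourier.
  + by move=> x; exact: normc_ifourier.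
Qed.

End KawaharaSolution.

(** * Density in weighted spaces *)

Section SobolevWeight.
Variable R : realType.
Notation mu := (@lebesgue_measure R).
Implicit Types (s x : R).

(** The square of the multiplier in [Hs_norm], whose exponent is [s / 2]. *)
Definition om s x : R := (1 + x ^+ 2) `^ s.

Lemma bracket_ge1 x : 1 <= 1 + x ^+ 2.
Proof. by rewrite lerDl sqr_ge0. Qed.

Lemma bracket_gt0 x : 0 < 1 + x ^+ 2.
Proof. exact: lt_le_trans (bracket_ge1 x). Qed.

Lemma om_gt0 s x : 0 < om s x.
Proof. by rewrite powR_gt0// bracket_gt0. Qed.

Lemma om_ge0 s x : 0 <= om s x.
Proof. exact/ltW/om_gt0. Qed.

Lemma om_half s x : ((1 + x ^+ 2) `^ (s / 2)) ^+ 2 = om s x.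
Proof. by rewrite -powR_mulrn ?powR_ge0// -powRrM divfK. Qed.

Lemma om_hw s x : s <= -1 -> om s x <= hw 1 x.
Proof.
move=> s1; rewrite /hw divr1 -powR_inv1 ?(ltW (bracket_gt0 x))//.
by rewrite ler_powR// bracket_ge1.
Qed.

Lemma measurable_om s : measurable_fun setT (om s).
Proof.
apply: (@measurableT_comp _ _ _ _ _ _ (fun y : R => y `^ s)).
  exact: measurable_powR.
by apply: measurable_funD => //; exact: measurable_funX.
Qed.

Lemma rintg_om s : s <= -1 -> rintg mu (om s).
Proof.
move=> s1; apply: (@rintg_dom _ _ R mu _ (hw 1)).
- exact: measurable_om.
- exact: rintg_hw.
- by move=> x; rewrite ger0_norm ?om_ge0// om_hw.
Qed.

Lemma om_le1 s x : s <= -1 -> om s x <= 1.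
Proof. by move=> s1; apply: le_trans (om_hw x s1) _; exact: hw_le1. Qed.

End SobolevWeight.

Section Density.
Variable R : realType.
Notation mu := (@lebesgue_measure R).
Implicit Types (f g h : R -> R[i]) (x y : R).

(** Equal to 1 for [|x| <= M], to 0 from [M + 1] on, and linear in [|x|] between. *)
Definition cutoff (M x : R) : R := Num.max 0 (Num.min 1 (M + 1 - `|x|)).

Lemma continuous_cutoff M : continuous (cutoff M).
Proof.
move=> x; apply: (@continuous_max _ _ (fun=> 0) (fun x => Num.min 1 (M + 1 - `|x|))).
  exact: cvg_cst.
apply: (@continuous_min _ _ (fun=> 1) (fun x => (M + 1 - `|x|))).
  exact: cvg_cst.
by apply: cvgB; [exact: cvg_cst|exact: norm_continuous].
Qed.

Definition clip (M y : R) : R := Num.max (- M) (Num.min M y).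

Lemma continuous_clip M : continuous (clip M).
Proof.
move=> x; apply: (@continuous_max _ _ (fun=> - M) (fun x => Num.min M x)).
  exact: cvg_cst.
apply: (@continuous_min _ _ (fun=> M) (fun x => x)).
  exact: cvg_cst.
exact: cvg_id.
Qed.

Lemma clip_norm M y : 0 <= M -> `|clip M y| <= M.
Proof.
move=> M0; rewrite ler_norml /clip le_max lexx /= ge_max ge_min lexx andbT.
by lra.
Qed.

(** [clip M] is the projection onto [[- M, M]], which brings a point no farther from the elements of
    that interval. *)
Lemma clip_dist M z y : `|z| <= M -> `|z - clip M y| <= `|z - y|.
Proof.
rewrite ler_norml => /andP[z1 z2]; rewrite /clip.
have [yM|yM] := leP M y; last first.
  have [h|h] := leP y (- M); first by rewrite !ger0_norm; lra.
  by [].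
have [h|h] := leP M (- M); rewrite !ler0_norm; lra.
Qed.

(** Approximation in [L1] on a compact interval controls neither the size nor the support; clipping
    and the cutoff restore both without increasing the distance to [f]. The bound on [h] later
    converts [L1] into [L2]. *)
Lemma continuous_approx (f : R -> R) (M e : R) : 0 <= M -> 0 < e ->
  measurable_fun setT f -> (forall x, `|f x| <= M) -> (forall x, M < `|x| -> f x = 0) ->
  exists h : R -> R, [/\ continuous h, forall x, `|h x| <= M,
    forall x, M + 1 < `|x| -> h x = 0, rintg mu (fun x => `|f x - h x|) &
    \int[mu]_x `|f x - h x| <= e].
Proof.
move=> M0 e0 mf fM f0.
pose E := `[- (M + 1), M + 1]%classic.
have mE : measurable E by exact: measurable_itv.
have finE : (mu E < +oo)%E.
  by rewrite /E lebesgue_measure_itv; case: ifP => _; rewrite ?ltry// -EFinD ltry.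
have cstE : mu.-integrable E (EFin \o (fun=> M)).
  apply: continuous_compact_integrable; first exact: segment_compact.
  by apply: continuous_subspaceT => x; exact: cvg_cst.
have iE : mu.-integrable E (EFin \o f).
  apply: (@le_integrable _ _ R mu _ mE _ (EFin \o (fun=> M)) _ _ cstE).
  - by apply/measurable_EFinP; exact: measurable_funTS mf.
  - by move=> x _; rewrite /= lee_fin (ger0_norm M0).
have [g [cg ig gf]] := approximation_continuous_integrable mE finE iE.
have /fine_cvgP[_ gf'] := gf.
have /cvgrPdist_lt/(_ _ e0)[n _ /(_ n (leqnn n))] := gf'.
rewrite /= sub0r normrN => hn.
pose h x := cutoff M x * clip M (g n x).
have c01 x : 0 <= cutoff M x <= 1.
  by rewrite /cutoff le_max lexx /= ge_max ler01 ge_min lexx.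
have ch : continuous h.
  move=> x; apply: cvgM; first exact: continuous_cutoff.
  by apply: (@continuous_comp _ _ _ (g n) (clip M)); [exact: cg|exact: continuous_clip].
have mfh : measurable_fun setT (fun x => `|f x - h x|).
  apply: measurableT_comp => //; apply: measurable_funB => //.
  exact: continuous_measurable_fun.
have key x : `|f x - h x| <= ((fun x => `|f x - g n x|) \_ E) x.
  rewrite patchE; case: ifPn => xE; last first.
    have xM : M + 1 < `|x|.
      rewrite ltNge; apply: contra xE => xM; rewrite inE /E /= in_itv /=.
      by rewrite -ler_norml.
    rewrite f0; last by lra.
    rewrite /h /cutoff min_r ?max_l ?mul0r ?subrr ?normr0//; lra.
  have h1 := clip_dist (g n x) (fM x).
  apply: le_trans h1; rewrite /h.
  have [xM|xM] := leP `|x| M.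
    have -> : cutoff M x = 1 by rewrite /cutoff min_l ?max_r//; lra.
    by rewrite mul1r.
  rewrite f0// !sub0r !normrN normrM ger0_norm; last by case/andP: (c01 x).
  by rewrite ler_piMl//; case/andP: (c01 x).
have iG : rintg mu ((fun x => `|f x - g n x|) \_ E).
  rewrite /rintg -restrict_EFin; apply/integrable_restrict => //=; rewrite setTI.
  have i1 := @integrableB _ _ R mu _ mE _ _ iE (ig n).
  have i2 := @integrable_norm _ _ R mu _ _ i1.
  by apply: eq_integrable i2 => // x _.
have ifh : rintg mu (fun x => `|f x - h x|).
  by apply: (@rintg_dom _ _ R mu _ _ _ iG) => // x; rewrite normr_id.
exists h; split => //.
- move=> x; rewrite /h normrM -[leRHS]mul1r; apply: ler_pM => //.
  + by have /andP[a1 a2] := c01 x; rewrite ger0_norm.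
  + exact: clip_norm.
- move=> x xM; rewrite /h /cutoff min_r ?max_l ?mul0r//; lra.
- apply: le_trans (@le_Rintegral _ _ R mu _ _ _ measurableT ifh iG (fun x _ => key x)) _.
  rewrite -Rintegral_mkcond; apply: le_trans (ler_norm _) _; exact: ltW.
Qed.

End Density.

(** * Density of mollified functions in weighted spaces *)

Section WeightedDensity.
Variables (R : realType) (s : R).
Notation mu := (@lebesgue_measure R).
Implicit Types (f g h : R -> R[i]) (x y : R).
Hypothesis s1 : s <= -1.

Definition wsq f x : R := om s x * normc (f x) ^+ 2.

Lemma wsq_ge0 f x : 0 <= wsq f x.
Proof. by rewrite mulr_ge0 ?om_ge0 ?sqr_ge0. Qed.

Lemma measurable_wsq f : cmeas f -> measurable_fun setT (wsq f).
Proof.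
move=> mf; apply: measurable_funM; first exact: measurable_om.
by apply: measurable_funX; exact: measurable_normc.
Qed.

Lemma wsqD_le f g x : wsq (fun x => f x + g x) x <= 2 * wsq f x + 2 * wsq g x.
Proof.
rewrite /wsq; have h := normcD (f x) (g x).
rewrite !(mulrCA 2) -mulrDr ler_wpM2l ?om_ge0//.
have h2 : normc (f x + g x) ^+ 2 <= (normc (f x) + normc (g x)) ^+ 2.
  by rewrite ler_sqr ?nnegrE ?addr_ge0 ?normc_ge0.
apply: le_trans h2 _; have := sqr_ge0 (normc (f x) - normc (g x)).
by move: (normc _) (normc _) => a c; nra.
Qed.

Lemma rintg_wsqD f g : cmeas f -> cmeas g -> rintg mu (wsq f) -> rintg mu (wsq g) ->
  rintg mu (wsq (fun x => f x + g x)) /\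
  \int[mu]_x wsq (fun x => f x + g x) x <=
    2 * (\int[mu]_x wsq f x) + 2 * (\int[mu]_x wsq g x).
Proof.
move=> mf mg ifw igw.
have i2 := @rintgD _ _ R mu _ _ (rintgZ 2 ifw) (rintgZ 2 igw).
have i1 : rintg mu (wsq (fun x => f x + g x)).
  apply: (@rintg_dom _ _ R mu _ _ _ i2).
    by apply: measurable_wsq; exact: cmeasD.
  by move=> x; rewrite ger0_norm ?wsq_ge0 ?wsqD_le.
split => //; apply: le_trans (@le_Rintegral _ _ R mu _ _ _ measurableT i1 i2 _) _.
  by move=> x _; exact: wsqD_le.
rewrite RintegralD ?RintegralZl//; exact: rintgZ.
Qed.

Lemma Rintegral_near0 (fn : nat -> R -> R) (G : R -> R) (e : R) : 0 < e ->
  (forall n, measurable_fun setT (fn n)) -> rintg mu G ->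
  (forall n x, `|fn n x| <= G x) -> (forall x, fn n x @[n --> \oo] --> (0 : R)) ->
  exists n, rintg mu (fn n) /\ \int[mu]_x fn n x <= e.
Proof.
move=> e0 mfn iG fG f0.
have := @rintg_dcvg _ _ R mu fn (fun=> 0) G mfn (measurable_cst _) iG fG f0.
rewrite Rintegral_cst// mul0r => /cvgrPdist_le/(_ _ e0)[n _ /(_ n (leqnn n))] /=.
rewrite sub0r normrN => h; exists n; split; first exact: (@rintg_dom _ _ R mu _ _ (mfn n) iG (fG n)).
exact: le_trans (ler_norm _) h.
Qed.

Definition truncate (n : nat) g x : R[i] :=
  if (`|x| <= n%:R) && (normc (g x) <= n%:R) then g x else 0.

Lemma cmeas_truncate n g : cmeas g -> cmeas (truncate n g).
Proof.
move=> mg; have [g1 g2] := mg.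
have mb : measurable_fun setT (fun x => (`|x| <= n%:R :> R) && (normc (g x) <= n%:R)).
  apply: measurable_and; apply: measurable_fun_ler => //.
  exact: measurable_normc.
split.
  rewrite (_ : (fun x => _) = (fun x =>
    if (`|x| <= n%:R) && (normc (g x) <= n%:R) then complex.Re (g x) else 0)).
    exact: measurable_fun_ifT.
  by apply/funext => x; rewrite /truncate; case: ifP.
rewrite (_ : (fun x => _) = (fun x =>
  if (`|x| <= n%:R) && (normc (g x) <= n%:R) then complex.Im (g x) else 0)).
  exact: measurable_fun_ifT.
by apply/funext => x; rewrite /truncate; case: ifP.
Qed.

Lemma normc_truncate n g x : normc (truncate n g x) <= n%:R.
Proof. by rewrite /truncate; case: ifP => [/andP[]//|_]; rewrite (normc_real 0) normr0. Qed.

Lemma truncate_dense g (e : R) : 0 < e -> cmeas g -> rintg mu (wsq g) ->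
  exists n, rintg mu (wsq (fun x => truncate n g x - g x)) /\
    \int[mu]_x wsq (fun x => truncate n g x - g x) x <= e.
Proof.
move=> e0 mg ig; apply: (Rintegral_near0 e0 _ ig).
- move=> n; apply: measurable_wsq; apply: cmeasB => //; exact: cmeas_truncate.
- move=> n x; rewrite ger0_norm ?wsq_ge0// /wsq ler_wpM2l ?om_ge0//.
  rewrite /truncate; case: ifP => _; last by rewrite sub0r normc_opp.
  by rewrite subrr (normc_real 0) normr0 expr0n sqr_ge0.
- move=> x; pose m := (Num.truncn (`|x| + normc (g x))).+1.
  apply/cvgrPdist_le => d d0; exists m => // n /= mn.
  have hn : `|x| + normc (g x) <= n%:R.
    apply: (@le_trans _ _ m%:R); last by rewrite ler_nat.
    by apply: ltW; exact: truncnS_gt.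
  have n0 := normc_ge0 (g x); have x0 := normr_ge0 x.
  have -> : wsq (fun x => truncate n g x - g x) x = 0.
    rewrite /wsq /truncate ifT; last by apply/andP; split; lra.
    by rewrite subrr (normc_real 0) normr0 expr0n mulr0.
  by rewrite subrr normr0 ltW.
Qed.

(** Both functions being bounded, the squared distance is at most [4 * M] times the [L1] distance of
    the parts, and the weight is at most 1 because [s <= -1]. *)
Lemma continuous_dense f (M e : R) : 0 <= M -> 0 < e -> cmeas f ->
  (forall x, normc (f x) <= M) -> (forall x, M < `|x| -> f x = 0) ->
  exists h, [/\ ccont h, forall x, normc (h x) <= 2 * M,
    forall x, M + 1 < `|x| -> h x = 0, rintg mu (wsq (fun x => h x - f x)) &
    \int[mu]_x wsq (fun x => h x - f x) x <= e].
Proof.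
move=> M0 e0 [f1 f2] fM f0.
(* Real and imaginary parts contribute [4 * M * (e / K)] each; the summand 1 covers [M = 0]. *)
pose K := 8 * M + 1; have K0 : 0 < K by rewrite /K; lra.
have eK : 0 < e / K by rewrite divr_gt0.
have f10 x : M < `|x| -> complex.Re (f x) = 0 by move=> /f0 ->.
have f20 x : M < `|x| -> complex.Im (f x) = 0 by move=> /f0 ->.
have [h1 [c1 b1 z1 i1 e1]] := continuous_approx M0 eK f1
  (fun x => le_trans (normc_Re _) (fM x)) f10.
have [h2 [c2 b2 z2 i2 e2]] := continuous_approx M0 eK f2
  (fun x => le_trans (normc_Im _) (fM x)) f20.
have ch : ccont (fun x => h1 x +i* h2 x) by [].
have k0 (x : R) : wsq (fun x => (h1 x +i* h2 x) - f x) x <=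
   4 * M * (`|complex.Re (f x) - h1 x| + `|complex.Im (f x) - h2 x|).
  rewrite /wsq -[leRHS]mul1r ler_pM ?om_ge0 ?sqr_ge0 ?om_le1//.
  rewrite normc_dist; apply: (@le_trans _ _ ((`|complex.Re (f x) - h1 x| + `|complex.Im (f x) - h2 x|) ^+ 2)).
    rewrite ler_sqr ?nnegrE ?addr_ge0 ?normc_ge0//.
    by apply: le_trans (normc_ReIm _) _; rewrite ReD ImD ReN ImN.
  have a1 := le_trans (normc_Re _) (fM x); have a2 := le_trans (normc_Im _) (fM x).
  have d1 := ler_normB (complex.Re (f x)) (h1 x).
  have d2 := ler_normB (complex.Im (f x)) (h2 x).
  rewrite expr2 ler_wpM2r ?addr_ge0//.
  have := b1 x; have := b2 x; lra.
have iG := @rintgZ _ _ R mu (4 * M) _ (@rintgD _ _ R mu _ _ i1 i2).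
have iw : rintg mu (wsq (fun x => (h1 x +i* h2 x) - f x)).
  apply: (@rintg_dom _ _ R mu _ _ _ iG).
    by apply: measurable_wsq; apply: cmeasB => //; exact: ccont_meas.
  by move=> x; rewrite ger0_norm ?wsq_ge0.
exists (fun x => h1 x +i* h2 x); split => //.
- move=> x; apply: le_trans (normc_ReIm _) _ => /=; have := b1 x; have := b2 x; lra.
- by move=> x xM; rewrite z1// z2.
apply: le_trans (@le_Rintegral _ _ R mu _ _ _ measurableT iw iG (fun x _ => k0 x)) _.
rewrite RintegralZl//; last exact: rintgD.
rewrite RintegralD//.
have h : e = K * (e / K) by field; rewrite lt0r_neq0.
have : 4 * M * (\int[mu]_x `|complex.Re (f x) - h1 x| +
   \int[mu]_x `|complex.Im (f x) - h2 x|) <= 4 * M * (e / K + e / K).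
  by rewrite ler_wpM2l ?mulr_ge0 ?lerD.
move=> /le_trans; apply; rewrite [leRHS]h /K; lra.
Qed.

(** A mollified function is no longer compactly supported, so the majorant is a multiple of the
    integrable weight [om s]. *)
Lemma gc_dense h (M e : R) : 0 <= M -> 0 < e -> ccont h ->
  (forall x, normc (h x) <= M) ->
  exists n, rintg mu (wsq (fun x => gc (sn R n) h x - h x)) /\
    \int[mu]_x wsq (fun x => gc (sn R n) h x - h x) x <= e.
Proof.
move=> M0 e0 ch hM; have mh := ccont_meas ch.
have iG := @rintgZ _ _ R mu ((2 * M) ^+ 2) _ (@rintg_om R s s1).
apply: (Rintegral_near0 e0 _ iG).
- by move=> n; apply: measurable_wsq; apply: cmeasB => //; apply: cmeas_gc => //; exact: sn_gt0.
- move=> n x; rewrite ger0_norm ?wsq_ge0// /wsq mulrC ler_wpM2r ?om_ge0//.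
  rewrite ler_sqr ?nnegrE ?normc_ge0 ?mulr_ge0//.
  apply: le_trans (normcB _ _) _.
  have := gc_bound x (sn_gt0 R n) mh hM; have := hM x; lra.
- move=> x; have h0 := gc_cvg mh hM (ccont_local x ch).
  rewrite -(mulr0 (om s x)); apply: cvgM; first exact: cvg_cst.
  by have h2 := cvgM h0 h0; rewrite mulr0 in h2; exact: h2.
Qed.

(** Truncation gives boundedness and compact support; the passage through a continuous function
    makes the mollification converge at every point. *)
Lemma weighted_density g (e : R) : 0 < e -> cmeas g -> rintg mu (wsq g) ->
  exists g1 (M d : R), [/\ 0 < d, cmeas g1, forall x, normc (g1 x) <= M,
    forall x, M < `|x| -> g1 x = 0 &
    rintg mu (wsq (fun x => gc d g1 x - g x)) /\
    \int[mu]_x wsq (fun x => gc d g1 x - g x) x <= e].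
Proof.
(* The number 10 is [2 + 2 * (2 + 2)], as [rintg_wsqD] is used twice. *)
move=> e0 mg ig; have e8 : 0 < e / 10 by rewrite divr_gt0.
have [n [iT eT]] := truncate_dense e8 mg ig.
have n0 : (0 : R) <= n%:R by [].
have mT := cmeas_truncate n mg.
have t0 x : n%:R < `|x| -> truncate n g x = 0.
  by move=> xn; rewrite /truncate ifF//; apply/negbTE; rewrite negb_and -ltNge xn.
have [h [ch hM h0 iC eC]] := continuous_dense n0 e8 mT (normc_truncate n g) t0.
have M0 : (0 : R) <= 2 * n%:R by rewrite mulr_ge0.
have [k [ik ek]] := gc_dense M0 e8 ch hM.
have mh := ccont_meas ch.
have mk : cmeas (gc (sn R k) h) by apply: cmeas_gc => //; exact: sn_gt0.
have [i1 l1] := rintg_wsqD (cmeasB mh mT) (cmeasB mT mg) iC iT.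
have [i2 l2] := rintg_wsqD (cmeasB mk mh) (cmeasD (cmeasB mh mT) (cmeasB mT mg)) ik i1.
(* A single constant dominates both the bound [2 * n] and the radius [n + 1] of the support. *)
exists h, (2 * n%:R + 1), (sn R k); split => //.
- exact: sn_gt0.
- by move=> x; apply: le_trans (hM x) _; rewrite lerDl.
- by move=> x xn; apply: h0; lra.
have E : (fun x => gc (sn R k) h x - g x) = (fun x => gc (sn R k) h x - h x +
    (h x - truncate n g x + (truncate n g x - g x))).
  by apply/funext => x; rewrite (addrA (h x - _)) subrK addrA subrK.
rewrite E; split; first exact: i2.
apply: le_trans l2 _; apply: le_trans (lerD (lexx _) (ler_wpM2l _ l1)) _ => //.
move: ek eC eT; move: (Rintegral _ _ _) (Rintegral _ _ _) (Rintegral _ _ _) => a1 a2 a3.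
lra.
Qed.

End WeightedDensity.

Section GaussianConvolution.
Variables (R : realType) (d : R).
Hypothesis d0 : 0 < d.
Notation mu := (@lebesgue_measure R).
Implicit Types (g : R -> R[i]) (x y : R).

Lemma gcD g1 g2 (M : R) y : cmeas g1 -> cmeas g2 -> (forall x, normc (g1 x) <= M) ->
  (forall x, normc (g2 x) <= M) ->
  gc d (fun x => g1 x + g2 x) y = gc d g1 y + gc d g2 y.
Proof.
move=> m1 m2 b1 b2; rewrite /gc -cintD; first by apply: eq_cint => x; rewrite mulrDr.
- exact: gc_intg b1.
- exact: gc_intg b2.
Qed.

Lemma gcZ g (M : R) (z : R[i]) y : cmeas g -> (forall x, normc (g x) <= M) ->
  gc d (fun x => z * g x) y = z * gc d g y.
Proof.
move=> mg bg; rewrite /gc -cintZ; first by apply: eq_cint => x; rewrite mulrCA.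
exact: gc_intg bg.
Qed.

End GaussianConvolution.

Section IntervalBounds.
Variable R : realType.
Notation mu := (@lebesgue_measure R).

Lemma Rintegral_ge_chi (F : R -> R) (a l c : R) : rintg mu F -> (forall x, 0 <= F x) ->
  0 <= l -> (forall x, a <= x <= a + l -> c <= F x) -> c * l <= \int[mu]_x F x.
Proof.
move=> iF F0 l0 Fc.
have ic : rintg mu (fun x => chi l (x - a)) by apply: rintg_shift; exact: rintg_chi.
have <- : \int[mu]_x (c * chi l (x - a)) = c * l.
  by rewrite RintegralZl// (Rintegral_shift a (rintg_chi l)) Rintegral_chi.
apply: (@le_Rintegral _ _ R mu _ _ _ measurableT (rintgZ c ic) iF) => x _.
rewrite /chi; case: ifPn => [/andP[h1 h2]|_]; last by rewrite mulr0.
by rewrite mulr1; apply: Fc; apply/andP; split; lra.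
Qed.

Lemma expR_decay_integral (N : R) : 0 < N -> \int[mu]_x expR (- (N^-1 * `|x|)) <= 4 * (pi * N).
Proof.
move=> N0; have [ih eh] := Rintegral_hw N0.
have Ni : 0 < N^-1 by rewrite invr_gt0.
rewrite -eh -RintegralZl//.
apply: (@le_Rintegral _ _ R mu _ _ _ measurableT (rintg_expRc Ni) (rintgZ 4 ih)) => x _.
by rewrite mulrC; exact: expR_hw.
Qed.

End IntervalBounds.

(** * The mollified frequency block *)

Section Bump.
Variable R : realType.
Notation mu := (@lebesgue_measure R).
Implicit Types (x y z : R).

Definition box (N x : R) : R := if (N <= `|x|) && (`|x| <= 2 * N) then 1 else 0.

Lemma box_ge0 N x : 0 <= box N x. Proof. by rewrite /box; case: ifP. Qed.

Lemma box_le1 N x : box N x <= 1. Proof. by rewrite /box; case: ifP. Qed.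

Lemma measurable_box N : measurable_fun setT (box N).
Proof.
by apply: measurable_fun_ifT => //; apply: measurable_and; apply: measurable_fun_ler.
Qed.

Lemma cmeas_box N : cmeas (fun x => (box N x)%:C : R[i]).
Proof. by apply: cmeas_real; exact: measurable_box. Qed.

Lemma normc_box N x : normc ((box N x)%:C : R[i]) <= 1.
Proof. by rewrite normc_real ger0_norm ?box_ge0 ?box_le1. Qed.

Lemma peetre x z : 1 + z ^+ 2 <= 2 * (1 + x ^+ 2) * (1 + (z - x) ^+ 2).
Proof.
have h : z ^+ 2 <= 2 * x ^+ 2 + 2 * (z - x) ^+ 2.
  have : 0 <= (x - (z - x)) ^+ 2 by exact: sqr_ge0.
  by nra.
have := mulr_ge0 (sqr_ge0 x) (sqr_ge0 (z - x)); nra.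
Qed.

Lemma bracket_expR x : 1 + x ^+ 2 <= expR (2 * `|x|).
Proof.
have h : 1 + `|x| <= expR `|x| by exact: expR_ge1Dx.
rewrite (_ : 2 * `|x| = `|x| + `|x|); last by ring.
rewrite expRD -(real_normK (num_real x)).
have := normr_ge0 x; nra.
Qed.

(** Peetre's inequality raised to the power [p], with the dependence on the distance in the
    exponential form that [gc_weight] accepts. *)
Lemma bracket_powR_expR (p : R) x z : 0 <= p ->
  (1 + z ^+ 2) `^ p <= 2 `^ p * (1 + x ^+ 2) `^ p * expR (2 * p * `|z - x|).
Proof.
move=> p0.
have h0 x' : 0 <= 1 + x' ^+ 2 :> R by rewrite addr_ge0 ?sqr_ge0.
have -> : expR (2 * p * `|z - x|) = expR (2 * `|z - x|) `^ p.
  by rewrite /powR gt_eqF ?expR_gt0// expRK; congr expR; ring.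
rewrite -!powRM ?mulr_ge0 ?expR_ge0//.
apply: ge0_ler_powR => //; rewrite ?nnegrE ?mulr_ge0 ?expR_ge0//.
apply: le_trans (peetre x z) _; rewrite ler_wpM2l ?mulr_ge0//.
exact: bracket_expR.
Qed.

Definition bump (d N x : R) : R := \int[mu]_z (gk d (z - x) * box N z).

Variables (d N : R).
Hypotheses (d0 : 0 < d) (N1 : 1 <= N).

Lemma rintg_bump x : rintg mu (fun z => gk d (z - x) * box N z).
Proof.
apply: (@rintg_dom _ _ R mu _ _ _ (rintg_gk_shift x d0)).
- by apply: measurable_funM; [exact: (measurable_gk_shift x d0)|exact: measurable_box].
- move=> z; have g0 := gk_ge0 d0 (z - x).
  rewrite ger0_norm; last by apply: mulr_ge0 => //; exact: box_ge0.
  by rewrite ler_piMr// box_le1.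
Qed.

Lemma gc_box x : gc d (fun z => (box N z)%:C) x = (bump d N x)%:C.
Proof.
rewrite /gc -(cint_real (rintg_bump x)); apply: eq_cint => z.
by apply: complexP; rewrite ?ReM ?ImM /= !(mul0r, mulr0, subr0, addr0).
Qed.

Lemma bump_ge0 x : 0 <= bump d N x.
Proof. by apply: Rintegral_ge0 => z _; apply: mulr_ge0; [exact: gk_ge0|exact: box_ge0]. Qed.

Lemma bump_le1 x : bump d N x <= 1.
Proof.
have := gc_bound x d0 (cmeas_box N) (normc_box N).
by rewrite gc_box normc_real ger0_norm ?bump_ge0.
Qed.

(** The interval of radius 1 about [x] lies in the block, and there the Gaussian is at least
    [gk d 1]. *)
Lemma bump_lower x : N + 1 <= `|x| -> `|x| <= 2 * N - 1 -> 2 * gk d 1 <= bump d N x.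
Proof.
move=> x1 x2; rewrite mulrC.
apply: (@Rintegral_ge_chi _ _ (x - 1) 2) => //.
- exact: rintg_bump.
- by move=> z; apply: mulr_ge0; [exact: gk_ge0|exact: box_ge0].
move=> z hz; have zx : `|z - x| <= 1 by rewrite ler_norml; lra.
have h1 : `|z| <= `|z - x| + `|x| by rewrite -{1}(subrK x z) ler_normD.
have h2 : `|x| <= `|z - x| + `|z| by rewrite distrC -{1}(subrK z x) ler_normD.
have -> : box N z = 1 by rewrite /box ifT//; apply/andP; split; lra.
rewrite mulr1 /gk ler_wpM2l//.
  by rewrite invr_ge0 mulr_ge0 ?(ltW d0)// (ltW (@sqrt2pi_gt0 R)).
rewrite ler_expR lerN2 ler_wpM2r//.
  by rewrite invr_ge0 mulr_ge0// sqr_ge0.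
by rewrite -(real_normK (num_real (z - x))) ler_sqr ?nnegrE.
Qed.

Definition bump_cst (s : R) : R :=
  expR 2 * 2 `^ (- s / 2) * (2 * expR ((1 - s) ^+ 2 * d ^+ 2)).

(** On the block [N^s (1 + z^2)^(- s / 2) >= 1] and [exp (2 - |z| / N) >= 1]. Passing from [z] to
    [x] costs [exp ((1 - s) |z - x|)], which [gc_weight] absorbs. The middle factor is the inverse
    of the Sobolev weight, so that in [H^s] the bump has height [N^s]; the last factor supplies
    integrability. *)
Lemma bump_upper s x : s <= 0 -> bump d N x <=
  bump_cst s * (N `^ s * (1 + x ^+ 2) `^ (- s / 2) * expR (- (N^-1 * `|x|))).
Proof.
move=> s0; have N0 : 0 < N by exact: lt_le_trans N1.
have p0 : 0 <= - s / 2 by rewrite divr_ge0// oppr_ge0.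
pose H := expR 2 * 2 `^ (- s / 2) * (N `^ s * (1 + x ^+ 2) `^ (- s / 2) * expR (- (N^-1 * `|x|))).
have H0 : 0 <= H by rewrite !mulr_ge0 ?expR_ge0 ?powR_ge0.
have c_0 : 0 <= 1 - s by lra.
have := @gc_weight _ d _ H (1 - s) x d0 (cmeas_box N) c_0 H0 _.
rewrite gc_box normc_real ger0_norm ?bump_ge0// => h.
rewrite /bump_cst -mulrA [X in _ <= _ * X]mulrC mulrA; apply: h => z.
rewrite normc_real ger0_norm ?box_ge0// /box; case: ifPn => [/andP[z1 z2]|_]; last first.
  by rewrite mulr_ge0 ?expR_ge0.
have b1 : 1 <= N `^ s * (1 + z ^+ 2) `^ (- s / 2).
  have h2 : (N ^+ 2) `^ (- s / 2) <= (1 + z ^+ 2) `^ (- s / 2).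
    apply: ge0_ler_powR => //; rewrite ?nnegrE ?addr_ge0 ?sqr_ge0//.
    rewrite -(real_normK (num_real z)); apply: le_trans (_ : `|z| ^+ 2 <= _); last by rewrite lerDr.
    by rewrite ler_sqr ?nnegrE ?(ltW N0).
  apply: le_trans (ler_wpM2l (powR_ge0 _ _) h2).
  rewrite -powR_mulrn ?(ltW N0)// -powRrM -powRD; last by apply/implyP => _; rewrite gt_eqF.
  by rewrite (_ : s + _ = 0) ?powRr0//; field.
have b2 : 1 <= expR 2 * expR (- (N^-1 * `|x|)) * expR `|z - x|.
  rewrite -!expRD -[leLHS]expR0 ler_expR.
  have h1 : `|x| <= `|z - x| + `|z| by rewrite distrC -{1}(subrK z x) ler_normD.
  have h3 : N^-1 * `|x| <= `|z - x| + 2.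
    rewrite mulrC ler_pdivrMr//; apply: le_trans h1 _; rewrite mulrDl lerD//.
    by rewrite ler_peMr.
  lra.
have b3 := bracket_powR_expR x z p0.
apply: (@le_trans _ _ (N `^ s * (2 `^ (- s / 2) * (1 + x ^+ 2) `^ (- s / 2) * expR (2 * (- s / 2) * `|z - x|)) *
   (expR 2 * expR (- (N^-1 * `|x|)) * expR `|z - x|))).
  rewrite -[leLHS]mulr1; apply: ler_pM => //.
  by apply: le_trans b1 _; rewrite ler_wpM2l ?powR_ge0.
rewrite [X in _ <= _ * X](_ : _ = expR (2 * (- s / 2) * `|z - x|) * expR `|z - x|); last first.
  by rewrite -expRD; congr expR; field.
by rewrite le_eqVlt; apply/orP; left; apply/eqP; rewrite /H; ring.
Qed.

Lemma measurable_bump : measurable_fun setT (bump d N).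
Proof.
have [mb _] : cmeas (fun x => (bump d N x)%:C : R[i]).
  have -> : (fun x => (bump d N x)%:C) = gc d (fun z => (box N z)%:C).
    by apply/funext => x; rewrite gc_box.
  exact: (cmeas_gc d0 (cmeas_box N)).
exact: mb.
Qed.

Lemma integrable_bump : rintg mu (bump d N).
Proof.
have Ni : 0 < N^-1 by rewrite invr_gt0 (lt_le_trans ltr01).
have iE := @rintgZ _ _ R mu (bump_cst 0) _ (rintg_expRc Ni).
apply: (@rintg_dom _ _ R mu _ _ measurable_bump iE) => x; rewrite ger0_norm ?bump_ge0//.
by have := bump_upper x (lexx 0); rewrite oppr0 mul0r !powRr0 !mul1r.
Qed.

End Bump.

Lemma bump_cst_ge0 (R : realType) (d s : R) : 0 <= bump_cst d s.
Proof. by apply: mulr_ge0; apply: mulr_ge0; rewrite ?expR_ge0 ?powR_ge0. Qed.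

(** * The second iterate *)

Section DuhamelError.
Variable R : realType.
Notation mu := (@lebesgue_measure R).
Implicit Types (x y r : R).

(** Telescoping: replace [e] by [p * a], then [f] by [q * c], then the total phase [m * p * q] by 1,
    and finally [a * c] by the model [z]. *)
Lemma product_error (m p q a c e f z : R[i]) : normc m = 1 -> normc p = 1 ->
  normc (m * (e * f) - z) <= normc (e - p * a) * normc f +
    normc a * normc (f - q * c) + normc (m * p * q - 1) * (normc a * normc c) +
    normc (a * c - z).
Proof.
move=> m1 p1.
have -> : m * (e * f) - z = m * ((e - p * a) * f) + m * (p * (a * (f - q * c))) +
   (m * p * q - 1) * (a * c) + (a * c - z) by ring.
apply: le_trans (normcD _ _) _; rewrite lerD2r.
apply: le_trans (normcD _ _) _; apply: lerD; last by rewrite !normcM.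
apply: le_trans (normcD _ _) _; rewrite normcM m1 mul1r normcM lerD2l.
by rewrite normcM m1 mul1r normcM p1 mul1r normcM.
Qed.

(** The degree 4 in [y], instead of 5, is the cancellation between [y] and [x - y]. The powers of
    [x] are harmless, as the test function decays like a Gaussian. *)
Lemma phase_bound (b T r x y : R) : `|b| <= 1 -> 0 <= r <= T ->
  `|(T - r) * (x ^+ 5 + b * x ^+ 3) + r * (y ^+ 5 + b * y ^+ 3) +
    r * ((x - y) ^+ 5 + b * (x - y) ^+ 3)| <=
  40 * T * ((1 + `|x|) ^+ 5 * (1 + `|y|) ^+ 4).
Proof.
move=> b1 /andP[r0 rT].
set P := (1 + `|x|) ^+ 5 * (1 + `|y|) ^+ 4.
have x1 : 1 <= 1 + `|x| by rewrite lerDl.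
have y1 : 1 <= 1 + `|y| by rewrite lerDl.
have mono (i j : nat) : (i <= 5)%N -> (j <= 4)%N -> `|x| ^+ i * `|y| ^+ j <= P.
  move=> i5 j4; apply: ler_pM; rewrite ?exprn_ge0//.
  - apply: (@le_trans _ _ ((1 + `|x|) ^+ i)); last by rewrite ler_weXn2l.
    by rewrite lerXn2r ?nnegrE ?addr_ge0// lerDr.
  - apply: (@le_trans _ _ ((1 + `|y|) ^+ j)); last by rewrite ler_weXn2l.
    by rewrite lerXn2r ?nnegrE ?addr_ge0// lerDr.
have sm (c : R) i j : (i <= 5)%N -> (j <= 4)%N -> `|c * (x ^+ i * y ^+ j)| <= `|c| * P.
  by move=> i5 j4; rewrite normrM ler_wpM2l// normrM !normrX mono.
have bm (c : R) i j : (i <= 5)%N -> (j <= 4)%N -> `|c * b * (x ^+ i * y ^+ j)| <= `|c| * P.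
  move=> i5 j4; apply: le_trans (sm _ _ _ i5 j4) _; rewrite normrM.
  by rewrite ler_wpM2r ?ler_piMr// mulr_ge0// exprn_ge0// addr_ge0.
have P0 : 0 <= P by rewrite mulr_ge0// exprn_ge0// addr_ge0.
pose X := x ^+ 5 + b * x ^+ 3.
pose Y := y ^+ 5 + b * y ^+ 3 + ((x - y) ^+ 5 + b * (x - y) ^+ 3).
have hX : `|X| <= 2 * P.
  have h1 := sm 1 5 0 isT isT; have h2 := bm 1 3 0 isT isT.
  rewrite !expr0 !mulr1 !mul1r !normr1 !mul1r in h1 h2.
  by apply: le_trans (ler_normD _ _) _; lra.
have hY : `|Y| <= 38 * P.
  (* The terms [y ^+ 5] and [y ^+ 3] have dropped out. The remaining coefficients add up to 38 in
     absolute value, which with the 2 of [X] makes 40. *)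
  have -> : Y = 1 * (x ^+ 5 * y ^+ 0) + (- 5) * (x ^+ 4 * y ^+ 1) +
     10 * (x ^+ 3 * y ^+ 2) + (- 10) * (x ^+ 2 * y ^+ 3) + 5 * (x ^+ 1 * y ^+ 4) +
     1 * b * (x ^+ 3 * y ^+ 0) + (- 3) * b * (x ^+ 2 * y ^+ 1) + 3 * b * (x ^+ 1 * y ^+ 2).
    by rewrite /Y; ring.
  have h1 := sm 1 5 0 isT isT; have h2 := sm (- 5) 4 1 isT isT.
  have h3 := sm 10 3 2 isT isT; have h4 := sm (- 10) 2 3 isT isT.
  have h5 := sm 5 1 4 isT isT; have h6 := bm 1 3 0 isT isT.
  have h7 := bm (- 3) 2 1 isT isT; have h8 := bm 3 1 2 isT isT.
  have tr (u w p q : R) : `|u| <= p -> `|w| <= q -> `|u + w| <= p + q.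
    by move=> up wq; apply: le_trans (ler_normD _ _) (lerD up wq).
  have h := tr _ _ _ _ (tr _ _ _ _ (tr _ _ _ _ (tr _ _ _ _ (tr _ _ _ _
    (tr _ _ _ _ (tr _ _ _ _ h1 h2) h3) h4) h5) h6) h7) h8.
  apply: le_trans h _; rewrite !normrN !normr1 !normr_nat; lra.
have -> : (T - r) * (x ^+ 5 + b * x ^+ 3) + r * (y ^+ 5 + b * y ^+ 3) +
    r * ((x - y) ^+ 5 + b * (x - y) ^+ 3) = (T - r) * X + r * Y by rewrite /X /Y; ring.
apply: le_trans (ler_normD _ _) _; rewrite !normrM (ger0_norm r0) (@ger0_norm _ (T - r)) ?subr_ge0//.
have T0 : 0 <= T by exact: le_trans rT.
have h1 : (T - r) * `|X| <= T * (2 * P) by apply: ler_pM => //; lra.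
have h2 : r * `|Y| <= T * (38 * P) by apply: ler_pM.
by apply: le_trans (lerD h1 h2) _; rewrite le_eqVlt; apply/orP; left; apply/eqP; ring.
Qed.

(** The fourth power of [1 + |y| <= N (1 + u) <= 4 N exp (u / 4)], where [u = |y| / N]. *)
Lemma quartic_expR (N y : R) : 1 <= N ->
  (1 + `|y|) ^+ 4 <= 256 * N ^+ 4 * expR (N^-1 * `|y|).
Proof.
move=> N1; have N0 : 0 < N by exact: lt_le_trans N1.
set u := N^-1 * `|y|.
have u0 : 0 <= u by rewrite mulr_ge0// invr_ge0 ltW.
have e1 : 1 + `|y| <= N * (4 * expR (u / 4)).
  have h1 : 1 + u / 4 <= expR (u / 4) by exact: expR_ge1Dx.
  have h2 : 1 + `|y| <= N * (1 + u).
    by rewrite /u mulrDr mulr1 mulrA mulfV ?gt_eqF// mul1r lerD2r.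
  apply: le_trans h2 _; rewrite ler_wpM2l ?(ltW N0)//; lra.
have -> : expR u = expR (u / 4) ^+ 4 by rewrite -expRM_natl; congr expR; field.
rewrite (_ : 256 * N ^+ 4 * expR (u / 4) ^+ 4 = (N * (4 * expR (u / 4))) ^+ 4); last by ring.
by rewrite lerXn2r ?nnegrE ?addr_ge0 ?mulr_ge0 ?expR_ge0// ltW.
Qed.

End DuhamelError.

(** * Comparison of the Duhamel term with its model *)

Section DuhamelMainTerm.
Variable R : realType.
Notation mu := (@lebesgue_measure R).
Implicit Types (x y r : R).

Variables b N T A B0 B G1 : R.
Hypotheses (b1 : `|b| <= 1) (N1 : 1 <= N) (T0 : 0 < T) (A0 : 0 <= A) (B00 : 0 <= B0).
Hypothesis G10 : 0 <= G1.
Variables (v0 : R -> R[i]) (v : R -> R -> R[i]) (w : R -> R).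
Hypothesis gv : good N T B v.
Hypothesis fixv : forall t x, v t x = Phi b T v0 v t x.
Hypothesis cv0 : ccont v0.
Hypothesis hv0 : forall x, normc (v0 x) <= B0 * W N T 0 x.
Hypotheses (w0 : forall x, 0 <= w x) (w1 : forall x, w x <= 1) (iw : rintg mu w).
Hypothesis hG : forall x, normc (v0 x - (A * w x)%:C) <= G1 * expR (- `|x|).

Definition selfconv x : R := \int[mu]_y (w y * w (x - y)).

(** The terms account for the nonlinear correction to the free evolution, for the phases, and for
    the replacement of the data by [A * w]. The last error decays at rate 1 instead of [1 / N],
    hence the absence of the factor [N]. *)
Definition duh_err : R := 4 * pi * N *
    (kappa N T * (B * B) * (B + B0) + 40 * T * (256 * N ^+ 4) * B0 ^+ 2) +
  4 * pi * G1 * (B0 + A).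

Let N0 : 0 < N. Proof. exact: lt_le_trans N1. Qed.
Let Ni : 0 < N^-1. Proof. by rewrite invr_gt0. Qed.
Let k := kappa N T * (B * B).
Let B_0 : 0 <= B. Proof. exact: (good_B0 T0 gv). Qed.
Let k0 : 0 <= k. Proof. by apply: mulr_ge0; [exact: kappa_ge0|exact: mulr_ge0]. Qed.

Lemma selfconv_intg x : rintg mu (fun y => w y * w (x - y)).
Proof.
have mw := rintg_meas iw; have iw' := rintg_reflection x iw.
apply: (@rintg_dom _ _ R mu _ w) => //.
  by apply: measurable_funM => //; exact: (rintg_meas iw').
by move=> y; rewrite ger0_norm ?mulr_ge0// ler_piMr.
Qed.

Let bE (x : R) : expR (- (N^-1 * `|x|)) <= 1.
Proof. by rewrite -[leRHS]expR0 ler_expR oppr_le0 mulr_ge0// ltW. Qed.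

(** At time 0 the rate is [2 / N]; the surplus over [1 / N] pays for the quartic growth of the phase
    in [quartic_expR]. *)
Let v0_exp x : normc (v0 x) <= B0 * expR (- (2 * (N^-1 * `|x|))).
Proof.
apply: le_trans (hv0 x) _; rewrite ler_wpM2l// /W.
rewrite (_ : alpha N T 0 * `|x| = 2 * (N^-1 * `|x|)); last first.
  by rewrite /alpha mul0r subr0 mulrA.
by rewrite ler_piMr ?expR_ge0// hw_le1.
Qed.

Let v0_exp1 x : normc (v0 x) <= B0 * expR (- (N^-1 * `|x|)).
Proof.
apply: le_trans (v0_exp x) _; rewrite ler_wpM2l// ler_expR lerN2.
by rewrite ler_peMl ?ler1n// mulr_ge0// ltW.
Qed.

Let v0_bnd x : normc (v0 x) <= B0.
Proof. by apply: le_trans (v0_exp1 x) _; rewrite ler_piMr. Qed.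

Let free_err r x : 0 <= r <= T ->
  normc (v r x - kawahara_multiplier b r x * v0 x) <= k * expR (- (N^-1 * `|x|)).
Proof.
move=> rT; have := Phi_free_bound b N0 T0 v0 r x gv.
rewrite -fixv chi_in// !mul1r => /le_trans; apply.
by rewrite ler_wpM2l//; apply: W_le_exp => //; case/andP: rT.
Qed.

Let F x y : R := (k * (B + B0) + 40 * T * (256 * N ^+ 4) * B0 ^+ 2 * (1 + `|x|) ^+ 5) *
    expR (- (N^-1 * `|y|)) + G1 * B0 * expR (- (1 * `|y|)) +
    G1 * A * expR (- (1 * `|x - y|)).

Let iE1 : rintg mu (fun y : R => expR (- (1 * `|y|))) := rintg_expRc ltr01.

Let iF x : rintg mu (F x).
Proof.
have iE := rintg_expRc Ni.
apply: rintgD; first apply: rintgD.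
- exact: rintgZ.
- exact: rintgZ.
- by apply: rintgZ; exact: (rintg_reflection x iE1).
Qed.

Let intF x : \int[mu]_y F x y <= duh_err * (1 + `|x|) ^+ 5.
Proof.
have iE := rintg_expRc Ni; have iE' := rintg_reflection x iE1.
have x5 : 1 <= (1 + `|x|) ^+ 5 by rewrite exprn_ege1// lerDl.
rewrite RintegralD//; last 2 first.
- by apply: (@rintgD _ _ R mu); exact: rintgZ.
- exact: rintgZ.
rewrite RintegralD//; [|exact: rintgZ..].
rewrite !RintegralZl// (Rintegral_reflection x iE1).
have e1 := expR_decay_integral N0; have e2 := expR_decay_integral (@ltr01 R).
rewrite invr1 mulr1 in e2.
move: e1 e2; move: (Rintegral _ _ _) (Rintegral _ _ _) => I2 I1 e1 e2.
set X := (1 + `|x|) ^+ 5 in x5 *.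
pose D := 40 * T * (256 * N ^+ 4) * B0 ^+ 2.
have D0 : 0 <= D.
  apply: mulr_ge0; last exact: sqr_ge0.
  by apply: mulr_ge0; apply: mulr_ge0; rewrite ?ler0n ?exprn_ge0 ?(ltW N0) ?(ltW T0).
have kB : 0 <= k * (B + B0) by rewrite mulr_ge0// addr_ge0.
have X0 : 0 <= X by exact: le_trans x5.
have p0 := pi_ge0 R.
have h1 : (k * (B + B0) + D * X) * I1 <= ((k * (B + B0) + D) * X) * (4 * (pi * N)).
  apply: (@le_trans _ _ ((k * (B + B0) + D * X) * (4 * (pi * N)))).
    by rewrite ler_wpM2l// addr_ge0// mulr_ge0.
  rewrite ler_wpM2r ?mulr_ge0 ?(ltW N0)// mulrDl lerD2r.
  by rewrite ler_peMr.
have h2 : G1 * B0 * I2 <= G1 * B0 * (4 * pi) by rewrite ler_wpM2l ?mulr_ge0.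
have h3 : G1 * A * I2 <= G1 * A * (4 * pi) by rewrite ler_wpM2l ?mulr_ge0.
have h4 : G1 * (B0 + A) * (4 * pi) <= G1 * (B0 + A) * (4 * pi) * X.
  by rewrite ler_peMr//; apply: mulr_ge0; apply: mulr_ge0 => //; exact: addr_ge0.
apply: (@le_trans _ _ (((k * (B + B0) + D) * X) * (4 * (pi * N)) + G1 * (B0 + A) * (4 * pi) * X)).
  apply: le_trans (lerD (lerD h1 h2) h3) _; rewrite -addrA lerD2l.
  by apply: le_trans h4; rewrite le_eqVlt; apply/orP; left; apply/eqP; ring.
by rewrite le_eqVlt /duh_err -/k -/D; apply/orP; left; apply/eqP; ring.
Qed.

Let phase r x y : 0 <= r <= T ->
  normc (kawahara_multiplier b (T - r) x * kawahara_multiplier b r y *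
    kawahara_multiplier b r (x - y) - 1) <=
  40 * T * ((1 + `|x|) ^+ 5 * (1 + `|y|) ^+ 4).
Proof.
move=> rT; rewrite /kawahara_multiplier -!cisD.
exact: le_trans (normc_cisB1 _) (phase_bound x y b1 rT).
Qed.

Let pointwise r x y : 0 <= r <= T ->
  normc (kawahara_multiplier b (T - r) x * (v r y * v r (x - y)) -
    (A ^+ 2 * (w y * w (x - y)))%:C) <= F x y.
Proof.
move=> rT.
apply: le_trans (product_error (kawahara_multiplier b r (x - y)) (v0 y) (v0 (x - y)) _ _ _
  (normc_mult b (T - r) x) (normc_mult b r y)) _.
have h1 := free_err y rT; have h2 := free_err (x - y) rT.
have h3 := v0_exp y; have h3' := v0_exp1 y; have h4 := v0_bnd (x - y).
have h5 := good_bnd N0 T0 gv r (x - y).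
have h6 := phase x y rT; have h7 := quartic_expR y N1.
have h8 : normc (v0 y * v0 (x - y) - (A ^+ 2 * (w y * w (x - y)))%:C) <=
    G1 * B0 * expR (- (1 * `|y|)) + G1 * A * expR (- (1 * `|x - y|)).
  have -> : v0 y * v0 (x - y) - (A ^+ 2 * (w y * w (x - y)))%:C =
     (v0 y - (A * w y)%:C) * v0 (x - y) + (A * w y)%:C * (v0 (x - y) - (A * w (x - y))%:C).
    apply: complexP; rewrite ?(ReD, ReM, ImD, ImM, ReN, ImN) /=; ring.
  apply: le_trans (normcD _ _) _; rewrite !normcM; apply: lerD.
    rewrite mul1r [leRHS]mulrAC; by apply: ler_pM; rewrite ?normc_ge0.
  rewrite normc_real ger0_norm ?mulr_ge0// mul1r [leRHS]mulrAC [leRHS]mulrC.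
  apply: ler_pM; rewrite ?normc_ge0 ?mulr_ge0//.
  by rewrite ler_piMr.
move: h1 h2 h3 h3' h4 h5 h6 h7 h8.
move: (normc_ge0 (v r y - kawahara_multiplier b r y * v0 y))
  (normc_ge0 (v r (x - y) - kawahara_multiplier b r (x - y) * v0 (x - y)))
  (normc_ge0 (v r (x - y))) (normc_ge0 (v0 y)) (normc_ge0 (v0 (x - y)))
  (normc_ge0 (kawahara_multiplier b (T - r) x * kawahara_multiplier b r y *
    kawahara_multiplier b r (x - y) - 1)).
move: (normc (v0 y * v0 (x - y) - (A ^+ 2 * (w y * w (x - y)))%:C)) => n7.
move: (normc (kawahara_multiplier b (T - r) x * kawahara_multiplier b r y *
    kawahara_multiplier b r (x - y) - 1)) => n6.
move: (normc (v r y - kawahara_multiplier b r y * v0 y)) => n1.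
move: (normc (v r (x - y) - kawahara_multiplier b r (x - y) * v0 (x - y))) => n2.
move: (normc (v r (x - y))) (normc (v0 y)) (normc (v0 (x - y))) => n3 n4 n5.
move=> p1 p2 p3 p4 p5 p6 h1 h2 h3 h3' h4 h5 h6 h7 h8.
rewrite /F -[leRHS]addrA; apply: lerD => //.
set u := N^-1 * `|y| in h1 h3 h3' h7 *.
set E := expR (- u) in h1 h3' *.
have E0 : 0 <= E by exact: expR_ge0.
have c1 : n1 * n3 <= k * B * E by rewrite mulrAC; apply: ler_pM.
have n2k : n2 <= k by apply: le_trans h2 _; rewrite ler_piMr.
have c2 : n4 * n2 <= k * B0 * E.
  by apply: le_trans (ler_pM p4 p2 h3' n2k) _; rewrite mulrC mulrA.
set X := (1 + `|x|) ^+ 5 in h6 *.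
have X0 : 0 <= X by rewrite exprn_ge0// addr_ge0.
have c3 : n6 * (n4 * n5) <= 40 * T * (256 * N ^+ 4) * B0 ^+ 2 * X * E.
  have a1 : n6 <= 40 * T * (X * (256 * N ^+ 4 * expR u)).
    apply: le_trans h6 _; apply: ler_wpM2l; first by rewrite mulr_ge0// ltW.
    by apply: ler_wpM2l.
  have a2 := ler_pM p6 (mulr_ge0 p4 p5) a1 (ler_pM p4 p5 h3 h4).
  apply: le_trans a2 _.
  have -> : expR (- (2 * u)) = E * E by rewrite /E -expRD; congr expR; ring.
  have eu : expR u * E = 1 by rewrite -expRD subrr expR0.
  rewrite le_eqVlt; apply/orP; left; apply/eqP.
  rewrite (_ : 40 * T * (X * (256 * N ^+ 4 * expR u)) * (B0 * (E * E) * B0) =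
     40 * T * (256 * N ^+ 4) * B0 ^+ 2 * X * E * (expR u * E)); last by ring.
  by rewrite eu mulr1.
apply: le_trans (lerD (lerD c1 c2) c3) _.
by rewrite le_eqVlt; apply/orP; left; apply/eqP; ring.
Qed.

Lemma conv_error r x : 0 <= r <= T ->
  normc (kawahara_multiplier b (T - r) x * Q v r x - (A ^+ 2 * selfconv x)%:C) <=
    duh_err * (1 + `|x|) ^+ 5.
Proof.
move=> rT; have [_ cv _] := gv; have mv := ccont_meas (cv r).
have cvv : cintg mu (fun y => v r y * v r (x - y)).
  apply: (@cintgM_bnd _ _ R mu _ _ B) => //.
  - by move=> y; exact: (good_bnd N0 T0 gv).
  - exact: (cintg_reflection x (good_cintg N0 T0 r gv)).
have iw2 : rintg mu (fun y => A ^+ 2 * (w y * w (x - y))).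
  by apply: rintgZ; exact: selfconv_intg.
rewrite /Q /conv -cintZ// /selfconv -RintegralZl//; last exact: selfconv_intg.
rewrite -(cint_real iw2) -cintB; [|exact: cintgZ|exact: cintg_real].
apply: le_trans (intF x); apply: normc_cint_le.
- by apply: cmeasB; [exact: cintg_meas (cintgZ _ cvv)|exact: cintg_meas (cintg_real iw2)].
- exact: iF.
- by move=> y; exact: pointwise.
Qed.

(** The model in [conv_error] does not depend on [r], so that integration over [[0, T]] multiplies
    model and error by [T]. *)
Lemma Duh_error x :
  normc (Duh b (Q v) T x - (T * (A ^+ 2 * selfconv x))%:C) <=
    T * (duh_err * (1 + `|x|) ^+ 5).
Proof.
have [mv cv _] := gv.
pose z := A ^+ 2 * selfconv x.
have iz : rintg mu (fun r => chi T r * z) by under eq_fun do rewrite mulrC; apply: rintgZ; exact: rintg_chi.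
have eT : \int[mu]_r chi T r = T by rewrite Rintegral_chi// ltW.
have -> : (T * z)%:C = cint mu (fun r => (chi T r * z)%:C).
  by rewrite cint_real// RintegralZr ?eT//; exact: rintg_chi.
rewrite /Duh -cintB; [|exact: (good_Duh_intg b N0 T0 x gv gv)|exact: cintg_real].
have -> : T * (duh_err * (1 + `|x|) ^+ 5) = \int[mu]_r (duh_err * (1 + `|x|) ^+ 5 * chi T r).
  by rewrite RintegralZl ?eT 1?mulrC//; exact: rintg_chi.
apply: normc_cint_le.
- apply: cmeasB; last exact: cintg_meas (cintg_real iz).
  exact: cintg_meas (good_Duh_intg b N0 T0 x gv gv (lexx T)).
- by apply: rintgZ; exact: rintg_chi.
move=> r; have [rT|->] := chi_cases T r; last first.
  by rewrite !mul0r !mulr0 subrr (normc_real 0) normr0.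
rewrite chi_in// !mul1r mulr1; exact: conv_error.
Qed.

End DuhamelMainTerm.

(** * The test function *)

Section TestFunction.
Variable R : realType.
Notation mu := (@lebesgue_measure R).
Implicit Types x y : R.

(** The factor [x] matches the one in front of the Duhamel integral: in the pairing the model is
    integrated against the nonnegative [x ^+ 2 * ge 1 x], and no cancellation occurs. *)
Definition psi x : R[i] := (x * ge 1 x)%:C.

Lemma rintg_expR_ge (c : R) : 0 <= c -> rintg mu (fun x => expR (c * `|x|) * ge 1 x).
Proof.
move=> c_0; have -> : (fun x => expR (c * `|x|) * ge 1 x) =
    fun x => (1 * c0 R)^-1 * (expR (c * `|x|) * gk 1 x).
  by apply/funext => x; rewrite (ge_gk ltr01) invr1 mulrCA.
by apply: rintgZ; exact: rintg_gk_expR.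
Qed.

Lemma one_norm_expR n x : (1 + `|x|) ^+ n <= expR (n%:R * `|x|).
Proof.
rewrite expRM_natl lerXn2r ?nnegrE ?addr_ge0 ?expR_ge0//; exact: expR_ge1Dx.
Qed.

Lemma measurable_ge : measurable_fun setT (ge 1 : R -> R).
Proof. exact: rintg_meas (@rintg_ge R 1 ltr01). Qed.

Lemma rintg_ge_poly (n : nat) (f : R -> R) : measurable_fun setT f ->
  (forall x, `|f x| <= (1 + `|x|) ^+ n) -> rintg mu (fun x => f x * ge 1 x).
Proof.
move=> mf fn; apply: (@rintg_dom _ _ R mu _ _ _ (rintg_expR_ge (ler0n R n))).
  by apply: measurable_funM => //; exact: measurable_ge.
move=> x; rewrite normrM (ger0_norm (ge_ge0 _ _)) ler_wpM2r ?ge_ge0//.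
exact: le_trans (fn x) (one_norm_expR n x).
Qed.

End TestFunction.

(** * Lower bound for the pairing *)

Section PairingLower.
Variable R : realType.
Notation mu := (@lebesgue_measure R).
Implicit Types (x y r : R).

Variables b N T A B0 B G1 : R.
Hypotheses (b1 : `|b| <= 1) (N1 : 1 <= N) (T0 : 0 < T) (A0 : 0 <= A) (B00 : 0 <= B0).
Hypothesis G10 : 0 <= G1.
Variables (v0 : R -> R[i]) (v : R -> R -> R[i]) (w : R -> R).
Hypothesis gv : good N T B v.
Hypothesis fixv : forall t x, v t x = Phi b T v0 v t x.
Hypothesis cv0 : ccont v0.
Hypothesis hv0 : forall x, normc (v0 x) <= B0 * W N T 0 x.
Hypotheses (w0 : forall x, 0 <= w x) (w1 : forall x, w x <= 1) (iw : rintg mu w).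
Hypothesis hG : forall x, normc (v0 x - (A * w x)%:C) <= G1 * expR (- `|x|).

Let N0 : 0 < N. Proof. exact: lt_le_trans N1. Qed.
Let err := duh_err N T A B0 B G1.

Lemma selfconv_ge0 x : 0 <= selfconv w x.
Proof. by apply: Rintegral_ge0 => y _; rewrite mulr_ge0. Qed.

Lemma selfconv_le x : selfconv w x <= \int[mu]_y w y.
Proof.
apply: (@le_Rintegral _ _ R mu _ _ _ measurableT (selfconv_intg w0 w1 iw x) iw) => y _.
by rewrite ler_piMr.
Qed.

Lemma measurable_selfconv : measurable_fun setT (selfconv w).
Proof.
have mw : cmeas (fun x => (w x)%:C : R[i]) by apply: cmeas_real; exact: rintg_meas iw.
have [h _] := cmeas_conv mw mw.
rewrite (_ : selfconv w = fun x => complex.Re (conv (fun y => (w y)%:C) (fun y => (w y)%:C) x))//.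
apply/funext => x; apply: eq_Rintegral => y _.
by rewrite ReM /= mul0r subr0.
Qed.

Lemma rintg_selfconv_ge : rintg mu (fun x => x ^+ 2 * ge 1 x * selfconv w x).
Proof.
have i2 : rintg mu (fun x : R => x ^+ 2 * ge 1 x).
  apply: (@rintg_ge_poly _ 2); first exact: measurable_funX.
  by move=> x; rewrite normrX lerXn2r ?nnegrE ?addr_ge0// lerDr.
apply: (@rintg_dom _ _ R mu _ _ _ (rintgZ (\int[mu]_y w y) i2)).
  apply: measurable_funM; last exact: measurable_selfconv.
  exact: (rintg_meas i2).
move=> x; have p0 : 0 <= x ^+ 2 * ge 1 x by apply: mulr_ge0; [exact: sqr_ge0|exact: ge_ge0].
rewrite ger0_norm; last by apply: mulr_ge0 => //; exact: selfconv_ge0.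
by rewrite mulrC; apply: ler_wpM2r => //; exact: selfconv_le.
Qed.

Definition main_term : R := \int[mu]_x (x ^+ 2 * ge 1 x * selfconv w x).

Definition moment7 : R := \int[mu]_x (x ^+ 2 * (1 + `|x|) ^+ 5 * ge 1 x).

Lemma rintg_moment7 : rintg mu (fun x => x ^+ 2 * (1 + `|x|) ^+ 5 * ge 1 x).
Proof.
apply: (@rintg_ge_poly _ 7).
  apply: measurable_funM; first exact: measurable_funX.
  by apply: measurable_funX; apply: measurable_funD => //; exact: measurableT_comp.
move=> x; rewrite normrM normrX [X in _ * X]ger0_norm ?exprn_ge0 ?addr_ge0//.
rewrite (_ : 7 = 2 + 5)%N// exprD ler_wpM2r ?exprn_ge0 ?addr_ge0//.
by rewrite lerXn2r ?nnegrE ?addr_ge0// lerDr.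
Qed.

(** The pairing is a free part, bounded by the moment of the data, and [c0] times a Duhamel part. In
    the latter [Duh_error] isolates a nonnegative real main term, whose size the reverse triangle
    inequality preserves. *)
Lemma pairing_lower : c0 R * (T * (A ^+ 2 * main_term - err * moment7)) -
    \int[mu]_x (normc (psi x) * normc (v0 x)) <=
  normc (cint mu (fun x => v T x * psi x)).
Proof.
have [mv cv _] := gv.
have cD : ccont (Duh b (Q v) T) := ccont_Duh b N0 T0 gv gv (lexx T).
have ipsi : cintg mu (@psi R).
  apply: cintg_real; apply: (@rintg_ge_poly _ 1) => // x.
  by rewrite expr1 lerDr.
have mpsi := cintg_meas ipsi.
have mD := ccont_meas cD.
have bv0 x : normc (v0 x) <= B0.
  apply: le_trans (hv0 x) _; rewrite ler_piMr//.
  apply: le_trans (W_le_exp N0 T0 x (ltW T0)) _.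
  by rewrite -[leRHS]expR0 ler_expR oppr_le0 mulr_ge0// invr_ge0 ltW.
pose f x := kawahara_multiplier b T x * v0 x * psi x.
pose g x := (x ^+ 2 * ge 1 x)%:C * Duh b (Q v) T x.
have i_f : cintg mu f.
  apply: (@cintgM_bnd _ _ R mu _ _ B0) => //.
    apply: cmeasM; [exact: ccont_meas (ccont_mult b T)|exact: ccont_meas].
  by move=> x; rewrite normcM normc_mult mul1r.
have is2 : rintg mu (fun x => T * (A ^+ 2 * (x ^+ 2 * ge 1 x * selfconv w x))).
  by do 2 apply: rintgZ; exact: rintg_selfconv_ge.
have i7 : rintg mu (fun x => T * (err * (x ^+ 2 * (1 + `|x|) ^+ 5 * ge 1 x))).
  by do 2 apply: rintgZ; exact: rintg_moment7.
pose h x := g x - (T * (A ^+ 2 * (x ^+ 2 * ge 1 x * selfconv w x)))%:C.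
have mg : cmeas g.
  apply: cmeasM => //; apply: cmeas_real; apply: measurable_funM.
    exact: measurable_funX.
  exact: measurable_ge.
have hh x : normc (h x) <= T * (err * (x ^+ 2 * (1 + `|x|) ^+ 5 * ge 1 x)).
  have -> : h x = (x ^+ 2 * ge 1 x)%:C *
      (Duh b (Q v) T x - (T * (A ^+ 2 * selfconv w x))%:C).
    rewrite /h /g; move: (Duh _ _ _ _) => z.
    apply: complexP; rewrite ?(ReD, ReM, ImD, ImM, ReN, ImN) /=; ring.
  have h1 := Duh_error b1 N1 T0 A0 B00 G10 gv fixv hv0 w0 w1 iw hG x.
  have p0 : 0 <= x ^+ 2 * ge 1 x by apply: mulr_ge0; [exact: sqr_ge0|exact: ge_ge0].
  rewrite normcM normc_real ger0_norm//.
  apply: le_trans (ler_wpM2l p0 h1) _.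
  by rewrite le_eqVlt; apply/orP; left; apply/eqP; rewrite -/err; ring.
have ih : cintg mu h.
  by apply: (@cintg_dom _ _ R mu _ _ _ i7 hh); apply: cmeasB => //; exact: cintg_meas (cintg_real is2).
have ig : cintg mu g.
  have -> : g = fun x => h x + (T * (A ^+ 2 * (x ^+ 2 * ge 1 x * selfconv w x)))%:C.
    by apply/funext => x; rewrite /h subrK.
  by apply: cintgD => //; exact: cintg_real.
have Eg : cint mu g = cint mu h + (T * (A ^+ 2 * main_term))%:C.
  have -> : T * (A ^+ 2 * main_term) =
      \int[mu]_x (T * (A ^+ 2 * (x ^+ 2 * ge 1 x * selfconv w x))).
    rewrite RintegralZl//; last by apply: rintgZ; exact: rintg_selfconv_ge.
    by rewrite RintegralZl//; exact: rintg_selfconv_ge.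
  rewrite -cint_real// -cintD//; last exact: cintg_real.
  by apply: eq_cint => x; rewrite /h subrK.
have lh : normc (cint mu h) <= T * (err * moment7).
  apply: le_trans (normc_cint_le (cintg_meas ih) i7 hh) _.
  by rewrite !RintegralZl//; [exact: rintg_moment7|apply: rintgZ; exact: rintg_moment7].
have Ev : cint mu (fun x => v T x * psi x) = cint mu f - 'i * (c0 R)%:C * cint mu g.
  rewrite -cintZ// -cintB//; last exact: cintgZ.
  apply: eq_cint => x; rewrite fixv /Phi chi_in ?(ltW T0) ?lexx//.
  rewrite /f /g /psi; move: (Duh _ _ _ _) (kawahara_multiplier _ _ _) (v0 x) => z1 z2 z3.
  apply: complexP; rewrite ?(ReD, ReM, ImD, ImM, ReN, ImN) /=; ring.
have lf : normc (cint mu f) <= \int[mu]_x (normc (psi x) * normc (v0 x)).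
  apply: le_trans (normc_cint i_f) _; rewrite le_eqVlt; apply/orP; left; apply/eqP.
  apply: eq_Rintegral => x _; rewrite /f normcM normcM normc_mult mul1r mulrC//.
rewrite Ev Eg.
have main0 : 0 <= main_term.
  by apply: Rintegral_ge0 => x _; apply: mulr_ge0; [apply: mulr_ge0; [exact: sqr_ge0|exact: ge_ge0]|exact: selfconv_ge0].
pose K := T * (A ^+ 2 * main_term).
have K0 : 0 <= K by rewrite /K !mulr_ge0 ?sqr_ge0// ltW.
have ni : normc ('i * (c0 R)%:C : R[i]) = c0 R.
  rewrite normcM normc_real ger0_norm ?(ltW (c0_gt0 R))//.
  by rewrite normcE /= expr0n /= add0r expr1n sqrtr1 mul1r.
move: lh lf; rewrite -/K; move: (cint mu h) (cint mu f) (Rintegral _ _ _) => zh zf I lh lf.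
have h1 : K - T * (err * moment7) <= normc (zh + K%:C).
  have := le_normcB (K%:C) (- zh); rewrite opprK normc_real ger0_norm// normc_opp.
  by rewrite (addrC _ zh); lra.
have h2 := le_normcB ('i * (c0 R)%:C * (zh + K%:C)) zf.
rewrite (normcM _ (zh + K%:C)) ni normc_dist in h2.
have h3 := ler_wpM2l (ltW (c0_gt0 R)) h1.
rewrite (_ : T * (A ^+ 2 * main_term - err * moment7) = K - T * (err * moment7)); last first.
  by rewrite /K mulrBr.
lra.
Qed.

(** For [x] in [[1, 2]] and [y] in [[N + 3, 2 N - 3]] both [y] and [x - y] belong to the region
    where [m <= w]: opposite high frequencies interact to a low one. *)
Lemma main_term_lower (m : R) : 0 <= m ->
  (forall x, N + 1 <= `|x| -> `|x| <= 2 * N - 1 -> m <= w x) -> 6 <= N ->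
  ge 1 2 * (m ^+ 2 * (N - 6)) <= main_term.
Proof.
move=> m0 mw N6.
rewrite -[leLHS]mulr1; apply: (@Rintegral_ge_chi _ _ 1 1) => //.
- exact: rintg_selfconv_ge.
- by move=> x; apply: mulr_ge0; [apply: mulr_ge0; [exact: sqr_ge0|exact: ge_ge0]|exact: selfconv_ge0].
move=> x /andP[x1 x2]; apply: ler_pM.
- exact: ge_ge0.
- by rewrite mulr_ge0 ?sqr_ge0// subr_ge0.
- have h : ge 1 2 <= ge 1 x.
    rewrite ler_expR lerN2 ler_wpM2r// ler_wpM2l ?sqr_ge0// lerXn2r ?nnegrE//; lra.
  rewrite -[leLHS]mul1r; apply: ler_pM => //; first exact: ge_ge0.
  by rewrite exprn_ege1.
apply: (@Rintegral_ge_chi _ _ (N + 3) (N - 6)).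
- exact: selfconv_intg.
- by move=> y; rewrite mulr_ge0.
- by rewrite subr_ge0.
move=> y /andP[y1 y2].
have yp : 0 <= y by lra.
have d0 : x - y <= 0 by lra.
rewrite expr2; apply: ler_pM => //; apply: mw; rewrite ?(ger0_norm yp) ?(ler0_norm d0); lra.
Qed.

End PairingLower.

(** * Inflation of the Sobolev norm *)

Section WeightedNorm.
Variable R : realType.
Notation mu := (@lebesgue_measure R).
Implicit Types (f g psi : R -> R[i]) (U : @functional R) (s C : R).

Lemma L2_cauchy f g : cmeas f -> cmeas g ->
  (\int[mu]_x (normc (f x) * normc (g x))%:E <= L2norm f * L2norm g)%E.
Proof.
move=> mf mg.
have := @hoelder _ _ R mu (fun x => normc (f x)) (fun x => normc (g x)) 2 2
  (measurable_normc mf) (measurable_normc mg) (ltr0n _ 2) (ltr0n _ 2) _.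
rewrite Lnorm1 -[X in (X + X)%R]div1r -splitr => /(_ erefl); apply: le_trans.
apply: ge0_le_integral => //.
- by move=> x _; rewrite lee_fin mulr_ge0 ?normc_ge0.
- by apply/measurable_EFinP; apply: measurable_funM; exact: measurable_normc.
- do 2 apply: measurableT_comp => //; apply: measurable_funM; exact: measurable_normc.
- by move=> x _; rewrite /= lee_fin ler_norm.
Qed.

Lemma rintg_L2norm f : cmeas f -> (L2norm f < +oo)%E -> rintg mu (fun x => normc (f x) ^+ 2).
Proof.
move=> mf; rewrite L2normE => h.
have m2 : measurable_fun setT (fun x => normc (f x) ^+ 2).
  by apply: measurable_funX; exact: measurable_normc.
apply/integrableP; split; first exact/measurable_EFinP.
have -> : (\int[mu]_x `|(normc (f x) ^+ 2)%:E| =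
    \int[mu]_x (normc (f x) ^+ 2)%:E)%E.
  by apply: eq_integral => x _; rewrite gee0_abs// lee_fin sqr_ge0.
by apply: lty_poweRy h; rewrite invr_eq0.
Qed.

Definition wmul s f xi : R[i] := ((1 + xi ^+ 2) `^ (s / 2))%:C * f xi.

Lemma cmeas_wmul s f : cmeas f -> cmeas (wmul s f).
Proof.
move=> mf; apply: cmeasM => //; apply: cmeas_real.
exact: (@measurable_om R (s / 2)).
Qed.

Lemma normc_wmul s f x : normc (wmul s f x) = (1 + x ^+ 2) `^ (s / 2) * normc (f x).
Proof. by rewrite normcM normc_real ger0_norm ?powR_ge0. Qed.

Lemma sqr_wmul s f x : normc (wmul s f x) ^+ 2 = wsq s f x.
Proof. by rewrite normc_wmul exprMn om_half. Qed.

(** Duality of [H^s] and [H^(-s)] by Cauchy-Schwarz, for each representative of the Fourier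
    transform; if there is none, the infimum is [+oo]. *)
Lemma Hs_lower U s psi C : 0 < C -> schwartz psi ->
  (L2norm (wmul (- s) psi) <= C%:E)%E ->
  ((normc (U (fourier psi)) / C)%:E <= Hs_norm s U)%E.
Proof.
move=> C0 spsi hpsi; apply: le_ereal_inf_tmp => _ [g [mg rg] <-].
have [ig ->] : cintg mu (fun x => g x * psi x) /\ U (fourier psi) = distr_of g psi := rg psi spsi.
have mpsi : cmeas psi by exact: cintg_meas (test_cintg spsi).
have nz (x : R) : normc (wmul s g x) * normc (wmul (- s) psi x) = normc (g x * psi x).
  rewrite !normc_wmul mulrACA -powRD; last first.
    by apply/implyP => _; rewrite gt_eqF ?bracket_gt0.
  by rewrite -mulrDl subrr mul0r powRr0 mul1r normcM.
have h1 : ((normc (distr_of g psi))%:E <= L2norm (wmul s g) * C%:E)%E.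
  apply: (@le_trans _ _ (\int[mu]_x (normc (g x * psi x))%:E)%E).
    by rewrite -Rintegral_EFin ?lee_fin; [exact: normc_cint|exact: cintg_normc].
  under eq_integral do rewrite -nz.
  apply: le_trans (L2_cauchy (cmeas_wmul s mg) (cmeas_wmul (- s) mpsi)) _.
  by apply: lee_pmul => //; exact: L2norm_ge0.
rewrite -/(wmul s g); have := L2norm_ge0 (wmul s g); move: h1.
case: (L2norm _) => [r||] //=; last by move=> *; rewrite leey.
by rewrite -EFinM !lee_fin => h _; rewrite ler_pdivrMr.
Qed.

Lemma Hs_upper U s g C : represented_by (distr_fourier U) g ->
  (L2norm (wmul s g) <= C%:E)%E -> (Hs_norm s U <= C%:E)%E.
Proof. by move=> rg; apply: le_trans; apply: ereal_inf_lbound; exists g. Qed.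

Lemma inHs_represented U s : inHs s U ->
  exists2 g, represented_by (distr_fourier U) g & rintg mu (wsq s g).
Proof.
move=> [_ /ereal_inf_lt [_ [g rg <-] h]]; exists g => //.
have [mg _] := rg.
have := rintg_L2norm (cmeas_wmul s mg) h.
by under eq_fun do rewrite sqr_wmul.
Qed.

(** It bounds the norm itself, since [I <= (1 + I)^2] for [I >= 0], and it is positive. *)
Definition psi_norm s : R := 1 + \int[mu]_x wsq (- s) (@psi R) x.

Lemma psi_norm_gt0 s : 0 < psi_norm s.
Proof.
by rewrite ltr_pwDl//; apply: Rintegral_ge0 => x _; exact: wsq_ge0.
Qed.

Lemma L2norm_psi s : s <= 0 -> (L2norm (wmul (- s) (@psi R)) <= (psi_norm s)%:E)%E.
Proof.
move=> s0.
have mpsi : cmeas (@psi R) by exact: cintg_meas (test_cintg (schwartz_xge ltr01)).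
have iG : rintg mu (wsq (- s) (@psi R)).
  have c_0 : 0 <= 2 * (- s) + 2 by lra.
  apply: (@rintg_dom _ _ R mu _ _ _ (rintg_expR_ge c_0)); first exact: measurable_wsq.
  move=> x; rewrite ger0_norm ?wsq_ge0// /wsq.
  have h2 : om (- s) x <= expR (2 * (- s) * `|x|).
    rewrite /om /powR gt_eqF ?bracket_gt0// ler_expR (_ : 2 * - s * `|x| = - s * (2 * `|x|)); last by ring.
    rewrite ler_wpM2l ?oppr_ge0// -[leRHS]expRK ler_ln ?posrE ?expR_gt0 ?bracket_gt0//.
    exact: bracket_expR.
  have h3 : normc (psi x) ^+ 2 <= expR (2 * `|x|) * ge 1 x.
    rewrite /psi normc_real normrM (ger0_norm (ge_ge0 _ _)) exprMn.
    apply: ler_pM; rewrite ?sqr_ge0//.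
      apply: le_trans (bracket_expR x); rewrite (real_normK (num_real x)); lra.
    by rewrite expr2 ler_piMr ?ge_ge0// ge_le1.
  apply: le_trans (ler_pM (om_ge0 _ _) (sqr_ge0 _) h2 h3) _.
  by rewrite mulrA -expRD -mulrDl.
apply: (@L2norm_dom _ _ (wsq (- s) (@psi R))) => //.
- exact/ltW/psi_norm_gt0.
- exact: cmeas_wmul.
- by move=> x; rewrite sqr_wmul.
have I0 : 0 <= \int[mu]_x wsq (- s) (@psi R) x.
  by apply: Rintegral_ge0 => x _; exact: wsq_ge0.
rewrite /psi_norm; move: I0; move: (Rintegral _ _ _) => I I0; nra.
Qed.

End WeightedNorm.

(** * The inflating data and their solution *)

Section InflatingData.
Variable R : realType.
Notation mu := (@lebesgue_measure R).
Implicit Types (x y r : R).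

Variables (b d M : R) (g1 : R -> R[i]).
Hypotheses (b1 : `|b| <= 1) (d0 : 0 < d) (mg1 : cmeas g1).
Hypotheses (g1M : forall x, normc (g1 x) <= M) (g10 : forall x, M < `|x| -> g1 x = 0).

(** The constant of [data_W], uniform in [N], [A] and [T]. The profile decays at rate [3 / N]: two
    units are the rate of [W] at time 0, the third yields [hw N] at the price of a factor 4.
    Mollification contributes [2 * expR (9 * d ^+ 2)], as [3 / N <= 3]. *)
Definition amp : R := 8 * expR (9 * d ^+ 2) * (M * expR (3 * M) + expR 6).

(** The constant of the part of the data that approximates the given function; it decays at rate 1,
    independently of [N] and [A]. *)
Definition base : R := M * expR M * (2 * expR (1 ^+ 2 * d ^+ 2)).

Let M0 : 0 <= M. Proof. by apply: le_trans (g1M 0); exact: normc_ge0. Qed.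

Lemma amp_ge0 : 0 <= amp.
Proof. by apply: mulr_ge0; [exact: mulr_ge0|rewrite addr_ge0// mulr_ge0]. Qed.

Lemma base_ge0 : 0 <= base.
Proof. by apply: mulr_ge0; [rewrite mulr_ge0|rewrite mulr_ge0]. Qed.

Let g1_exp (c x : R) : 0 <= c -> normc (g1 x) <= M * expR (c * M) * expR (- (c * `|x|)).
Proof.
move=> c_0; have [xM|xM] := leP `|x| M; last first.
  by rewrite g10// (normc_real 0) normr0 !mulr_ge0.
apply: le_trans (g1M x) _; rewrite -mulrA ler_peMr// -expRD -[leLHS]expR0 ler_expR.
by rewrite -mulrBr mulr_ge0// subr_ge0.
Qed.

Lemma base_bound x : normc (gc d g1 x) <= base * expR (- `|x|).
Proof.
have g1e y : normc (g1 y) <= M * expR M * expR (- (1 * `|y|)).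
  by have := g1_exp y ler01; rewrite (mul1r M).
by have := gc_decay x d0 mg1 ler01 g1e; rewrite (mul1r `|x|).
Qed.

Variables (N A T : R).
Hypotheses (N1 : 1 <= N) (A1 : 1 <= A) (T0 : 0 < T).
Hypothesis small : 8 * kappa N T * (amp * A) <= 1.

Definition profile x : R[i] := g1 x + A%:C * (box N x)%:C.

Definition data x : R[i] := gc d profile x.

Let N0 : 0 < N. Proof. exact: lt_le_trans N1. Qed.
Let A0 : 0 <= A. Proof. exact: le_trans A1. Qed.

Lemma cmeas_profile : cmeas profile.
Proof.
by apply: cmeasD => //; apply: cmeasM; [exact: cmeas_cst|exact: cmeas_box].
Qed.

(** Both parts are compactly supported: [|x| <= M] costs [expR (3 * M)] and [|x| <= 2 * N] costs
    [expR 6]. *)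
Lemma profile_exp x : normc (profile x) <=
  (M * expR (3 * M) + expR 6) * A * expR (- (3 / N * `|x|)).
Proof.
have c_0 : 0 <= 3 / N by rewrite divr_ge0// ltW.
have c3 : 3 / N <= 3 by rewrite ler_pdivrMr// ler_peMr.
apply: le_trans (normcD _ _) _.
rewrite (mulrDl _ _ A) (mulrDl _ _ (expR _)); apply: lerD.
  apply: le_trans (g1_exp x c_0) _; rewrite ler_wpM2r ?expR_ge0//.
  apply: (@le_trans _ _ (M * expR (3 * M))); last by rewrite ler_peMr// mulr_ge0.
  by rewrite ler_wpM2l// ler_expR ler_wpM2r.
rewrite normcM !normc_real (ger0_norm A0) (ger0_norm (box_ge0 _ _)) mulrAC [leLHS]mulrC.
rewrite ler_wpM2r// /box; case: ifPn => [/andP[_ x2]|_]; last by rewrite mulr_ge0.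
rewrite -expRD -[leLHS]expR0 ler_expR subr_ge0 mulrAC ler_pdivrMr//.
by rewrite (_ : 6 * N = 3 * (2 * N)) ?ler_wpM2l//; ring.
Qed.

Lemma profile_bnd x : normc (profile x) <= M + A.
Proof.
apply: le_trans (normcD _ _) _; apply: lerD => //.
by rewrite normcM !normc_real !ger0_norm ?box_ge0// ler_piMr// box_le1.
Qed.

Lemma dataE x : data x = gc d g1 x + (A * bump d N x)%:C.
Proof.
have mb : cmeas (fun x => A%:C * (box N x)%:C : R[i]).
  by apply: cmeasM; [exact: cmeas_cst|exact: cmeas_box].
rewrite /data /profile (@gcD _ _ d0 _ _ (M + A))//.
- congr (_ + _); rewrite (@gcZ _ _ d0 _ 1); [|exact: cmeas_box|exact: normc_box].
  rewrite gc_box//; move: (bump d N x) => z.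
  by apply: complexP; rewrite ?ReM ?ImM /= !(mul0r, mulr0, subr0, addr0).
- by move=> z; apply: le_trans (g1M z) _; rewrite lerDl.
- move=> z; rewrite normcM !normc_real !ger0_norm ?box_ge0//.
  by apply: (@le_trans _ _ A); rewrite ?ler_piMr ?box_le1// lerDr.
Qed.

Let c3 : 0 < 3 / N. Proof. by rewrite divr_gt0. Qed.

Lemma ccont_data : ccont data.
Proof. exact: (ccont_gc d0 c3 cmeas_profile profile_exp). Qed.

Lemma data_W x : normc (data x) <= amp * A * W N T 0 x.
Proof.
have h := gc_decay x d0 cmeas_profile (ltW c3) profile_exp.
apply: le_trans h _.
set P := M * expR (3 * M) + expR 6.
have P0 : 0 <= P by rewrite addr_ge0// mulr_ge0.
have -> : amp * A * W N T 0 x =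
   P * A * (2 * expR (9 * d ^+ 2)) * (4 * W N T 0 x) by rewrite /amp -/P; ring.
apply: ler_pM; rewrite ?expR_ge0//.
- by apply: mulr_ge0; apply: mulr_ge0.
- apply: ler_wpM2l; first exact: mulr_ge0.
  rewrite ler_wpM2l// ler_expR ler_wpM2r ?sqr_ge0//.
  rewrite (_ : 9 = 3 ^+ 2 :> R); last by ring.
  rewrite lerXn2r ?nnegrE ?(ltW c3)//.
  by rewrite ler_pdivrMr// ler_peMr.
have -> : expR (- (3 / N * `|x|)) = expR (- (alpha N T 0 * `|x|)) * expR (- (`|x| / N)).
  rewrite -expRD /alpha mul0r subr0; congr expR; ring.
rewrite /W [leRHS]mulrCA ler_wpM2l ?expR_ge0//; exact: expR_hw.
Qed.

Lemma data_bnd x : normc (data x) <= M + A.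
Proof. exact: gc_bound d0 cmeas_profile profile_bnd. Qed.

Let v := picard_lim b T data.

Let gv : good N T (2 * (amp * A)) v.
Proof. exact: (picard_lim_good b N0 T0 ccont_data data_W small). Qed.

Let fixv t x : v t x = Phi b T data v t x.
Proof. exact: (picard_lim_fixpoint b N0 T0 ccont_data data_W small). Qed.

Let cintg_data : cintg mu data.
Proof.
apply: (cintg_exp c3 (ccont_meas ccont_data)) => x.
exact: gc_decay d0 cmeas_profile (ltW c3) profile_exp.
Qed.

Lemma schwartz_data : schwartz (ifourier data).
Proof.
have -> : ifourier data = fun x => (ge d x)%:C * ifourier profile x.
  by apply/funext => x; exact: (ifourier_gc x d0 c3 cmeas_profile profile_exp).
apply: (schwartz_ge_ifourier d0); split; first exact: cmeas_profile.
exists ((M * expR (3 * M) + expR 6) * A), (3 / N); split => //; last exact: profile_exp.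
by rewrite mulr_ge0// addr_ge0// mulr_ge0.
Qed.

Let iu0 : cintg mu (ifourier data). Proof. exact: test_cintg schwartz_data. Qed.

(** The third clause says that [data] represents the Fourier transform of [u 0], which the estimate
    of the distance to the given distribution requires; the last one feeds [Hs_lower]. *)
Lemma inflating_solution : exists u : R -> R -> R[i],
  [/\ u 0 = ifourier data, kawahara_solution b T (u 0) u,
   (forall psi, schwartz psi -> cintg mu (fun x => data x * psi x) /\
      distr_of (u 0) (fourier psi) = cint mu (fun x => data x * psi x)) &
   c0 R * (T * (A ^+ 2 * main_term (bump d N) -
      duh_err N T A (amp * A) (2 * (amp * A)) base * moment7 R)) -
    \int[mu]_x (normc (@psi R x) * normc (data x)) <=
   normc (distr_of (u T) (fourier (@psi R)))].
Proof.
have u0 : sol v 0 = ifourier data by rewrite /sol (v_init N0 T0 gv fixv).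
exists (sol v); split => //.
- exact: (sol_kawahara N0 T0 gv fixv ccont_data cintg_data data_bnd iu0).
- move=> psi spsi; have ip := test_cintg spsi.
  split; first exact: (@cintgM_bnd _ _ R mu _ _ _ (ccont_meas ccont_data) data_bnd ip).
  by rewrite u0; exact: (free_pairing ccont_data cintg_data data_bnd iu0 ip).
have spsi : schwartz (@psi R) := schwartz_xge ltr01.
have ip := test_cintg spsi; have [ifp _] := phi_cintg spsi.
have iF : cintg mu (fourier (@psi R)).
  have -> : fourier (@psi R) = fun x => ifourier (@psi R) (0 - x).
    by apply/funext => x; rewrite fourierE sub0r.
  exact: cintg_reflection.
have cp : ccont (@psi R) by have := schwartz_ccont 0 spsi; rewrite cderiven0.
rewrite (sol_pairing N0 T0 gv T ip cp iF).
have iw := integrable_bump d0 N1.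
have hG x : normc (data x - (A * bump d N x)%:C) <= base * expR (- `|x|).
  by rewrite dataE addrK; exact: base_bound.
apply: (pairing_lower b1 N1 T0 A0 _ base_ge0 gv fixv ccont_data data_W _ _ iw hG).
- by rewrite mulr_ge0// amp_ge0.
- exact: bump_ge0.
- exact: bump_le1.
Qed.

End InflatingData.

(** * Choice of the scales *)

Section ScaleChoice.
Variable R : realType.

Lemma powR_small (p eta : R) : p < 0 -> 0 < eta ->
  exists2 x0 : R, 0 < x0 & forall x, x0 <= x -> x `^ p <= eta.
Proof.
move=> p0 e0; exists (eta `^ p^-1); first exact: powR_gt0.
move=> x hx; have x_gt0 : 0 < x by apply: lt_le_trans hx; exact: powR_gt0.
rewrite -(opprK p) powRN -[leRHS]invrK lef_pV2 ?posrE ?powR_gt0 ?invr_gt0//.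
have -> : eta^-1 = (eta `^ p^-1) `^ (- p).
  by rewrite -powRrM mulrN mulVf ?lt_eqF// powR_inv1// ltW.
by apply: ge0_ler_powR; rewrite ?oppr_ge0 ?nnegrE ?powR_ge0// ltW.
Qed.

(* The scaling [N = n^2, A = L n^3, T = 1 / (L n^8)] makes [T A^2 N = L] while
   [T N^4 = 1 / L] and [kappa A] is of order [1 / n]. *)
Lemma duh_err_scaled (K G1 L n : R) : L != 0 -> n != 0 ->
  (L * n ^+ 8)^-1 * duh_err (n ^+ 2) (L * n ^+ 8)^-1 (L * n ^+ 3)
    (K * (L * n ^+ 3)) (2 * (K * (L * n ^+ 3))) G1 =
  4 * pi * (c0 R * (4 * pi) * (12 * K ^+ 3)) * (L / n) +
  4 * pi * (40 * 256 * K ^+ 2) + 4 * pi * G1 * (K + 1) * (n ^+ 5)^-1.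
Proof.
move=> L0 n0; rewrite /duh_err /kappa; move: (c0 R) pi => c p.
by field; rewrite L0 n0.
Qed.

Lemma kappa_scaled (K L n : R) : L != 0 -> n != 0 ->
  8 * kappa (n ^+ 2) (L * n ^+ 8)^-1 * (K * (L * n ^+ 3)) = 8 * c0 R * (4 * pi) * K / n.
Proof.
move=> L0 n0; rewrite /kappa; move: (c0 R) pi => c p.
by field; rewrite L0 n0.
Qed.

(** The order of choice matters: [L] is fixed first, large against [Y] and against errors that are
    uniform in [n], and then [n] is taken large depending on [L]. *)
Lemma inflation_scales (K G1 beta Cb C5 C7 s eta Y eps : R) : 0 <= K -> 0 <= G1 -> 0 < beta ->
  0 <= Cb -> 0 <= C5 -> 0 <= C7 -> s < -2 -> 0 < eta -> 0 < eps ->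
  exists N A T : R, [/\ 12 <= N, 1 <= A, 0 < T & T < eps] /\
    [/\ 8 * kappa N T * (K * A) <= 1,
      Y < c0 R * (T * (A ^+ 2 * (beta * (N - 6)) -
             duh_err N T A (K * A) (2 * (K * A)) G1 * C5)) -
           (G1 + A * (Cb * N `^ s)) * C7 &
      (A * (Cb * N `^ s)) ^+ 2 * (8 * pi * N) <= eta].
Proof.
move=> K0 G0 be0 Cb0 C50 C70 s2 et0 ep0.
have c00 := c0_gt0 R; have p0 := pi_gt0 R.
pose ea := 4 * pi * (c0 R * (4 * pi) * (12 * K ^+ 3)).
pose eb := 4 * pi * (40 * 256 * K ^+ 2).
pose ec := 4 * pi * G1 * (K + 1).
have ea0 : 0 <= ea.
  apply: mulr_ge0; first by apply: mulr_ge0 => //; exact: ltW.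
  apply: mulr_ge0; last by apply: mulr_ge0 => //; exact: exprn_ge0.
  by apply: mulr_ge0; [exact: ltW|apply: mulr_ge0 => //; exact: ltW].
have ec0 : 0 <= ec.
  apply: mulr_ge0; last exact: addr_ge0.
  by apply: mulr_ge0 => //; apply: mulr_ge0 => //; exact: ltW.
have eb0 : 0 <= eb.
  apply: mulr_ge0; first by apply: mulr_ge0; [exact: ler0n|exact: ltW].
  by apply: mulr_ge0; [apply: mulr_ge0; exact: ler0n|exact: exprn_ge0].
(* The right side of [duh_err_scaled] with [L / n] and [(n ^+ 5)^-1] replaced by 1, hence free of
   [L] and [n]. *)
pose E2 := ea + eb + ec.
have E20 : 0 <= E2 by apply: addr_ge0 => //; exact: addr_ge0.
pose V := c0 R * (E2 * C5) + (G1 + Cb) * C7 + `|Y| + 1.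
have V0 : 0 < V.
  apply: ltr_wpDl => //; apply: addr_ge0 => //; apply: addr_ge0.
    by apply: mulr_ge0; [exact: ltW|exact: mulr_ge0].
  by apply: mulr_ge0 => //; exact: addr_ge0.
have cb0 : 0 < c0 R * beta by exact: mulr_gt0.
(* Half of [c0 R * beta * L] exceeds [V], which collects [Y] and all subtracted terms; the other
   half is lost in passing from [N] to [N - 6]. *)
pose L := 1 + 2 * V / (c0 R * beta).
have L1 : 1 <= L by rewrite lerDl; apply: divr_ge0; [apply: mulr_ge0 => //; exact: ltW|exact: ltW].
have L0 : 0 < L by exact: lt_le_trans L1.
have LV : c0 R * beta * L = c0 R * beta + 2 * V.
  by rewrite /L mulrDr mulr1 [c0 R * beta * (_ / _)]mulrC divfK// gt_eqF.
pose D := 8 * pi * Cb ^+ 2 * L ^+ 2.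
have D0 : 0 <= D.
  apply: mulr_ge0; last exact: sqr_ge0.
  by apply: mulr_ge0; [apply: mulr_ge0 => //; exact: ltW|exact: sqr_ge0].
(* Chosen to satisfy [D * et <= eta] and [et <= 1], whence [D * et ^+ 2 <= eta]. *)
pose et := eta / (1 + D + eta).
have den0 : 0 < 1 + D + eta by lra.
have et_0 : 0 < et by exact: divr_gt0.
have et1 : et <= 1 by rewrite /et ler_pdivrMr// mul1r; lra.
have etD : D * et ^+ 2 <= eta.
  have h1 : D * et <= eta.
    rewrite /et mulrA ler_pdivrMr// mulrC ler_wpM2l ?(ltW et0)//; lra.
  apply: le_trans h1; rewrite expr2 mulrA ler_piMr//; exact: mulr_ge0 (ltW et_0).
have s20 : s + 2 < 0 by lra.
have [x0 x00 hx0] := powR_small s20 et_0.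
pose k1 := 8 * c0 R * (4 * pi) * K.
have k10 : 0 <= k1.
  apply: mulr_ge0 => //; apply: mulr_ge0; last by apply: mulr_ge0 => //; exact: ltW.
  by apply: mulr_ge0 => //; exact: ltW.
have ei0 : 0 < eps^-1 by rewrite invr_gt0.
(* The summands are nonnegative, and each of them is one of the required lower bounds for [n]. *)
pose n := 12 + L + k1 + x0 + eps^-1.
have n12 : 12 <= n by rewrite /n; lra.
have nL : L <= n by rewrite /n; lra.
have nk : k1 <= n by rewrite /n; lra.
have nx : x0 <= n by rewrite /n; lra.
have ne : eps^-1 < n by rewrite /n; lra.
clearbody n.
have n0 : 0 < n by lra.
have n1 : 1 <= n by lra.
have nn : n <= n ^+ 2 by rewrite expr2 ler_peMr// ltW.
have N12 : 12 <= n ^+ 2 by exact: le_trans nn.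
have N0 : 0 < n ^+ 2 by exact: exprn_gt0.
have nz : n != 0 by rewrite gt_eqF.
have Lz : L != 0 by rewrite gt_eqF.
have T0 : 0 < (L * n ^+ 8)^-1 by rewrite invr_gt0 mulr_gt0// exprn_gt0.
have Ln : L / n <= 1 by rewrite ler_pdivrMr// mul1r.
have Ns : (n ^+ 2) `^ s = (n ^+ 2) `^ (s + 2) / n ^+ 4.
  have -> : n ^+ 4 = (n ^+ 2) `^ 2 by rewrite powR_mulrn ?(ltW N0)// -exprM.
  by rewrite -powRN -powRD ?addrK//; apply/implyP => _; rewrite gt_eqF.
have Pe : (n ^+ 2) `^ (s + 2) <= et by apply: hx0; exact: le_trans nn.
have P0 : 0 <= (n ^+ 2) `^ (s + 2) by exact: powR_ge0.
exists (n ^+ 2), (L * n ^+ 3), (L * n ^+ 8)^-1; split; split => //.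
- by rewrite -[leLHS]mulr1; apply: ler_pM => //; exact: exprn_ege1.
- apply: le_lt_trans (_ : n^-1 < _); last by rewrite invf_plt.
  rewrite lef_pV2 ?posrE// ?mulr_gt0// ?exprn_gt0// exprS mulrCA ler_peMr ?(ltW n0)//.
  by rewrite -[leLHS]mulr1; apply: ler_pM => //; exact: exprn_ege1.
- by rewrite kappa_scaled// ler_pdivrMr// mul1r.
- have AN : L * n ^+ 3 * (Cb * (n ^+ 2) `^ s) <= Cb.
    rewrite Ns (_ : L * n ^+ 3 * (Cb * ((n ^+ 2) `^ (s + 2) / n ^+ 4)) =
      Cb * ((L / n) * (n ^+ 2) `^ (s + 2))); last first.
      by move: (_ `^ _) => z; field.
    rewrite ler_piMr// -[leRHS]mulr1 ler_pM//; first by rewrite divr_ge0// ltW.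
    exact: le_trans et1.
  have err : (L * n ^+ 8)^-1 * duh_err (n ^+ 2) (L * n ^+ 8)^-1 (L * n ^+ 3)
    (K * (L * n ^+ 3)) (2 * (K * (L * n ^+ 3))) G1 <= E2.
    rewrite duh_err_scaled// /E2 -/ea -/eb -/ec; apply: lerD.
      by rewrite lerD2r ler_piMr.
    by rewrite ler_piMr// invf_le1 ?exprn_gt0// exprn_ege1.
  (* Since [N = n ^+ 2] is at least 12, [N - 6] is at least [N / 2]. *)
  have main : L / 2 <= (L * n ^+ 8)^-1 * ((L * n ^+ 3) ^+ 2 * (n ^+ 2 - 6)).
    have -> : (L * n ^+ 8)^-1 * ((L * n ^+ 3) ^+ 2 * (n ^+ 2 - 6)) = L * (1 - 6 / n ^+ 2).
      by field; rewrite Lz nz.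
    rewrite ler_wpM2l ?(ltW L0)//.
    have : 6 / n ^+ 2 <= 1 / 2 by rewrite ler_pdivrMr//; lra.
    lra.
  set T := (L * n ^+ 8)^-1 in T0 err main *.
  set A := L * n ^+ 3 in AN err main *.
  set de := duh_err _ _ _ _ _ _ in err *.
  have h1 : c0 R * beta * (L / 2) <= c0 R * beta * (T * (A ^+ 2 * (n ^+ 2 - 6))).
    by rewrite ler_wpM2l// ltW.
  have h2 : c0 R * (T * de * C5) <= c0 R * (E2 * C5).
    by rewrite ler_wpM2l ?(ltW c00)// ler_wpM2r.
  have h3 : (G1 + A * (Cb * (n ^+ 2) `^ s)) * C7 <= (G1 + Cb) * C7.
    by rewrite ler_wpM2r// lerD2l.
  have hY := ler_norm Y.
  rewrite (_ : c0 R * (T * (A ^+ 2 * (beta * (n ^+ 2 - 6)) - de * C5)) =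
    c0 R * beta * (T * (A ^+ 2 * (n ^+ 2 - 6))) - c0 R * (T * de * C5)); last by ring.
  move: h1 h2 h3; rewrite (mulrA _ L) LV /V.
  move: (c0 R * beta * (T * _)) (c0 R * (T * de * C5)) ((G1 + A * _) * C7).
  move: (c0 R * (E2 * C5)) ((G1 + Cb) * C7) => *; lra.
- rewrite Ns; apply: le_trans etD.
  apply: (@le_trans _ _ (D * ((n ^+ 2) `^ (s + 2)) ^+ 2)).
    rewrite le_eqVlt /D; apply/orP; left; apply/eqP; move: (_ `^ _) pi => z p.
    by field.
  by rewrite ler_wpM2l// lerXn2r ?nnegrE// ltW.
Qed.

End ScaleChoice.

(** * Size of the data *)

Section DataEstimates.
Variable R : realType.
Notation mu := (@lebesgue_measure R).
Implicit Types (x y : R).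

Variables (d M : R) (g1 : R -> R[i]).
Hypotheses (d0 : 0 < d) (mg1 : cmeas g1).
Hypotheses (g1M : forall x, normc (g1 x) <= M) (g10 : forall x, M < `|x| -> g1 x = 0).
Variables (N A s : R).
Hypotheses (N1 : 1 <= N) (A1 : 1 <= A) (s0 : s <= -1).

Let N0 : 0 < N. Proof. exact: lt_le_trans N1. Qed.
Let A0 : 0 <= A. Proof. exact: le_trans A1. Qed.
Let sn0 : s <= 0. Proof. by apply: le_trans s0 _; rewrite lerN10. Qed.

Definition weighted_moment : R := \int[mu]_x (normc (@psi R x) * (1 + x ^+ 2) `^ (- s / 2)).

Let measurable_br : measurable_fun setT (fun x : R => (1 + x ^+ 2) `^ (- s / 2)).
Proof. exact: measurable_om. Qed.

Let normc_psi x : normc (psi x) = `|x| * ge 1 x.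
Proof. by rewrite normc_real normrM (ger0_norm (ge_ge0 _ _)). Qed.

Lemma rintg_weighted_moment : rintg mu (fun x => normc (@psi R x) * (1 + x ^+ 2) `^ (- s / 2)).
Proof.
have p0 : 0 <= - s / 2 by rewrite divr_ge0// oppr_ge0.
have c_0 : 0 <= 1 + 2 * (- s / 2) by rewrite addr_ge0// mulr_ge0.
apply: (@rintg_dom _ _ R mu _ _ _ (rintgZ (2 `^ (- s / 2)) (rintg_expR_ge c_0))).
  apply: measurable_funM => //; apply: measurable_normc.
  exact: cintg_meas (test_cintg (schwartz_xge ltr01)).
move=> x; rewrite ger0_norm ?mulr_ge0 ?normc_ge0 ?powR_ge0// normc_psi.
have h1 := bracket_powR_expR 0 x p0.
rewrite expr0n addr0 powR1 mulr1 subr0 in h1.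
have h2 := norm_le_expR x.
rewrite mulrDl expRD mul1r.
rewrite [leRHS](_ : _ = expR `|x| * ge 1 x * (2 `^ (- s / 2) * expR (2 * (- s / 2) * `|x|))); last by ring.
apply: ler_pM => //; [by rewrite mulr_ge0 ?ge_ge0|exact: powR_ge0|].
by rewrite ler_wpM2r ?ge_ge0.
Qed.

Lemma weighted_moment_ge0 : 0 <= weighted_moment.
Proof. by apply: Rintegral_ge0 => x _; rewrite mulr_ge0 ?normc_ge0 ?powR_ge0. Qed.

(** The test function sees only the tail of the block, which by [bump_upper] is of size [N^s]; this
    keeps the free part of the pairing bounded while [A] grows. *)
Lemma data_moment : \int[mu]_x (normc (@psi R x) * normc (data d g1 N A x)) <=
  (base d M + A * (bump_cst d s * N `^ s)) * weighted_moment.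
Proof.
have im := rintg_weighted_moment.
rewrite /weighted_moment -RintegralZl//.
have k x : normc (psi x) * normc (data d g1 N A x) <=
   (base d M + A * (bump_cst d s * N `^ s)) * (normc (@psi R x) * (1 + x ^+ 2) `^ (- s / 2)).
  rewrite [leRHS]mulrCA ler_wpM2l ?normc_ge0// (dataE d0 mg1 g1M)//.
  set q := (1 + x ^+ 2) `^ _.
  have q1 : 1 <= q.
    rewrite -[leLHS](powRr0 (1 + x ^+ 2)) ler_powR ?bracket_ge1//.
    by rewrite divr_ge0// oppr_ge0.
  apply: le_trans (normcD _ _) _; rewrite mulrDl; apply: lerD.
    apply: le_trans (base_bound d0 mg1 g1M g10 x) _; rewrite ler_wpM2l ?(base_ge0 d g1M)//.
    by apply: le_trans q1; rewrite -[leRHS]expR0 ler_expR oppr_le0.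
  rewrite normc_real ger0_norm ?mulr_ge0 ?bump_ge0//.
  have hb := bump_upper d0 N1 x sn0; rewrite -/q in hb.
  move: (bump_cst d s) (bump_cst_ge0 d s) hb => K K0 hb.
  rewrite -(mulrA A) ler_wpM2l//; apply: le_trans hb _; rewrite -(mulrA K) ler_wpM2l//.
  rewrite ler_piMr ?mulr_ge0 ?powR_ge0//.
  by rewrite -[leRHS]expR0 ler_expR oppr_le0 mulr_ge0// invr_ge0 ltW.
apply: (@le_Rintegral _ _ R mu _ _ _ measurableT _ (rintgZ _ im)) => //.
apply: (@rintg_dom _ _ R mu _ _ _ (rintgZ (base d M + A * (bump_cst d s * N `^ s)) im)).
- apply: measurable_funM; apply: measurable_normc.
  + exact: cintg_meas (test_cintg (schwartz_xge ltr01)).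
  + exact: ccont_meas (ccont_data d0 mg1 g1M g10 N1 A1).
- by move=> x; rewrite ger0_norm ?mulr_ge0 ?normc_ge0.
Qed.

(** The Sobolev weight cancels the polynomial factor of [bump_upper], and the integral of the
    exponential contributes the factor [N]. *)
Lemma data_close (g0 : R -> R[i]) (e : R) : cmeas g0 ->
  rintg mu (wsq s (fun x => gc d g1 x - g0 x)) ->
  \int[mu]_x wsq s (fun x => gc d g1 x - g0 x) x <= e ->
  rintg mu (wsq s (fun x => data d g1 N A x - g0 x)) /\
  \int[mu]_x wsq s (fun x => data d g1 N A x - g0 x) x <=
    2 * e + (A * (bump_cst d s * N `^ s)) ^+ 2 * (8 * pi * N).
Proof.
move=> mg0 ig eg.
pose B x : R[i] := (A * bump d N x)%:C.
have Ni : 0 < N^-1 by rewrite invr_gt0.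
have mB : cmeas B.
  by apply: cmeas_real; apply: measurable_funM => //; exact: (measurable_bump N d0).
have kB x : wsq s B x <= (A * (bump_cst d s * N `^ s)) ^+ 2 * expR (- (N^-1 * `|x|)).
  rewrite /wsq /B normc_real ger0_norm ?mulr_ge0 ?bump_ge0//.
  have h1 := bump_upper d0 N1 x sn0.
  have o0 : om s x * ((1 + x ^+ 2) `^ (- s / 2)) ^+ 2 = 1.
    rewrite om_half /om -powRD ?subrr ?powRr0//.
    by apply/implyP => _; rewrite gt_eqF ?bracket_gt0.
  set q := (1 + x ^+ 2) `^ _ in h1 o0.
  set E := expR _ in h1 *.
  have E1 : E <= 1 by rewrite -[leRHS]expR0 ler_expR oppr_le0 mulr_ge0// ltW.
  have h2 : (A * bump d N x) ^+ 2 <= (A * (bump_cst d s * (N `^ s * q * E))) ^+ 2.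
    have b0 := bump_ge0 N d0 x.
    have p1 : 0 <= A * bump d N x by exact: mulr_ge0.
    have p2 : A * bump d N x <= A * (bump_cst d s * (N `^ s * q * E)) by exact: ler_wpM2l.
    by rewrite lerXn2r ?nnegrE// (le_trans p1).
  apply: le_trans (ler_wpM2l (om_ge0 s x) h2) _.
  rewrite [leLHS](_ : _ = (A * (bump_cst d s * N `^ s)) ^+ 2 * (E * E) * (om s x * q ^+ 2)); last by ring.
  by rewrite o0 mulr1 ler_wpM2l ?sqr_ge0// ler_piMr// expR_ge0.
have iE := @rintgZ _ _ R mu ((A * (bump_cst d s * N `^ s)) ^+ 2) _ (rintg_expRc Ni).
have iB : rintg mu (wsq s B).
  apply: (@rintg_dom _ _ R mu _ _ _ iE); first exact: measurable_wsq.
  by move=> x; rewrite ger0_norm ?wsq_ge0.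
have lB : \int[mu]_x wsq s B x <= (A * (bump_cst d s * N `^ s)) ^+ 2 * (4 * (pi * N)).
  apply: le_trans (@le_Rintegral _ _ R mu _ _ _ measurableT iB iE (fun x _ => kB x)) _.
  rewrite RintegralZl//; last exact: rintg_expRc.
  by rewrite ler_wpM2l ?sqr_ge0// expR_decay_integral.
have mG : cmeas (fun x => gc d g1 x - g0 x).
  by apply: cmeasB => //; exact: cmeas_gc.
have [i1 l1] := rintg_wsqD mG mB ig iB.
have -> : (fun x => data d g1 N A x - g0 x) = fun x => gc d g1 x - g0 x + B x.
  by apply/funext => x; rewrite (dataE d0 mg1 g1M)// addrAC.
split; first exact: i1.
apply: le_trans l1 _; move: lB eg.
move: (Rintegral _ _ _) (Rintegral _ _ _) (_ ^+ 2) pi => a1 a2 c p h1 h2.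
rewrite (_ : 2 * e + c * (8 * p * N) = 2 * e + 2 * (c * (4 * (p * N)))); last by ring.
lra.
Qed.

End DataEstimates.

Theorem theorem1p2 (R : realType) (b : R) (hb : [\/ b = -1, b = 0 | b = 1])
    (s : R) (hs : s < -2)
    (phi : @functional R) (hphi : inHs s phi)
    (eps : R) (heps : 0 < eps) :
  exists (T : R) (u : R -> R -> R[i]) (t : R),
    [/\ 0 < t < eps, t <= T, schwartz (u 0) & kawahara_solution b T (u 0) u] /\
    (Hs_norm s (distr_of (u 0) \- phi)%R < eps%:E)%E /\
    (eps^-1%:E < Hs_norm s (distr_of (u t)))%E.
Proof.
have b1 : `|b| <= 1 by case: hb => ->; rewrite ?normrN ?normr1 ?normr0.
have s1 : s <= -1 by lra.
have sn0 : s <= 0 by lra.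
have [g0 rg0 ig0] := inHs_represented hphi; have [mg0 hg0] := rg0.
(* The squared distance will be at most [2 * (eps ^+ 2 / 8) + eps ^+ 2 / 4], that is [eps ^+ 2 / 2],
   below the square of [3 / 4 * eps]. *)
have e0 : 0 < eps ^+ 2 / 8 by rewrite divr_gt0// exprn_gt0.
have [g1 [M [d [d0 mg1 g1M g10 [iw lw]]]]] := weighted_density s1 e0 mg0 ig0.
have m0 : 0 < 2 * gk d 1 :> R by rewrite mulr_gt0// gk_gt0.
have ge0 : 0 < ge 1 2 :> R by exact: expR_gt0.
have be0 : 0 < ge 1 2 * (2 * gk d 1) ^+ 2 :> R by rewrite mulr_gt0// exprn_gt0.
have cb0 : 0 <= bump_cst d s.
  exact: bump_cst_ge0.
have m70 : 0 <= moment7 R.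
  apply: Rintegral_ge0 => x _; apply: mulr_ge0; last exact: ge_ge0.
  by rewrite mulr_ge0 ?sqr_ge0 ?exprn_ge0 ?addr_ge0.
have et0 : 0 < eps ^+ 2 / 4 by rewrite divr_gt0// exprn_gt0.
(* The target [psi_norm s / eps] becomes [eps^-1] after the division by [psi_norm s] in
   [Hs_lower]. *)
have [N [A [T [[N12 A1 T0 Te] [small main close]]]]] :=
  inflation_scales (psi_norm s / eps) (amp_ge0 d g1M) (base_ge0 d g1M) be0 cb0 m70
    (weighted_moment_ge0 s) hs et0 heps.
have N1 : 1 <= N by lra.
have [u [u0 usol uF uT]] := inflating_solution b1 d0 mg1 g1M g10 N1 A1 T0 small.
(* Inflation is observed at the end point of the life span, which [Te] puts below [eps]. *)
exists T, u, T; split; [split => //|split].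
- by rewrite T0.
- by rewrite u0; exact: (schwartz_data d0 mg1 g1M g10 N1 A1).
- have [iD lD] := data_close d0 mg1 g1M N1 A1 s1 mg0 iw lw.
  have mD : cmeas (data d g1 N A) by exact: ccont_meas (ccont_data d0 mg1 g1M g10 N1 A1).
  apply: (@le_lt_trans _ _ (3 / 4 * eps)%:E); last by rewrite lte_fin gtr_pMl// ltr_pdivrMr// mul1r ltr_nat.
  apply: (@Hs_upper _ _ _ (fun x => data d g1 N A x - g0 x)).
    split; first exact: (cmeasB mD mg0).
    move=> p sp; have [iu eu] := uF p sp; have [ip ep] := hg0 p sp.
    have e x : (data d g1 N A x - g0 x) * p x = data d g1 N A x * p x - g0 x * p x.
      by rewrite mulrBl.
    split.
      have := cintgB iu ip; rewrite /cintegrable.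
      by rewrite (_ : (fun x => (data d g1 N A x - g0 x) * p x) =
         fun x => data d g1 N A x * p x - g0 x * p x)//; apply/funext.
    rewrite /distr_fourier /= eu -[phi (fourier p)]/(distr_fourier phi p) ep.
    rewrite -[LHS](cintB iu ip); apply: eq_cint => x.
    by rewrite e.
  apply: (@L2norm_dom _ _ (wsq s (fun x => data d g1 N A x - g0 x))) => //.
  + by rewrite mulr_ge0// ltW.
  + exact: (cmeas_wmul s (cmeasB mD mg0)).
  + by move=> x; rewrite sqr_wmul.
  apply: le_trans lD _; apply: (@le_trans _ _ (2 * (eps ^+ 2 / 8) + eps ^+ 2 / 4)).
    by rewrite lerD2l.
  by have := sqr_ge0 eps; rewrite exprMn; lra.
have := Hs_lower (distr_of (u T)) (psi_norm_gt0 s) (schwartz_xge ltr01) (L2norm_psi sn0).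
apply: lt_le_trans; rewrite lte_fin ltr_pdivlMr ?psi_norm_gt0//.
(* The bounds [main] and [uT] differ in two places, settled by [data_moment] and by
   [main_term_lower]. *)
rewrite mulrC; apply: lt_le_trans uT; apply: lt_le_trans main _.
apply: lerB; last exact: data_moment.
rewrite ler_wpM2l ?(ltW (c0_gt0 R))// ler_wpM2l ?(ltW T0)// lerD2r.
rewrite ler_wpM2l ?sqr_ge0// -mulrA.
apply: main_term_lower => //.
- exact: bump_ge0.
- exact: bump_le1.
- exact: integrable_bump.
- exact: ltW.
- by move=> x x1 x2; exact: bump_lower.
- by apply: le_trans N12; rewrite ler_nat.
Qed.
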